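(* Let $\mathcal{E}$ be a regular Dirichlet form on $L^2(E,m)$ with domain $\mathcal{D}(\mathcal{E})$, with strongly local part $\mathcal{E}^{\mathrm{c}}$, jumping kernel $J$ and killing measure $k$, and let $p \in (1, \infty)$. Let $\mathcal{E}_p$ be the corresponding Sobolev--Bregman form with domain $\mathcal{D}(\mathcal{E}_p)$. Then \[ \mathcal{D}(\mathcal{E}_p) = \{u \in L^p(E) : u^{\langle p/2\rangle} \in \mathcal{D}(\mathcal{E})\} , \] and for every $u \in \mathcal{D}(\mathcal{E}_p)$ we have \[ \frac{4 (p - 1)}{p^2} \, \mathcal{E}(u^{\langle p/2\rangle}) \le \mathcal{E}_p(u) \le 2\, \mathcal{E}(u^{\langle p/2\rangle}) . \] Furthermore, for every $u \in \mathcal{D}(\mathcal{E}_p)$, \[ \mathcal{E}_p(u) = \frac{4 (p - 1)}{p^2} \, \mathcal{E}^{\mathrm{c}}(u^{\langle p/2\rangle}) + \frac{1}{2} \iint_{(E \times E) \setminus \Delta} (\tilde{u}(y) - \tilde{u}(x)) \bigl(\tilde{u}^{\langle p - 1\rangle}(y) - \tilde{u}^{\langle p - 1\rangle}(x)\bigr) J(dx, dy) + \int_E |\tilde{u}(x)|^p k(dx) , \qquad ( * ) \] where $\tilde{u}$ is the quasi-continuous modification of $u$. In particular, if $u \in \mathcal{D}(\mathcal{E}_p)$, then $u$ has a quasi-continuous modification $\tilde{u}$ such that both integrals in $( * )$ are finite. If the Dirichlet form $\mathcal{E}$ is maximally defined, then the converse is true: every $u \in L^p(E)$ which has a quasi-continuous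 modification $\tilde{u}$ such that the two integrals in $( * )$ are finite belongs to $\mathcal{D}(\mathcal{E}_p)$.
   Context: $E$ is a locally compact, separable metric space, $m$ is a Radon measure on $E$ with full support, and $L^p(E) = L^p(E,m)$ consists of real functions, identified when equal $m$-almost everywhere. For $s \in \mathbb{R}$ and $\alpha>0$, $s^{\langle\alpha\rangle} = |s|^\alpha \operatorname{sign} s$, and $u^{\langle\alpha\rangle}(x) = (u(x))^{\langle\alpha\rangle}$. $\Delta = \{(x,x) : x \in E\}$. For a symmetric bilinear form $\mathcal{A}$ we write $\mathcal{A}(u) = \mathcal{A}(u,u)$. Dirichlet form: a (densely defined, nonnegative) symmetric bilinear form $\mathcal{E}$ with domain $\mathcal{D}(\mathcal{E}) \subseteq L^2(E)$ which is closed and Markovian (if $u \in \mathcal{D}(\mathcal{E})$ and $|v(x)| \le |u(x)|$, $|v(x)-v(y)| \le |u(x)-u(y)|$ for all $x,y$, then $v \in \mathcal{D}(\mathcal{E})$ and $\mathcal{E}(v) \le \mathcal{E}(u)$). It is regular if the set of continuous compactly supported functions in $\mathcal{D}(\mathcal{E})$ is a core for $\mathcal{E}$ (dense in $\mathcal{D}(\mathcal{E})$ for the norm $(\mathcal{E}(u)+\|u\|_2^2)^{1/2}$, and uniformly dense in the continuous compactly supported functions). Semigroup: $T_t$ is the symmetric Markovian semigroup on $L^2(E)$ associated with $\mathcal{E}$, so that $\mathcal{E}(u,v) = \lim_{t\to0^+} \frac1t \int_E (u - T_t u)\, v\, dm$ for $u,v \in \mathcal{D}(\mathcal{E})$. It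 is given by a sub-probability kernel, $T_t u(x) = \int_E u(y) T_t(x,dy)$, and this formula extends $T_t$ to contractions on every $L^p(E)$, $p\in[1,\infty]$. Quasi-continuity: for open $A \subseteq E$ let $\operatorname{Cap}(A) = \inf\{\mathcal{E}(w) + \|w\|_2^2 : w \in \mathcal{D}(\mathcal{E}),\ w \ge 1 \ m\text{-a.e. on } A\}$. A function $u$ on $E$ is quasi-continuous (in the restricted sense) if for every $\varepsilon>0$ there is an open $G\subseteq E$ with $\operatorname{Cap}(G)<\varepsilon$ such that $u$, extended by $0$ at the point at infinity of the one-point compactification $E_\partial$ of $E$, is continuous on $E_\partial \setminus G$. A quasi-continuous modification $\tilde u$ of $u$ is a quasi-continuous (Borel) function equal to $u$ $m$-a.e.; every $u \in \mathcal{D}(\mathcal{E})$ has one. Beurling--Deny formula: every regular Dirichlet form can be written uniquely, for $u,v \in \mathcal{D}(\mathcal{E})$, as \[ \mathcal{E}(u,v) = \mathcal{E}^{\mathrm{c}}(u,v) + \frac12 \iint_{(E\times E)\setminus\Delta} (\tilde u(y)-\tilde u(x))(\tilde v(y)-\tilde v(x)) J(dx,dy) + \int_E \tilde u(x)\tilde v(x) k(dx) , \] where $\mathcal{E}^{\mathrm{c}}$ (the strongly local part) is a symmetric Markovian form defined on $\mathcal{D}(\mathcal{E})$ with $\mathcal{E}^{\mathrm{c}}(u,v)=0$ whenever $v$ is constant on a neighbourhood of the support of $u$, $J$ (the jumping kernel) is a symmetric Radon measure on $(E\times E)\setminus\Delta$, and $k$ (the killing measure) is a Radon measure on $E$. Note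 the factor $\frac12$ in the normalisation of $J$. Maximally defined: $\mathcal{E}$ is maximally defined if every $u \in L^2(E)$ which has a quasi-continuous modification $\tilde u$ such that both integrals $\iint_{(E\times E)\setminus\Delta} (\tilde u(y)-\tilde u(x))^2 J(dx,dy)$ and $\int_E (\tilde u(x))^2 k(dx)$ are finite belongs to $\mathcal{D}(\mathcal{E})$. Sobolev--Bregman form: for $p \in (1,\infty)$, \[ \mathcal{E}_p(u) = \lim_{t\to0^+} \frac1t \int_E (u(x) - T_t u(x))\, u^{\langle p-1\rangle}(x)\, m(dx) , \] with domain $\mathcal{D}(\mathcal{E}_p)$ consisting of those $u \in L^p(E)$ for which a finite limit exists. In particular $\mathcal{E}_2(u) = \mathcal{E}(u)$ with $\mathcal{D}(\mathcal{E}_2)=\mathcal{D}(\mathcal{E})$. *)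

(* Defs.v *)
From HB Require Import structures.
From mathcomp Require Import all_boot all_order all_algebra.
From mathcomp Require Import all_classical all_reals all_analysis.

Set Implicit Arguments.
Unset Strict Implicit.
Unset Printing Implicit Defensive.

Import Order.TTheory GRing.Theory Num.Theory.
Import numFieldNormedType.Exports.

Local Open Scope classical_set_scope.
Local Open Scope ring_scope.

HB.mixin Record Metric_isBorel (d : measure_display) (R : realType) T
    & Measurable d T & Metric R T := {
  measurable_borel : @measurable d T = <<s @open T >>
}.

#[short(type="borelMetricType")]
HB.structure Definition BorelMetric (d : measure_display) (R : realType) :=
  { T of Measurable d T & Metric R T & Metric_isBorel d R T }.

Definition offdiag {T : Type} : set (T * T) := [set z | z.1 <> z.2].

Section topology.
Context {R : realType} {T : topologicalType}.

Definition separable_space := exists2 S : set T, countable S & dense S.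

Definition Cc : set (T -> R) :=
  [set u | continuous u /\ compact (closure [set x | u x != 0])].

(* Radon measure on the subspace W of T, given as a measure on T of which only
   the values on subsets of W matter. *)
Definition radon_on (mu : set T -> \bar R) (M : set (set T)) (W : set T) :=
  (forall K, compact K -> K `<=` W -> (mu K < +oo)%E) /\
  (forall A, M A -> A `<=` W ->
    mu A = ereal_sup [set mu K | K in [set K | compact K /\ K `<=` A]]).

End topology.

(* s^<a> = |s|^a sign s; the value at s = 0 is 0 since Num.sg 0 = 0. *)
Definition spow {R : realType} (s a : R) : R := `|s| `^ a * Num.sg s.

Definition fspow {T : Type} {R : realType} (u : T -> R) (a : R) : T -> R :=
  fun x => spow (u x) a.

Section forms.
Context {d : measure_display} {R : realType} {E : borelMetricType d R}.
Implicit Types (m k : {measure set E -> \bar R}) (D : set (E -> R))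
  (A : (E -> R) -> (E -> R) -> R) (u v w f : E -> R).

Definition full_support m := forall U : set E, open U -> U !=set0 -> (0 < m U)%E.

Definition l2norm m u : R := fine ('N[m]_2%:E [EFin \o u])%E.

(* squared norm E_1(u) = E(u) + ||u||_2^2 *)
Definition form1 m A u : R := A u u + l2norm m u ^+ 2.

(* Forms are defined on functions rather than on classes modulo equality
   m-a.e., whence the two clauses on a.e. equal functions. *)
Record symmetric_form m D A : Prop := SymmetricForm {
  sf_L2 : forall u, D u -> u \in Lfun m 2%:E ;
  sf_ae : forall u v, D u -> measurable_fun setT v -> u = v %[ae m] -> D v ;
  sf_form_ae : forall u v w, D u -> D v -> D w -> u = v %[ae m] -> A u w = A v w ;
  sf_zero : D (cst 0) ;
  sf_lin : forall a u v, D u -> D v -> D (fun x => a * u x + v x) ;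
  sf_form_sym : forall u v, D u -> D v -> A u v = A v u ;
  sf_form_lin : forall a u v w, D u -> D v -> D w ->
    A (fun x => a * u x + v x) w = a * A u w + A v w ;
  sf_form_ge0 : forall u, D u -> 0 <= A u u
}.

Definition normal_contraction v u := (forall x, `|v x| <= `|u x|) /\
  (forall x y, `|v x - v y| <= `|u x - u y|).

Definition markovian D A :=
  forall u v, D u -> normal_contraction v u -> D v /\ A v v <= A u u.

Definition L2_dense m D :=
  forall f, f \in Lfun m 2%:E -> forall e, 0 < e ->
    exists2 u, D u & l2norm m (f \- u) < e.

Definition closed_form m D A :=
  forall s : nat -> E -> R, (forall n, D (s n)) ->
    (forall e, 0 < e -> exists N, forall i j, (N <= i)%N -> (N <= j)%N ->
      form1 m A (s i \- s j) < e) ->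
    exists2 u, D u & form1 m A (s n \- u) @[n --> \oo] --> 0.

Record dirichlet_form m D A : Prop := DirichletForm {
  df_form : symmetric_form m D A ;
  df_dense : L2_dense m D ;
  df_closed : closed_form m D A ;
  df_markov : markovian D A
}.

Record regular m D A : Prop := Regular {
  reg_form : forall u, D u -> forall e, 0 < e ->
    exists w, [/\ D w, Cc w & form1 m A (u \- w) < e] ;
  reg_unif : forall f, Cc f -> forall e, 0 < e ->
    exists w, [/\ D w, Cc w & forall x, `|f x - w x| < e]
}.

Definition capacity m D A (U : set E) : \bar R :=
  ereal_inf [set (form1 m A w)%:E
            | w in [set w | D w /\ {ae m, forall x, U x -> 1 <= w x}]].

Definition extend0 u : one_point_compactification E -> R :=
  fun z => if z is Some x then u x else 0.

Definition quasi_continuous m D A u :=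
  forall e : R, 0 < e -> exists G : set E,
    [/\ open G, (capacity m D A G < e%:E)%E &
      {within ~` (Some @` G : set (one_point_compactification E)),
        continuous (extend0 u)}].

Definition qc_modification m D A u ut :=
  [/\ measurable_fun setT ut, quasi_continuous m D A ut & ut = u %[ae m]].

(* support of the measure |u| m *)
Definition ess_support m u : set E :=
  ~` \bigcup_(U in [set U | open U /\ {ae m, forall x, U x -> u x = 0}]) U.

Definition strongly_local m D A :=
  forall u v, D u -> D v ->
    (exists G c, [/\ open G, ess_support m u `<=` G &
      {ae m, forall x, G x -> v x = c}]) ->
    A u v = 0.

Definition jump_integrand u v (z : E * E) : R :=
  (u z.2 - u z.1) * (v z.2 - v z.1).

Implicit Types (J : {measure set (E * E)%type -> \bar R}).

(* A Radon measure on (E x E) \ Delta is encoded by its extension by 0 to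
   E x E.  The product sigma-algebra on E x E is the Borel one, as E is
   separable and metric. *)
Record jumping_kernel J : Prop := JumpingKernel {
  jk_radon : radon_on J measurable offdiag ;
  jk_diag : J (~` offdiag) = 0%E ;
  jk_sym : forall B, measurable B -> J [set z | B (z.2, z.1)] = J B
}.

Record beurling_deny m D A (Ac : (E -> R) -> (E -> R) -> R) J k : Prop :=
  BeurlingDeny {
  bd_local_form : symmetric_form m D Ac ;
  bd_local_markov : markovian D Ac ;
  bd_local : strongly_local m D Ac ;
  bd_jump : jumping_kernel J ;
  bd_kill : radon_on k measurable setT ;
  bd_formula : forall u v ut vt, D u -> D v ->
    qc_modification m D A u ut -> qc_modification m D A v vt ->
    [/\ J.-integrable offdiag (EFin \o jump_integrand ut vt),
        k.-integrable setT (fun x => (ut x * vt x)%:E) &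
        A u v = Ac u v
          + 2^-1 * \int[J]_(z in offdiag) jump_integrand ut vt z
          + \int[k]_x (ut x * vt x)]
}.

Definition kernel_op (K : R.-spker E ~> E) u : E -> R :=
  fun x => \int[K x]_y u y.

(* t^-1 \int (u - T_t u) v dm *)
Definition approx_form m (T : R -> R.-spker E ~> E) u v (t : R) : R :=
  t^-1 * \int[m]_x ((u x - kernel_op (T t) u x) * v x).

Record semigroup_of m D A (T : R -> R.-spker E ~> E) : Prop := SemigroupOf {
  sg_contraction : forall t u, 0 < t -> u \in Lfun m 2%:E ->
    kernel_op (T t) u \in Lfun m 2%:E /\
    l2norm m (kernel_op (T t) u) <= l2norm m u ;
  sg_sym : forall t u v, 0 < t -> u \in Lfun m 2%:E -> v \in Lfun m 2%:E ->
    \int[m]_x (kernel_op (T t) u x * v x) =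
    \int[m]_x (u x * kernel_op (T t) v x) ;
  sg_add : forall s t u, 0 < s -> 0 < t -> u \in Lfun m 2%:E ->
    kernel_op (T (s + t)) u = kernel_op (T s) (kernel_op (T t) u) %[ae m] ;
  sg_cont : forall u, u \in Lfun m 2%:E ->
    l2norm m (kernel_op (T t) u \- u) @[t --> 0^'+] --> 0 ;
  sg_domain : forall u, D u <->
    u \in Lfun m 2%:E /\ cvg (approx_form m T u u @ 0^'+) ;
  sg_form : forall u v, D u -> D v -> approx_form m T u v @ 0^'+ --> A u v
}.

Definition maximally_defined m D A J k :=
  forall u, u \in Lfun m 2%:E ->
    (exists ut, [/\ qc_modification m D A u ut,
      (\int[J]_(z in offdiag) ((ut z.2 - ut z.1) ^+ 2)%:E < +oo)%E &
      (\int[k]_x (ut x ^+ 2)%:E < +oo)%E]) ->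
    D u.

Definition sb_dom m (T : R -> R.-spker E ~> E) (p : R) : set (E -> R) :=
  [set u | u \in Lfun m p%:E /\
           cvg (approx_form m T u (fspow u (p - 1)) @ 0^'+)].

Definition sb_form m (T : R -> R.-spker E ~> E) (p : R) u : R :=
  lim (approx_form m T u (fspow u (p - 1)) @ 0^'+).

Definition sb_jump J (p : R) u : \bar R :=
  \int[J]_(z in offdiag) (jump_integrand u (fspow u (p - 1)) z)%:E.

Definition sb_kill k (p : R) u : \bar R := \int[k]_x (`|u x| `^ p)%:E.

End forms.

(* Main.v *)
(* Put [v = u^<p/2>], [a = 2/p], [f = s^<a>] and [g = s^<2-a>], so that
   [u = f(v)] and [u^<p-1> = g(v)].  The elementary inequality
   [a(2-a)(y-x)^2 <= (f y - f x)(g y - g x) <= 2(y-x)^2] compares the energies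
   of (f(v), g(v)) and (v, v): for every [t], the approximate form is a positive
   functional of such increments, by the symmetry of the kernel of [T_t].  As
   the approximate form of (v, v) increases when [t] decreases to 0, a finite
   limit for [E_p(u)] puts [v] in the domain of [E].

   For the limit itself [f] and [g] are replaced by odd Lipschitz truncations,
   which are flat near 0 and near infinity.  The error is controlled by a small
   multiple of [E(v)] and by the energies of [v] clamped near 0 and of the excess
   of [v] over a large level, which vanish by Markovianity and weak convergence.
   The same comparison applies to the jumping and killing parts, and the
   truncations of [f(v)] and [g(v)] belong to the domain of [E], where the
   Beurling-Deny formula is available.

   Finally [E^c(f(v), g(v)) = a(2-a) E^c(v)] for the truncated powers: strong
   locality makes the contributions of different level intervals of [v]
   orthogonal, and on short intervals [f] and [g] are close to affine functions
   whose slopes have product [a(2-a)]. *)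
Require Import Defs.
From HB Require Import structures.
From mathcomp Require Import all_boot all_order all_algebra.
From mathcomp Require Import all_classical all_reals all_analysis.
From mathcomp Require Import measurable_realfun.
From mathcomp Require Import ring lra.

Import Order.TTheory GRing.Theory Num.Theory.
Import numFieldNormedType.Exports.

Local Open Scope classical_set_scope.
Local Open Scope ring_scope.

Set Implicit Arguments.
Unset Strict Implicit.
Unset Printing Implicit Defensive.

(** * Signed powers *)

(** The exponents of [f] and [g] add up to 2, so unless [p = 2] one is below 1 and the other above
    1: one power is not Lipschitz at 0, the other not at infinity. Neither [f(v)] nor [g(v)] need
    lie in [D], and the limit of their approximate forms cannot be read off from the polarised form.
    The truncation error must therefore be uniform in [t]. This is why it is stated as an inequality
    between increments of real functions: it can be integrated against every [T t] and against [J]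
    and [k] alike, and its error terms are energies of [v] and of contractions of [v], which [A]
    bounds for all [t] at once. The constant [a * (2 - a)] is 4(p - 1)/p^2. The upper constant 2 is
    due to increments between values of opposite signs; for values of the same sign it is 1. *)

Section real_functions.
Context {R : realType}.
Implicit Types (x y z s t a b r k : R).

Lemma mean_value (f df : R -> R) x y : x <= y ->
  (forall z, x <= z <= y -> is_derive z 1 f (df z)) ->
  exists2 z, x <= z <= y & f y - f x = df z * (y - x).
Proof.
move=> xy fD; have [z||z zxy ->] := @MVT_segment R f df x y xy.
- by rewrite in_itv/= => /andP[xz zy]; apply: fD; rewrite !ltW.
- apply: derivable_within_continuous => z; rewrite in_itv/= => zxy.
  by have := fD _ zxy => ?; exact: ex_derive.
by exists z => //; rewrite in_itv/= in zxy.
Qed.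

(** Up to a factor 2, sinh(kz) <= k sinh z. The difference of the two sides vanishes at 0 and has
    derivative 2k(cosh z - cosh(kz)), which is nonnegative because t + 1/t increases for t >= 1. *)
Lemma sinh_scale_le k z : 0 <= k <= 1 -> 0 <= z ->
  expR (k * z) - expR (- (k * z)) <= k * (expR z - expR (- z)).
Proof.
move=> /andP[k0 k1] z0.
pose f z := k * (expR z - expR (- z)) - (expR (k * z) - expR (- (k * z))).
pose df z := k * (expR z + expR (- z)) - (k * expR (k * z) + k * expR (- (k * z))).
have fD x : 0 <= x <= z -> is_derive x 1 f (df x).
  move=> _; rewrite /f /df; apply: is_derive_eq.
  by rewrite /GRing.scale/=; ring.
have [x /andP[x0 _]] := mean_value z0 fD.
have f0 : f 0 = 0 by rewrite /f !mulr0 oppr0 expR0 !subrr mulr0 subr0.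
rewrite f0 !subr0 => E.
suff: 0 <= df x by move=> ?; rewrite -subr_ge0 -[leRHS]/(f z) E mulr_ge0.
have -> : df x = k * (expR x + (expR x)^-1 - expR (k * x) - (expR (k * x))^-1).
  by rewrite /df !expRN; ring.
apply: mulr_ge0 => //.
have p1 : 1 <= expR (k * x) by rewrite -expR0 ler_expR mulr_ge0.
have pq : expR (k * x) <= expR x by rewrite ler_expR ler_piMl.
set p := expR (k * x) in p1 pq *; set q := expR x in pq *.
have p0 : 0 < p := lt_le_trans ltr01 p1.
have q0 : 0 < q := lt_le_trans p0 pq.
have -> : q + q^-1 - p - p^-1 = (q - p) * (1 - (p * q)^-1).
  by field; rewrite !gt_eqF.
by rewrite mulr_ge0 ?subr_ge0// invf_le1 ?mulr_gt0// mulr_ege1// (le_trans p1).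
Qed.

Lemma sqr_sinh_scale_le k z : -1 <= k <= 1 -> 0 <= z ->
  (expR (k * z) - expR (- (k * z))) ^+ 2 <= k ^+ 2 * (expR z - expR (- z)) ^+ 2.
Proof.
move=> /andP[kN1 k1] z0.
wlog k0 : k kN1 k1 / 0 <= k.
  move=> wlg; have [k0|k0] := leP 0 k; first exact: wlg.
  have := wlg (- k); rewrite mulNr opprK sqrrN => H.
  by rewrite -sqrrN opprB; apply: H; lra.
have S : 0 <= expR (k * z) - expR (- (k * z)).
  by rewrite subr_ge0 ler_expR ge0_cp ?mulr_ge0.
rewrite -exprMn lerXn2r// ?nnegrE ?sinh_scale_le ?k0//.
by rewrite (le_trans S)// sinh_scale_le ?k0.
Qed.

Lemma spow0 a : spow 0 a = 0 :> R.
Proof. by rewrite /spow sgr0 mulr0. Qed.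

Lemma spowN s a : spow (- s) a = - spow s a.
Proof. by rewrite /spow normrN sgrN mulrN. Qed.

Lemma spow_gt0E s a : 0 < s -> spow s a = s `^ a.
Proof. by move=> s0; rewrite /spow gtr0_norm// gtr0_sg// mulr1. Qed.

Lemma spow_ge0 s a : 0 <= s -> 0 <= spow s a.
Proof.
by rewrite le_eqVlt => /predU1P[<-|s0]; rewrite ?spow0// spow_gt0E// powR_ge0.
Qed.

Lemma spow_homo a : 0 <= a -> {homo (fun s => spow s a) : x y / x <= y}.
Proof.
move=> a0.
have pos x y : 0 <= x -> x <= y -> spow x a <= spow y a.
  rewrite le_eqVlt => /predU1P[<- y0|x0 xy]; first by rewrite spow0 spow_ge0.
  have y0 := lt_le_trans x0 xy.
  by rewrite !spow_gt0E// ge0_ler_powR// nnegrE ltW.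
move=> x y xy; have [x0|x0] := leP 0 x; first exact: pos.
have [y0|y0] := leP 0 y.
  apply: (@le_trans _ _ 0); last exact: spow_ge0.
  by rewrite -oppr_ge0 -spowN spow_ge0// oppr_ge0 ltW.
by rewrite -lerN2 -!spowN; apply: pos; rewrite ?lerN2// oppr_ge0 ltW.
Qed.

(** The case [a + b = 0] is excluded because [spow] vanishes at 0, whereas [powR] with exponent 0 is
    1 even there. *)
Lemma spowM s a b : a + b != 0 -> spow s a * spow s b = `|s| `^ (a + b).
Proof.
move=> ab; have [->|s0] := eqVneq s 0; first by rewrite !spow0 normr0 powR0// mulr0.
rewrite /spow powRD ?normr_eq0 ?s0 ?implybT//.
by rewrite mulrACA -expr2 sqr_sg s0 mulr1.
Qed.

Lemma normr_spow s a : a != 0 -> `|spow s a| = `|s| `^ a.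
Proof.
move=> a0; have [->|s0] := eqVneq s 0; first by rewrite spow0 normr0 powR0.
by rewrite /spow normrM normr_sg s0 mulr1 ger0_norm// powR_ge0.
Qed.

Lemma spow_spow s a b : spow (spow s a) b = spow s (a * b).
Proof.
have pos x : 0 < x -> spow (spow x a) b = spow x (a * b).
  by move=> x0; rewrite !spow_gt0E ?powRrM// powR_gt0.
have [s0|s0|->] := ltgtP s 0; last by rewrite !spow0.
- by apply: oppr_inj; rewrite -!spowN pos// oppr_gt0.
- exact: pos.
Qed.

Lemma spow1 s : spow s 1 = s.
Proof. by rewrite /spow powRr1// mulrC -numEsg. Qed.

Lemma continuous_spow a : 0 < a -> continuous (fun s => spow s a).
Proof.
move=> a0.
have pos x : 0 < x -> {for x, continuous (fun s => spow s a)}.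
  move=> x0; apply: (@cvg_trans _ (s `^ a @[s --> x])).
    apply: near_eq_cvg; near=> y; rewrite spow_gt0E//.
    by near: y; exact: lt_nbhsr.
  rewrite spow_gt0E//; have /differentiable_continuous : differentiable (@powR R ^~ a) x; last by apply.
  apply/derivable1_diffP.
  by have := is_derive1_powR a x0 => ?; exact: ex_derive.
have at0 : spow s a @[s --> (0 : R)] --> (0 : R).
  apply/cvgr0Pnorm_lt => e e0; exists (e `^ a^-1) => /=; first exact: powR_gt0.
  move=> y /=; rewrite sub0r normrN normr_spow ?gt_eqF// => ye.
  have -> : e = (e `^ a^-1) `^ a by rewrite -powRrM mulVf ?gt_eqF// powRr1// ltW.
  by apply: gt0_ltr_powR => //; rewrite ?nnegrE ?powR_ge0.
move=> x; have [x0|x0|->] := ltgtP x 0.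
- have E : (fun s => spow s a) = -%R \o ((fun s => spow s a) \o -%R).
    by apply/funext => s /=; rewrite spowN opprK.
  rewrite {1}E; apply: continuous_comp => /=; last exact: opp_continuous.
  apply: continuous_comp => /=; first exact: opp_continuous.
  by apply: pos; rewrite oppr_gt0.
- exact: pos.
- by rewrite /continuous_at spow0; exact: at0.
Unshelve. all: by end_near. Qed.

(* Writing [x = exp X] and [y = exp Y], the identity behind both bounds is
   [H = e^(X+Y) (e^d + e^-d - e^(kd) - e^-(kd))] with [d = X - Y], [k = a - 1]. *)
Lemma powR_increments_bounds a x y : 0 < a < 2 -> 0 < x -> 0 < y ->
  a * (2 - a) * (y - x) ^+ 2 <=
    (y `^ a - x `^ a) * (y `^ (2 - a) - x `^ (2 - a)) <= (y - x) ^+ 2.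
Proof.
move=> /andP[a0 a2] x0 y0.
have [X xE] := expR_total x0; have [Y yE] := expR_total y0.
rewrite -xE -yE {x y x0 y0 xE yE}.
rewrite -!expRM.
wlog: X Y / X <= Y.
  move=> wlg; have [/wlg//|/ltW/wlg] := leP X Y.
  by rewrite (_ : (expR (X * a) - _) * _ = (expR (Y * a) - expR (X * a)) *
    (expR (Y * (2 - a)) - expR (X * (2 - a)))); [rewrite (_ : (expR X - _) ^+ 2 =
    (expR Y - expR X) ^+ 2)//; ring|ring].
(* With half the difference, the bracket of the identity becomes a difference of squares, (2 sinh
   z)^2 - (2 sinh(gz))^2, and [a * (2 - a) = 1 - g ^+ 2]. *)
move=> XY; pose z := (Y - X) / 2; pose e := expR ((X + Y) / 2).
have z0 : 0 <= z by rewrite /z divr_ge0// subr_ge0.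
have eX : expR X = e * expR (- z) by rewrite /e -expRD; congr expR; rewrite /z; field.
have eY : expR Y = e * expR z by rewrite /e -expRD; congr expR; rewrite /z; field.
pose g := a - 1.
have E : (expR (Y * a) - expR (X * a)) * (expR (Y * (2 - a)) - expR (X * (2 - a))) =
  e ^+ 2 * ((expR z - expR (- z)) ^+ 2 - (expR (g * z) - expR (- (g * z))) ^+ 2).
  have -> : Y * a = (X + Y) / 2 * a + (z + g * z) by rewrite /g /z; field.
  have -> : X * a = (X + Y) / 2 * a - (z + g * z) by rewrite /g /z; field.
  have -> : Y * (2 - a) = (X + Y) / 2 * (2 - a) + (z - g * z) by rewrite /g /z; field.
  have -> : X * (2 - a) = (X + Y) / 2 * (2 - a) - (z - g * z) by rewrite /g /z; field.
  rewrite !(expRB, expRD, expRN).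
  have -> : e ^+ 2 = expR ((X + Y) / 2 * a) * expR ((X + Y) / 2 * (2 - a)).
    by rewrite /e expr2 -!expRD; congr expR; field.
  by field; rewrite !gt_eqF ?expR_gt0.
have gz : (expR (g * z) - expR (- (g * z))) ^+ 2 <= g ^+ 2 * (expR z - expR (- z)) ^+ 2.
  by apply: sqr_sinh_scale_le => //; rewrite /g; lra.
rewrite E eX eY; set u := expR z - _ in gz *; set w := expR (g * z) - _ in gz *.
have -> : e * expR z - e * expR (- z) = e * u by rewrite /u; ring.
have -> : a * (2 - a) = 1 - g ^+ 2 by rewrite /g; ring.
rewrite exprMn mulrCA ler_wpM2l ?sqr_ge0//= ; last lra.
by rewrite ler_wpM2l ?sqr_ge0// gerBl sqr_ge0.
Qed.

(** For x < 0 < y, let H' be the product of the increments between -x and y. Since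
    [spow z a * spow z (2 - a) = z ^+ 2], the product sought is 2(x^2 + y^2) - H'. From 0 <= H' <=
    (x + y)^2 it lies between (y - x)^2 and 2(y - x)^2. *)
Lemma spow_increments_bounds a x y : 0 < a < 2 ->
  a * (2 - a) * (y - x) ^+ 2 <=
    (spow y a - spow x a) * (spow y (2 - a) - spow x (2 - a)) <= 2 * (y - x) ^+ 2.
Proof.
move=> a02; have /andP[a0 a2] := a02.
have c1 : a * (2 - a) <= 1 by have := sqr_ge0 (a - 1); rewrite expr2; nra.
have sq z : spow z a * spow z (2 - a) = z ^+ 2.
  rewrite spowM; last by rewrite addrC subrK.
  by rewrite addrC subrK (powR_mulrn 2) ?normr_ge0// real_normK// num_real.
wlog xy : x y / x <= y.
  move=> wlg; have [/wlg//|/ltW/wlg] := leP x y.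
  rewrite -(opprB x) -(opprB (spow x a)) -(opprB (spow x (2 - a))).
  by rewrite mulrNN sqrrN.
have pos u w : 0 < u -> 0 < w -> a * (2 - a) * (w - u) ^+ 2 <=
    (spow w a - spow u a) * (spow w (2 - a) - spow u (2 - a)) <= (w - u) ^+ 2.
  by move=> u0 w0; rewrite !spow_gt0E//; exact: powR_increments_bounds.
have [y0|y0|yE] := ltgtP y 0.
- have := pos (- y) (- x); rewrite !oppr_gt0 y0 (le_lt_trans xy y0) => /(_ isT isT).
  rewrite !spowN !opprK !(addrC (- _)) => /andP[-> /le_trans]; apply.
  by rewrite ler_peMl ?sqr_ge0// ler1n.
- have [x0|x0|xE] := ltgtP x 0; last first.
  + rewrite xE !spow0 !subr0 sq; have := sqr_ge0 y; set q := y ^+ 2 => q0.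
    by apply/andP; split; [rewrite ler_piMl|rewrite ler_peMl// ler1n].
  + have := pos x y x0 y0 => /andP[-> /le_trans]; apply.
    by rewrite ler_peMl ?sqr_ge0// ler1n.
  + have := pos (- x) y; rewrite oppr_gt0 x0 => /(_ isT y0).
    have := sq x; have := sq y; rewrite !spowN !opprK.
    set p := spow y a; set p' := spow y _; set q := spow x a; set q' := spow x _.
    have := sqr_ge0 (y + x); have : 0 <= - x * y by rewrite mulr_ge0 ?ltW// oppr_gt0.
    rewrite !expr2 => xy0 S pp' qq' /andP[L U].
    have cS : 0 <= a * (2 - a) * ((y + x) * (y + x)) by apply: mulr_ge0 => //; apply: mulr_ge0; lra.
    apply/andP; split; last by nra.
    have : (y - x) * (y - x) <= (p - q) * (p' - q') by nra.
    by apply: le_trans; rewrite ler_piMl// -expr2 sqr_ge0.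
- rewrite yE !spow0 !sub0r mulrNN sqrrN sq; have := sqr_ge0 x; set q := x ^+ 2 => q0.
  by apply/andP; split; [rewrite ler_piMl|rewrite ler_peMl// ler1n].
Qed.

(** Mean value theorem twice: for the power, then for its derivative between [r] and the
    intermediate point. As [a - 2 < 0], the lower bound [k] can replace [r] in the constant, which
    is then the same for all intervals to the right of [k], as the subdivision in [cut_chain]
    requires. *)
Lemma powR_taylor a k r h x y : 0 < a < 2 -> 0 < k <= r ->
  r <= x <= r + h -> r <= y <= r + h ->
  `|x `^ a - y `^ a - a * r `^ (a - 1) * (x - y)|
    <= a * `|a - 1| * k `^ (a - 2) * h * `|x - y|.
Proof.
move=> /andP[a0 a2] /andP[k0 kr].
wlog xy : x y / y <= x.
  move=> wlg; have [/wlg//|/ltW/wlg H xr yr] := leP y x.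
  have -> : x `^ a - y `^ a - a * r `^ (a - 1) * (x - y) =
      - (y `^ a - x `^ a - a * r `^ (a - 1) * (y - x)) by ring.
  by rewrite normrN (distrC x) H.
move=> /andP[rx xh] /andP[ry yh].
have r0 := lt_le_trans k0 kr.
have D b z : r <= z -> is_derive z 1 (@powR R ^~ b) (b * z `^ (b - 1)).
  by move=> rz; apply: is_derive1_powR; exact: lt_le_trans rz.
have [z /andP[yz zx]|z /andP[yz zx] ->] := mean_value xy (f := @powR R ^~ a) (df := fun z => a * z `^ (a - 1)).
  by apply: D; exact: le_trans yz.
have rz := le_trans ry yz.
have [w /andP[rw wz]|w /andP[rw wz] E] := mean_value rz (f := @powR R ^~ (a - 1)) (df := fun z => (a - 1) * z `^ (a - 1 - 1)).
  exact: D.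
rewrite -mulrBl -mulrBr E !normrM (gtr0_norm a0) ler_wpM2r//.
rewrite -!mulrA ler_wpM2l ?(ltW a0)// ler_wpM2l//.
rewrite ger0_norm ?powR_ge0// ger0_norm ?subr_ge0//.
apply: ler_pM; rewrite ?powR_ge0 ?subr_ge0//; last by lra.
rewrite (_ : a - 1 - 1 = - (2 - a)); last by ring.
rewrite (_ : a - 2 = - (2 - a)); last by ring.
have w0 := lt_le_trans r0 rw.
rewrite !powRN lef_pV2 ?posrE ?powR_gt0//.
apply: ge0_ler_powR; rewrite ?nnegrE ?subr_ge0 ?(ltW k0) ?(ltW w0) ?(ltW a2)//.
exact: le_trans kr rw.
Qed.

End real_functions.

(** * Truncations *)

Section truncation.
Context {R : realType}.
Implicit Types (x y z s t a b r k M : R) (f g : R -> R).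

Definition clamp r s x := Num.min (Num.max x r) s.
Definition cut f r s x := f (clamp r s x) - f r.
(** For [0 <= r <= s] this is the odd function that vanishes on [-r, r], equals f - f(r) on [r, s]
    and is constant beyond. Keeping the halves as separate cuts lets strong locality treat positive
    and negative values of [v] independently. *)
Definition trunc f r s x := cut f r s x - cut f r s (- x).

(** Both [f] and [id - f] are nondecreasing and vanish at 0. So both act as normal contractions, and
    their increments have the same sign, which makes their mixed energy nonnegative. *)
Definition half_contraction f := f 0 = 0 /\
  forall x y, x <= y -> 0 <= f y - f x <= y - x.

Lemma clampP r s x : r <= s ->
  [\/ x <= r /\ clamp r s x = r, r <= x <= s /\ clamp r s x = x |
      s <= x /\ clamp r s x = s].
Proof.
move=> rs; rewrite /clamp; have [xr|rx] := leP x r.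
  by constructor 1; rewrite min_l.
have [xs|sx] := leP x s.
  by constructor 2; rewrite ltW.
by constructor 3; rewrite ltW.
Qed.

Lemma half_contractionN f : half_contraction f -> half_contraction (fun x => x - f x).
Proof.
move=> [f0 fD]; split; first by rewrite f0 subr0.
by move=> x y xy; have := fD _ _ xy; lra.
Qed.

Lemma half_contraction_clamp k : 0 <= k -> half_contraction (clamp (- k) k).
Proof.
move=> k0; have kk : - k <= k by lra.
split; first by case: (clampP 0 kk) => -[]; lra.
by move=> x y xy; case: (clampP x kk) => -[+ ->]; case: (clampP y kk) => -[+ ->]; lra.
Qed.

Lemma half_contraction_max0 : half_contraction (Num.max 0).
Proof.
split; first by rewrite maxxx.
by move=> x y xy; case: (leP 0 x) => ?; case: (leP 0 y) => ?; lra.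
Qed.

Lemma half_contraction_min k : 0 <= k -> half_contraction (Num.min k).
Proof.
move=> k0; split; first by rewrite min_r.
by move=> x y xy; case: (leP k x) => ?; case: (leP k y) => ?; lra.
Qed.

Lemma half_contraction_norm f x y : half_contraction f -> `|f x - f y| <= `|x - y|.
Proof.
move=> [_ fD]; wlog xy : x y / x <= y.
  move=> wlg; have [/wlg//|/ltW/wlg] := leP x y.
  by rewrite distrC (distrC x).
rewrite (distrC (f x)) (distrC x); have /andP[? ?] := fD _ _ xy.
by rewrite !ger0_norm// subr_ge0.
Qed.

Lemma clamp_homo r s : r <= s -> {homo clamp r s : x y / x <= y}.
Proof.
by move=> rs x y xy; case: (clampP x rs) => -[+ ->]; case: (clampP y rs) => -[+ ->]; lra.
Qed.

Lemma cutD f r s t x : r <= s <= t -> cut f r t x = cut f r s x + cut f s t x.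
Proof.
move=> /andP[rs st]; have rt := le_trans rs st; rewrite /cut.
have [xs|/ltW sx] := leP x s.
- have -> : clamp s t x = s by case: (clampP x st) => -[+ ->]; lra.
  have -> : clamp r t x = clamp r s x.
    by case: (clampP x rs) => -[+ ->]; case: (clampP x rt) => -[+ ->]; lra.
  by rewrite subrr addr0.
- have -> : clamp r s x = s by case: (clampP x rs) => -[+ ->]; lra.
  have -> : clamp r t x = clamp s t x.
    by case: (clampP x st) => -[+ ->]; case: (clampP x rt) => -[+ ->]; lra.
  by ring.
Qed.

Lemma clamp_id k B x : - B <= x -> x <= B -> B <= k -> clamp (- k) k x = x.
Proof.
move=> Bx xB Bk; have kk : - k <= k by lra.
by case: (clampP x kk) => -[+ ->]; lra.
Qed.

(** Here B is the larger of |x| and |y|, and the endpoint of modulus B exceeds the level by B - s >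
    B/2. If the other endpoint lies beyond the same level, the excess changes by exactly y - x;
    otherwise it changes by at least B - s, while y - x <= 2B < 4(B - s). *)
Lemma distance_to_clamp s B x y : 0 < s -> 2 * s < B -> - B <= x -> x <= y ->
  y <= B -> B = y \/ B = - x -> y - x <= 4 * ((y - clamp (- s) s y) - (x - clamp (- s) s x)).
Proof.
move=> s0 sB Bx xy yB; have ss : - s <= s by lra.
by case: (clampP x ss) => -[+ ->]; case: (clampP y ss) => -[+ ->]; case; lra.
Qed.

Lemma cut_le0 f r s x : r <= s -> x <= r -> cut f r s x = 0.
Proof.
move=> rs xr; rewrite /cut (_ : clamp r s x = r) ?subrr//.
by case: (clampP x rs) => -[+ ->]; lra.
Qed.

Section truncation_of_odd.
Variables (f : R -> R) (r s : R).
Hypotheses (f_homo : {homo f : x y / x <= y}) (fN : forall x, f (- x) = - f x).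
Hypothesis rs : 0 <= r <= s.

Let f0 : f 0 = 0.
Proof. by have := fN 0; rewrite oppr0; lra. Qed.

Let rs' : r <= s. Proof. by case/andP: rs. Qed.
Let r0 : 0 <= r. Proof. by case/andP: rs. Qed.

Lemma cut_homo : {homo cut f r s : x y / x <= y}.
Proof. by move=> x y xy; rewrite /cut lerB// f_homo// clamp_homo. Qed.

Lemma cut_increment_le x y : 0 <= x -> x <= y ->
  cut f r s y - cut f r s x <= f y - f x.
Proof.
have /andP[r0' rs''] := rs.
move=> x0 xy; have fxy := f_homo xy; rewrite /cut.
have [yr|ry] := leP y r.
  have -> : clamp r s y = r by case: (clampP y rs') => -[A ->]; lra.
  have -> : clamp r s x = r by case: (clampP x rs') => -[+ ->]; lra.
  by lra.
have fy : f (clamp r s y) <= f y by apply: f_homo; case: (clampP y rs') => -[+ ->]; lra.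
have [xs|sx] := leP x s.
  by have : f x <= f (clamp r s x); [apply: f_homo; case: (clampP x rs') => -[+ ->]; lra|lra].
have -> : clamp r s y = s by case: (clampP y rs') => -[+ ->]; lra.
have -> : clamp r s x = s by case: (clampP x rs') => -[+ ->]; lra.
by lra.
Qed.

Lemma truncN x : trunc f r s (- x) = - trunc f r s x.
Proof. by rewrite /trunc opprK [RHS]opprB. Qed.

Lemma trunc0 : trunc f r s 0 = 0.
Proof. by rewrite /trunc oppr0 subrr. Qed.

Lemma trunc_increment x y : x <= y ->
  0 <= trunc f r s y - trunc f r s x <= f y - f x.
Proof.
move=> xy; apply/andP; split.
  by rewrite /trunc; have := cut_homo xy; have := @cut_homo (- y) (- x); rewrite lerN2 => /(_ xy); lra.
have pos z : 0 <= z -> trunc f r s z = cut f r s z.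
  by move=> z0; rewrite /trunc (cut_le0 _ _ (x := - z))// ?subr0// (le_trans _ r0)// oppr_le0.
have [x0|/ltW x0] := leP 0 x.
  by rewrite !pos ?(le_trans x0 xy)//; exact: cut_increment_le.
have [y0|/ltW y0] := leP 0 y.
  have := cut_increment_le (lexx 0) y0; rewrite -!pos// trunc0 f0 !subr0.
  have := @cut_increment_le 0 (- x) (lexx 0); rewrite oppr_ge0 => /(_ x0).
  rewrite -!pos// ?oppr_ge0// trunc0 f0 !subr0 truncN fN; lra.
have := @cut_increment_le (- y) (- x); rewrite oppr_ge0 lerN2 => /(_ y0 xy).
by rewrite -!pos ?oppr_ge0// !truncN !fN; lra.
Qed.

Lemma trunc_mid x : r <= x <= s -> trunc f r s x = f x - f r.
Proof.
have /andP[r0' rs''] := rs.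
move=> /andP[rx xs].
rewrite /trunc (cut_le0 _ _ (x := - x))// ?subr0 /cut; last first.
  by rewrite (le_trans _ r0)// oppr_le0 (le_trans r0).
by congr (f _ - _); case: (clampP x rs') => -[+ ->]; lra.
Qed.

(** Both endpoints have the same sign and modulus between B/2 >= r and B <= s, where the truncation
    differs from [f] by a constant. *)
Lemma trunc_increment_far x y B : 2 * r <= B -> B <= s -> - B <= x -> x <= y ->
  y <= B -> y - x < B / 2 -> B = y \/ B = - x ->
  trunc f r s y - trunc f r s x = f y - f x.
Proof.
move=> rB Bs Bx xy yB yx [] BE.
  by rewrite !trunc_mid; [ring|lra|lra].
have := @trunc_mid (- x); have := @trunc_mid (- y); rewrite !truncN !fN.
by move=> Hy Hx; have := Hy _; have := Hx _; lra.
Qed.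

Lemma trunc_error x : `|x| <= s -> `|f x - trunc f r s x| <= f r.
Proof.
wlog x0 : x / 0 <= x.
  move=> wlg; have [x0|/ltW x0] := leP 0 x; first exact: wlg.
  by have := wlg (- x); rewrite oppr_ge0 fN truncN -opprD !normrN; apply.
rewrite ger0_norm// => xs.
have [rx|/ltW xr] := leP r x.
  rewrite trunc_mid ?rx// opprB addrC subrK ger0_norm// -f0; exact: f_homo.
rewrite /trunc !cut_le0// ?subrr ?subr0; last by lra.
by rewrite ger0_norm ?f_homo// -f0 f_homo.
Qed.

End truncation_of_odd.

(** Four cases for B = max(|x|, |y|). If B <= k, the clamp at [k] is the identity and its term
    bounds the whole product. If B > s, [distance_to_clamp] at level s/2 bounds (y - x)^2 by 16
    times the squared increment of the excess, whence 32. If k < B <= s and y - x < B/2, truncation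
    changes no increment. Otherwise B^2 <= 4(y - x)^2, and the errors [f r] and [g r] change the
    product by at most 4(f(r) g(B) + g(r) f(B)), which is at most e B^2/4. *)
Lemma trunc_product_error f g r s k e : 0 < r -> 2 * r <= k -> k <= s ->
  {homo f : x y / x <= y} -> (forall x, f (- x) = - f x) ->
  {homo g : x y / x <= y} -> (forall x, g (- x) = - g x) ->
  (forall x y, (f y - f x) * (g y - g x) <= 2 * (y - x) ^+ 2) ->
  (forall b, k <= b -> 16 * (f r * g b + g r * f b) <= e * b ^+ 2) ->
  forall x y,
    0 <= (trunc f r s y - trunc f r s x) * (trunc g r s y - trunc g r s x)
      <= (f y - f x) * (g y - g x) /\
    (f y - f x) * (g y - g x) <=
      (trunc f r s y - trunc f r s x) * (trunc g r s y - trunc g r s x)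
      + e * (y - x) ^+ 2 + 2 * (clamp (- k) k y - clamp (- k) k x) ^+ 2
      + 32 * ((y - clamp (- (s / 2)) (s / 2) y)
              - (x - clamp (- (s / 2)) (s / 2) x)) ^+ 2.
Proof.
move=> r0 rk ks f_homo fN g_homo gN fg fgr x y.
wlog xy : x y / x <= y.
  move=> wlg; have [/wlg//|/ltW/wlg] := leP x y.
  have -> : (f y - f x) * (g y - g x) = (f x - f y) * (g x - g y) by ring.
  rewrite -(opprB (trunc f r s x)) -(opprB (trunc g r s x)) mulrNN.
  by rewrite -(sqrrN (y - x)) -(sqrrN (clamp _ _ y - _)) -(sqrrN (y - _ - _)) !opprB.
have rs : 0 <= r <= s by lra.
have Tf := trunc_increment f_homo fN rs xy.
have Tg := trunc_increment g_homo gN rs xy.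
move: (Tf) (Tg) => /andP[Tf0 Tf1] /andP[Tg0 Tg1].
split; first by rewrite mulr_ge0//= ler_pM.
have k0 : - k <= k by lra.
have s0 : - (s / 2) <= s / 2 by lra.
have S1 := sqr_ge0 (clamp (- k) k y - clamp (- k) k x).
have S2 := sqr_ge0 ((y - clamp (- (s / 2)) (s / 2) y) - (x - clamp (- (s / 2)) (s / 2) x)).
have k0' : 0 < k by lra.
have f0 : f 0 = 0 by have := fN 0; rewrite oppr0; lra.
have g0 : g 0 = 0 by have := gN 0; rewrite oppr0; lra.
have fr0 : 0 <= f r by rewrite -f0 f_homo// ltW.
have gr0 : 0 <= g r by rewrite -g0 g_homo// ltW.
have he : 0 <= e.
  rewrite -(pmulr_lge0 _ (exprn_gt0 2 k0')) (le_trans _ (fgr _ (lexx k)))//.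
  have fk0 : 0 <= f k by rewrite -f0 f_homo// ltW.
  have gk0 : 0 <= g k by rewrite -g0 g_homo// ltW.
  by rewrite mulr_ge0// addr_ge0// mulr_ge0.
have e0 : 0 <= e * (y - x) ^+ 2 by rewrite mulr_ge0 ?sqr_ge0.
have TT := mulr_ge0 Tf0 Tg0.
pose B := Num.max (- x) y.
have xB : - B <= x by rewrite lerNl /B le_max lexx.
have yB : y <= B by rewrite /B le_max lexx orbT.
have [Bk|kB] := leP B k.
  rewrite !(@clamp_id k B)//; [|exact: le_trans xy yB|exact: le_trans xB xy].
  by move: (fg x y) S2 e0 TT; clear; lra.
have Bxy : B = y \/ B = - x by rewrite /B; case: leP; [left|right].
have [sB|Bs] := ltP s B.
  have H : y - x <= 4 * ((y - clamp (- (s / 2)) (s / 2) y) - (x - clamp (- (s / 2)) (s / 2) x)).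
    apply: (@distance_to_clamp _ B) => //; first by rewrite divr_gt0// (lt_le_trans k0').
    by rewrite mulrCA divff// mulr1.
  have : (y - x) ^+ 2 <= (4 * ((y - clamp (- (s / 2)) (s / 2) y) - (x - clamp (- (s / 2)) (s / 2) x))) ^+ 2.
    rewrite lerXn2r// nnegrE ?subr_ge0//; apply: (le_trans _ H).
    by rewrite subr_ge0.
  by rewrite exprMn => H2; move: (fg x y) S1 H2 e0 TT; clear; lra.
have [yx|yx] := ltP (y - x) (B / 2).
  have -> : trunc f r s y - trunc f r s x = f y - f x.
    apply: (@trunc_increment_far _ _ _ _ _ _ _ B) => //; exact: le_trans rk (ltW kB).
  have -> : trunc g r s y - trunc g r s x = g y - g x.
    apply: (@trunc_increment_far _ _ _ _ _ _ _ B) => //; exact: le_trans rk (ltW kB).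
  by move: S1 S2 e0; clear; lra.
have xs : `|x| <= s by rewrite ler_norml; move: xB yB xy Bs; clear; lra.
have ys : `|y| <= s by rewrite ler_norml; move: xB yB xy Bs; clear; lra.
have fB : - f B <= f x /\ f y <= f B by rewrite -fN !f_homo.
have gB : - g B <= g x /\ g y <= g B by rewrite -gN !g_homo.
have := trunc_error f_homo fN rs xs; rewrite ler_norml => /andP[fx1 fx2].
have := trunc_error f_homo fN rs ys; rewrite ler_norml => /andP[fy1 fy2].
have := trunc_error g_homo gN rs xs; rewrite ler_norml => /andP[gx1 gx2].
have := trunc_error g_homo gN rs ys; rewrite ler_norml => /andP[gy1 gy2].
have eB := fgr _ (ltW kB).
have BB : B ^+ 2 <= 4 * (y - x) ^+ 2.
  by rewrite (_ : 4 * _ = (2 * (y - x)) ^+ 2) ?lerXn2r ?nnegrE//; [move: kB k0'; clear; lra|move: xy; clear; lra|move: yx; clear; lra|ring].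
have eBB : e * B ^+ 2 <= 4 * (e * (y - x) ^+ 2).
  by rewrite (mulrCA 4) ler_wpM2l.
set P := f y - f x in Tf1 *; set Q := g y - g x in Tg1 *.
set p := trunc f r s y - _ in Tf0 Tf1 TT *; set q := trunc g r s y - _ in Tg0 Tg1 TT *.
have H1 : (P - p) * Q <= (2 * f r) * (2 * g B).
  by apply: ler_pM; move: Tf0 Tf1 Tg0 Tg1 fx1 fx2 fy1 fy2 gB; rewrite /P /p /Q; clear; lra.
have H2 : p * (Q - q) <= (2 * f B) * (2 * g r).
  by apply: ler_pM; move: Tf0 Tf1 Tg0 Tg1 gx1 gx2 gy1 gy2 fB; rewrite /P /p /Q /q; clear; lra.
have -> : P * Q = p * q + ((P - p) * Q + p * (Q - q)) by ring.
by move: H1 H2 eBB eB S1 S2; clear; lra.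
Qed.

End truncation.

(** * Symmetric forms *)

Section l2_pairing.
Context d (T : measurableType d) (R : realType) (m : {measure set T -> \bar R}).
Implicit Types u v w : T -> R.

Definition pairing u v : R := \int[m]_x (u x * v x).

Lemma Lfun_measurable (p : \bar R) u : u \in Lfun m p -> measurable_fun setT u.
Proof. by rewrite inE => /andP[]; rewrite inE. Qed.

Lemma Lfun2P u : u \in Lfun m 2%:E <-> measurable_fun setT u /\
  (\int[m]_x (u x ^+ 2)%:E < +oo)%E.
Proof.
split=> [u2|[mu u2]].
  split; first exact: Lfun_measurable u2.
  have /integrableP[_] := Lfun2_integrable_sqr u2.
  by under eq_integral => x _ do rewrite /= ger0_norm ?sqr_ge0//.
rewrite inE; apply/andP; split; rewrite inE//=.
rewrite /finite_norm unlock /Lnorm poweR_lty//.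
under eq_integral => x _.
  rewrite /= (powR_mulrn 2)// real_normK ?num_real//; over.
by [].
Qed.

Lemma measurable_sqrE u : measurable_fun setT u ->
  measurable_fun setT (fun x => (u x ^+ 2)%:E).
Proof. by move=> mu; apply/measurable_EFinP; exact: measurable_funX. Qed.

Lemma Lfun2_lin a u v : u \in Lfun m 2%:E -> v \in Lfun m 2%:E ->
  (fun x => a * u x + v x) \in Lfun m 2%:E.
Proof.
move=> /Lfun2P[mu u2] /Lfun2P[mv v2].
have mw : measurable_fun setT (fun x => a * u x + v x).
  by apply: measurable_funD => //; exact: measurable_funM.
apply/Lfun2P; split => //.
have c0 : 0 <= 2 * a ^+ 2 by rewrite mulr_ge0// sqr_ge0.
apply: (@le_lt_trans _ _ (\int[m]_x ((2 * a ^+ 2)%:E * (u x ^+ 2)%:E + 2%:E * (v x ^+ 2)%:E))%E).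
  apply: ge0_le_integral => //.
  - by move=> x _; rewrite lee_fin sqr_ge0.
  - exact: measurable_sqrE.
  - by apply: emeasurable_funD; apply: measurable_funeM; exact: measurable_sqrE.
  - move=> x _; rewrite -!EFinM -EFinD lee_fin.
    by have := sqr_ge0 (a * u x - v x); lra.
rewrite ge0_integralD//=; last 4 first.
- by move=> x _; rewrite mule_ge0// lee_fin ?sqr_ge0.
- apply: measurable_funeM; exact: measurable_sqrE.
- by move=> x _; rewrite mule_ge0// lee_fin ?sqr_ge0.
- apply: measurable_funeM; exact: measurable_sqrE.
rewrite !ge0_integralZl//=.
- by rewrite lte_add_pinfty// lte_mul_pinfty// ?lee_fin.
- exact: measurable_sqrE.
- by move=> x _; rewrite lee_fin sqr_ge0.
- exact: measurable_sqrE.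
- by move=> x _; rewrite lee_fin sqr_ge0.
Qed.

Lemma Lfun2_mul_integrable u v : u \in Lfun m 2%:E -> v \in Lfun m 2%:E ->
  m.-integrable setT (fun x => (u x * v x)%:E).
Proof. by move=> u2 v2; have /Lfun1_integrable := Lfun2_mul_Lfun1 u2 v2. Qed.

Lemma pairing_sqr u : u \in Lfun m 2%:E ->
  (pairing u u)%:E = (\int[m]_x (u x ^+ 2)%:E)%E.
Proof.
move=> u2; rewrite /pairing /Rintegral fineK//.
exact: (integrable_fin_num _ (Lfun2_mul_integrable u2 u2)).
Qed.

Lemma l2norm_sqr u : u \in Lfun m 2%:E ->
  fine ('N[m]_2%:E [EFin \o u])%E ^+ 2 = pairing u u.
Proof.
move=> u2; rewrite -(@powR_mulrn _ _ 2) ?fine_ge0 ?Lnorm_ge0//.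
rewrite -fine_poweR powR_Lnorm// -[RHS]/(fine (pairing u u)%:E) pairing_sqr//.
congr fine; apply: eq_integral => x _ /=.
by rewrite (powR_mulrn 2)// real_normK ?num_real.
Qed.

End l2_pairing.

Section l2_form.
Context d (R : realType) (E : borelMetricType d R) (m : {measure set E -> \bar R}).
Implicit Types u v w : E -> R.

Lemma l2norm_pairing u : u \in Lfun m 2%:E -> l2norm m u ^+ 2 = pairing m u u.
Proof. exact: l2norm_sqr. Qed.

Lemma l2norm_ge0 u : 0 <= l2norm m u.
Proof. by rewrite fine_ge0// Lnorm_ge0. Qed.

(** Makes the algebra of forms below, Young's inequality included, available for the inner product
    of L^2. *)
Lemma pairing_form : Defs.symmetric_form m [set u | u \in Lfun m 2%:E] (pairing m).
Proof.
split => /=.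
- by [].
- move=> u v u2 mv uv; apply/Lfun2P; split => //.
  have /Lfun2P[mu] := u2; rewrite (ae_eq_integral (fun x => (v x ^+ 2)%:E))//.
  + exact: measurable_sqrE.
  + exact: measurable_sqrE.
  + by apply: filterS uv => x /(_ I) -> _.
- move=> u v w u2 v2 w2 uv; rewrite /pairing /Rintegral; congr fine.
  apply: ae_eq_integral => //.
  + exact: measurable_int (Lfun2_mul_integrable u2 w2).
  + exact: measurable_int (Lfun2_mul_integrable v2 w2).
  + by apply: filterS uv => x /(_ I) -> _.
- apply/Lfun2P; split; first exact: measurable_cst.
  under eq_integral do rewrite /= expr0n/=.
  by rewrite integral0.
- exact: Lfun2_lin.
- by move=> u v _ _; rewrite /pairing; under eq_Rintegral do rewrite mulrC.
- move=> a u v w u2 v2 w2; rewrite /pairing -RintegralZl//; last exact: Lfun2_mul_integrable.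
  rewrite -RintegralD//; last exact: Lfun2_mul_integrable.
    by apply: eq_Rintegral => x _; ring.
  rewrite /comp; under eq_fun do rewrite EFinM.
  by apply: integrableZl => //; exact: Lfun2_mul_integrable.
- by move=> u u2; apply: Rintegral_ge0 => x _; rewrite -expr2 sqr_ge0.
Qed.

End l2_form.

Section symmetric_form_algebra.
Context d (R : realType) (E : borelMetricType d R) (m : {measure set E -> \bar R}).
Context (D : set (E -> R)) (A : (E -> R) -> (E -> R) -> R).
Hypothesis F : Defs.symmetric_form m D A.
Implicit Types (u v w : E -> R) (a l : R).

Lemma domZ a u : D u -> D (fun x => a * u x).
Proof.
move=> Du; rewrite (_ : (fun x => _) = (fun x => a * u x + cst 0 x)); last first.
  by apply/funext => x; rewrite addr0.
by apply: (sf_lin F) => //; exact: (sf_zero F).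
Qed.

Lemma domD u v : D u -> D v -> D (fun x => u x + v x).
Proof.
move=> Du Dv; rewrite (_ : (fun x => _) = (fun x => 1 * u x + v x)); last first.
  by apply/funext => x; rewrite mul1r.
exact: (sf_lin F).
Qed.

Lemma domB u v : D u -> D v -> D (fun x => u x - v x).
Proof.
move=> Du Dv; rewrite (_ : (fun x => _) = (fun x => -1 * v x + u x)); last first.
  by apply/funext => x; rewrite mulN1r addrC.
exact: (sf_lin F).
Qed.

Lemma domN u : D u -> D (fun x => - u x).
Proof.
move=> Du; rewrite (_ : (fun x => _) = (fun x => -1 * u x)); last first.
  by apply/funext => x; rewrite mulN1r.
exact: domZ.
Qed.

Lemma formDl u v w : D u -> D v -> D w ->
  A (fun x => u x + v x) w = A u w + A v w.
Proof.
move=> Du Dv Dw; rewrite -[in RHS](mul1r (A u w)) -(sf_form_lin F)//.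
by congr A; apply/funext => x; rewrite mul1r.
Qed.

Lemma form0l w : D w -> A (cst 0) w = 0.
Proof.
move=> Dw; have D0 := sf_zero F; have := formDl D0 D0 Dw.
have -> : (fun x => cst 0 x + cst 0 x) = cst 0 :> (E -> R) by apply/funext => x /=; rewrite addr0.
lra.
Qed.

Lemma formZl a u w : D u -> D w -> A (fun x => a * u x) w = a * A u w.
Proof.
move=> Du Dw; have D0 := sf_zero F; rewrite -[RHS]addr0 -(form0l Dw) -(sf_form_lin F)//.
by congr A; apply/funext => x /=; rewrite addr0.
Qed.

Lemma formBl u v w : D u -> D v -> D w ->
  A (fun x => u x - v x) w = A u w - A v w.
Proof.
move=> Du Dv Dw; rewrite -mulN1r addrC -(sf_form_lin F)//.
by congr A; apply/funext => x; rewrite mulN1r addrC.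
Qed.

Lemma formNl u w : D u -> D w -> A (fun x => - u x) w = - A u w.
Proof.
move=> Du Dw; rewrite -mulN1r -formZl//.
by congr A; apply/funext => x; rewrite mulN1r.
Qed.

Lemma formDr u v w : D u -> D v -> D w ->
  A w (fun x => u x + v x) = A w u + A w v.
Proof.
move=> Du Dv Dw; rewrite (sf_form_sym F Dw (domD Du Dv)) formDl//.
by rewrite (sf_form_sym F Du Dw) (sf_form_sym F Dv Dw).
Qed.

Lemma formBr u v w : D u -> D v -> D w ->
  A w (fun x => u x - v x) = A w u - A w v.
Proof.
move=> Du Dv Dw; rewrite (sf_form_sym F Dw (domB Du Dv)) formBl//.
by rewrite (sf_form_sym F Du Dw) (sf_form_sym F Dv Dw).
Qed.

Lemma formZr a u w : D u -> D w -> A w (fun x => a * u x) = a * A w u.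
Proof.
move=> Du Dw; rewrite (sf_form_sym F Dw (domZ a Du)) formZl//.
by rewrite (sf_form_sym F Du Dw).
Qed.

Lemma formNr u w : D u -> D w -> A w (fun x => - u x) = - A w u.
Proof.
move=> Du Dw; rewrite (sf_form_sym F Dw (domN Du)) formNl//.
by rewrite (sf_form_sym F Du Dw).
Qed.

Lemma form_sqrD u v : D u -> D v ->
  A (fun x => u x + v x) (fun x => u x + v x) = A u u + 2 * A u v + A v v.
Proof.
move=> Du Dv; have Duv := domD Du Dv; rewrite formDl// !formDr// (sf_form_sym F Dv Du).
by ring.
Qed.

Lemma form_sqrB u v : D u -> D v ->
  A (fun x => u x - v x) (fun x => u x - v x) = A u u - 2 * A u v + A v v.
Proof.
move=> Du Dv; have Duv := domB Du Dv; rewrite formBl// !formBr// (sf_form_sym F Dv Du).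
by ring.
Qed.

Lemma form_sqrZ a u : D u -> A (fun x => a * u x) (fun x => a * u x) = a ^+ 2 * A u u.
Proof. by move=> Du; rewrite formZl ?formZr//; [ring|exact: domZ]. Qed.

(** Weighted Cauchy-Schwarz, from the nonnegativity of the form at l u - s v with s equal to 1 or
    -1. The weight is chosen at each use, and no square roots appear. *)
Lemma form_young l u v : 0 < l -> D u -> D v ->
  `|A u v| * 2 <= l * A u u + l^-1 * A v v.
Proof.
move=> l0 Du Dv.
have H s : `|s| = 1 -> s * A u v * 2 <= l * A u u + l^-1 * A v v.
  move=> s1; have s2 : s ^+ 2 = 1 by rewrite -[LHS]real_normK ?num_real// s1 expr1n.
  have := sf_form_ge0 F (domB (domZ l Du) (domZ s Dv)).
  rewrite form_sqrB ?form_sqrZ ?formZl ?formZr//; try exact: domZ.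
  rewrite s2 mul1r => H; rewrite -(ler_pM2l l0).
  have -> : l * (l * A u u + l^-1 * A v v) = l ^+ 2 * A u u + A v v by field; rewrite gt_eqF.
  by move: H; lra.
by case: (ger0P (A u v)) => uv0; [have := H 1 (normr1 _)|have := H (-1) (normrN1 _)]; lra.
Qed.

Lemma form_sqrD_le u v : D u -> D v ->
  A (fun x => u x + v x) (fun x => u x + v x) <= 2 * A u u + 2 * A v v.
Proof.
move=> Du Dv; have := sf_form_ge0 F (domB Du Dv).
by rewrite form_sqrB// form_sqrD//; lra.
Qed.

Lemma form_sqrB_le u v : D u -> D v ->
  A (fun x => u x - v x) (fun x => u x - v x) <= 2 * A u u + 2 * A v v.
Proof.
move=> Du Dv; have := sf_form_ge0 F (domD Du Dv).
by rewrite form_sqrB// form_sqrD//; lra.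
Qed.

End symmetric_form_algebra.

Section markovian_forms.
Context d (R : realType) (E : borelMetricType d R) (m : {measure set E -> \bar R}).
Context (D : set (E -> R)) (A : (E -> R) -> (E -> R) -> R).
Hypotheses (F : Defs.symmetric_form m D A) (M : markovian D A).
Implicit Types (u v w f g : E -> R) (k : R).

Lemma lipschitz_dom k f g : D f ->
  (forall x, `|g x| <= k * `|f x|) ->
  (forall x y, `|g x - g y| <= k * `|f x - f y|) ->
  D g /\ A g g <= k ^+ 2 * A f f.
Proof.
move=> Df gf gfD; rewrite -(form_sqrZ F)//; apply: M; first exact: (domZ F).
have kN z : k * `|z| <= `|k * z| by rewrite normrM ler_wpM2r// ler_norm.
split=> [x|x y]; first exact: le_trans (gf x) (kN _).
by rewrite -mulrBr; exact: le_trans (gfD x y) (kN _).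
Qed.

Lemma half_contraction_dom (r : R -> R) f : half_contraction r -> D f ->
  D (r \o f) /\ A (r \o f) (r \o f) <= A f f.
Proof.
move=> rC Df; apply: M => //; split=> [x|x y] /=; last exact: half_contraction_norm.
by have := half_contraction_norm (f x) 0 rC; rewrite rC.1 !subr0.
Qed.

(** Equivalently, r(f) and w = f - r(f) have nonnegative mixed energy. Their increments have the
    same sign, so r(f) is a normal contraction of r(f) + s w for every s > 0. Compare the energies,
    divide by s and let s tend to 0. *)
Lemma half_contraction_form (r : R -> R) f : half_contraction r -> D f ->
  A (r \o f) (r \o f) <= A (r \o f) f.
Proof.
move=> rC Df; have [Drf _] := half_contraction_dom rC Df.
pose w x := f x - (r \o f) x.
have Dw : D w by exact: (domB F).
suff w0 : 0 <= A (r \o f) w.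
  by move: w0; rewrite (formBr F)//; lra.
have H (s : R) : 0 < s -> 0 <= 2 * A (r \o f) w + s * A w w.
  move=> s0; have Dsw := domZ F s Dw.
  have : A (r \o f) (r \o f) <=
      A (fun x => (r \o f) x + s * w x) (fun x => (r \o f) x + s * w x).
    have N x y : `|r x - r y| <= `|(r x + s * (x - r x)) - (r y + s * (y - r y))|.
      wlog xy : x y / x <= y.
        move=> wlg; have [/wlg//|/ltW/wlg] := leP x y.
        by rewrite distrC (distrC (r x + _)).
      have := rC.2 _ _ xy => /andP[r0 r1].
      rewrite (distrC (r x)) (distrC (r x + _)) !ger0_norm//.
        by have : 0 <= s * (y - x - (r y - r x)); [rewrite mulr_ge0 ?subr_ge0// ltW|lra].
      by have : 0 <= s * (y - x - (r y - r x)); [rewrite mulr_ge0 ?subr_ge0// ltW|lra].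
    have [|_ //] := @M _ (r \o f) (domD F Drf Dsw).
    split=> [x|x y] /=; last exact: N.
    by have := N (f x) 0; rewrite rC.1 !subr0 mulr0 addr0 subr0.
  rewrite (form_sqrD F)// (formZr F)// (form_sqrZ F)// => H.
  by rewrite -(pmulr_rge0 _ s0); move: H; lra.
rewrite leNgt; apply/negP => w0.
have Aw := sf_form_ge0 F Dw.
have Aw1 : 0 < A w w + 1 by lra.
(* Were the mixed energy negative, the quadratic term for this [s] would be at most its absolute
   value, too little to compensate twice the mixed energy. *)
have := H (- A (r \o f) w / (A w w + 1)).
rewrite divr_gt0// ?oppr_gt0// => /(_ isT).
rewrite mulrAC -mulrA => H1.
have : A w w / (A w w + 1) <= 1 by rewrite ler_pdivrMr//; lra.
by move: H1 w0; set q := A w w / _; set p := A _ w; nra.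
Qed.

End markovian_forms.

(** * Approximate forms of the semigroup *)

Section concave_sequences.
Context {R : realType}.

(** The decrements b_j - b_(j+1) are nonincreasing, so the mean of the first [i] is at least the
    mean of the first [n]. The auxiliary [step] says that each decrement is at most the mean of
    those before it. *)
Lemma midpoint_convex_chord (b : nat -> R) i n : (i <= n)%N ->
  (forall j, 2 * b j.+1 <= b j + b j.+2) ->
  i%:R * (b 0%N - b n) <= n%:R * (b 0%N - b i).
Proof.
move=> ilen bC.
have step j : j%:R * (b j - b j.+1) <= b 0%N - b j.
  elim: j => [|j IH]; first by rewrite mul0r subrr.
  rewrite -natr1; have := bC j; have : (0 : R) <= j%:R by [].
  set J := j%:R in IH *; move=> J0 H.
  have : (J + 1) * (b j.+1 - b j.+2) <= (J + 1) * (b j - b j.+1).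
    by rewrite ler_wpM2l ?addr_ge0//; lra.
  by move: IH H; lra.
elim: n ilen => [|n IH]; first by rewrite leqn0 => /eqP ->; rewrite !mul0r.
rewrite leq_eqVlt => /predU1P[->//|]; rewrite ltnS => ilen.
have := IH ilen; have := step n; rewrite -natr1.
have [n0|n0] := posnP n.
  by move: ilen; rewrite n0 leqn0 => /eqP ->; rewrite !mul0r add0r mul1r subrr.
have {}n0 : (0 : R) < n%:R by rewrite ltr0n.
have : (0 : R) <= i%:R by [].
set N : R := n%:R in n0 *; set I : R := i%:R => I0 S IHn.
rewrite -(ler_pM2l n0).
have : I * (N * (b n - b n.+1)) <= I * (b 0%N - b n) by rewrite ler_wpM2l.
have : (N + 1) * (I * (b 0%N - b n)) <= (N + 1) * (N * (b 0%N - b i)).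
  by rewrite ler_wpM2l// addr_ge0// ltW.
by lra.
Qed.

(** Monotonicity of [g] stands in for continuity: the chord inequality holds on the grid of step
    t/n, and rounding [s] down to this grid costs at most t c / n. *)
Lemma midpoint_convex_quotient (g : R -> R) (s t : R) :
  (forall x y, 0 <= x -> 0 <= y -> 2 * g ((x + y) / 2) <= g x + g y) ->
  (forall x y, 0 <= x <= y -> g y <= g x) ->
  0 < s -> s <= t -> t^-1 * (g 0 - g t) <= s^-1 * (g 0 - g s).
Proof.
move=> gC g_le s0 st; have t0 := lt_le_trans s0 st.
rewrite ler_pdivrMl// mulrCA ler_pdivlMl//.
have : 0 <= g 0 - g t by rewrite subr_ge0 g_le// lexx ltW.
move cE : (g 0 - g t) => c c0.
have H n : (0 < n)%N -> s * c <= t * (g 0 - g s) + t * c / n%:R.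
  move=> n0; pose h := t / n%:R.
  have nR : (0 : R) < n%:R by rewrite ltr0n.
  have h0 : 0 < h by rewrite divr_gt0.
  pose i := Num.truncn (s / h).
  have /andP[i1 i2] : i%:R <= s / h < i.+1%:R by rewrite truncn_itv// divr_ge0// ltW.
  have ih : i%:R * h <= s by rewrite -ler_pdivlMr.
  have hi : s < i.+1%:R * h by rewrite -ltr_pdivrMr.
  have nh : n%:R * h = t by rewrite /h mulrC divfK// gt_eqF.
  have iln : (i <= n)%N by rewrite -(ler_nat R) -(ler_pM2r h0) nh (le_trans ih).
  have bC j : 2 * g (j.+1%:R * h) <= g (j%:R * h) + g (j.+2%:R * h).
    have j0 k : 0 <= k%:R * h by rewrite mulr_ge0// ltW.
    rewrite (le_trans _ (gC _ _ (j0 _) (j0 _)))// (_ : _ / 2 = j.+1%:R * h)//.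
    by rewrite -addn2 -(addn1 j) !natrD; field.
  have := midpoint_convex_chord (b := fun j => g (j%:R * h)) iln bC.
  rewrite mul0r nh cE => H1.
  have H2 : n%:R * (g 0 - g (i%:R * h)) <= n%:R * (g 0 - g s).
    by rewrite ler_pM2l// lerB// g_le// ih andbT mulr_ge0// ltW.
  have H3 : n%:R * s <= i.+1%:R * t by rewrite -nh mulrCA ler_wpM2l// ltW.
  have H4 : n%:R * s * c <= i.+1%:R * t * c by rewrite ler_wpM2r.
  have H5 : t * (i%:R * c) <= t * (n%:R * (g 0 - g s)).
    by rewrite ler_wpM2l ?(ltW t0)// (le_trans H1).
  rewrite -(ler_pM2l nR).
  have -> : n%:R * (t * (g 0 - g s) + t * c / n%:R) =
      n%:R * (t * (g 0 - g s)) + t * c by field; rewrite gt_eqF.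
  by rewrite -natr1 in H4; move: H4 H5; clear; lra.
apply/ler_addgt0Pr => e e0; pose n := (Num.truncn (t * c / e)).+1.
apply: (le_trans (H n isT)); rewrite lerD2l ler_pdivrMr ?ltr0n//.
by rewrite -ler_pdivrMl// mulrC ltW// truncnS_gt.
Qed.

End concave_sequences.

Section semigroup.
Context d (R : realType) (E : borelMetricType d R) (m : {measure set E -> \bar R}).
Context (D : set (E -> R)) (A : (E -> R) -> (E -> R) -> R).
Hypothesis F : Defs.symmetric_form m D A.
Context (T : R -> R.-spker E ~> E).
Hypothesis T_sg : semigroup_of m D A T.
Implicit Types (u v w f g h : E -> R) (s t : R).

Local Notation P t := (kernel_op (T t)).
Local Notation L2 := [set u | u \in Lfun m 2%:E].
Let L2_form := pairing_form m.

Lemma semigroup_L2 t u : 0 < t -> u \in Lfun m 2%:E -> P t u \in Lfun m 2%:E.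
Proof. by move=> t0 u2; have [] := sg_contraction T_sg t0 u2. Qed.

Lemma semigroup_pairing_le t u : 0 < t -> u \in Lfun m 2%:E ->
  pairing m (P t u) (P t u) <= pairing m u u.
Proof.
move=> t0 u2; have [Pu2 le] := sg_contraction T_sg t0 u2.
by rewrite -!l2norm_pairing// lerXn2r// nnegrE l2norm_ge0.
Qed.

Lemma approx_formE t u v : 0 < t -> u \in Lfun m 2%:E -> v \in Lfun m 2%:E ->
  approx_form m T u v t = t^-1 * (pairing m u v - pairing m (P t u) v).
Proof.
move=> t0 u2 v2; rewrite /approx_form; congr *%R.
rewrite -(formBl L2_form)//; exact: semigroup_L2.
Qed.

Lemma semigroup_sym t u v : 0 < t -> u \in Lfun m 2%:E -> v \in Lfun m 2%:E ->
  pairing m (P t u) v = pairing m u (P t v).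
Proof. exact: (sg_sym T_sg). Qed.

(* [T_0] is the identity, whereas the kernel [T 0] is arbitrary *)
Definition semigroup0 t u := if 0 < t then P t u else u.
Local Notation Q := semigroup0.

Let Q2 t u : u \in Lfun m 2%:E -> Q t u \in Lfun m 2%:E.
Proof. by rewrite /semigroup0; case: ifP => // t0; exact: semigroup_L2. Qed.

Let QQ s t u : 0 <= s -> 0 <= t -> u \in Lfun m 2%:E ->
  pairing m (Q s u) (Q t u) = pairing m (Q (s + t) u) u.
Proof.
rewrite /semigroup0 le_eqVlt => /predU1P[<-|s0].
  move=> _ u2; rewrite ltxx add0r; case: ifP => // t0.
  by rewrite -(sf_form_sym L2_form)//=; exact: semigroup_L2.
rewrite le_eqVlt => /predU1P[<-|t0] u2; first by rewrite ltxx addr0 s0.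
rewrite s0 t0 addr_gt0// semigroup_sym//; last exact: semigroup_L2.
rewrite (sf_form_sym L2_form) /=; [|exact: u2|by do 2 apply: semigroup_L2 => //].
apply: (sf_form_ae L2_form) => /=.
- by do 2 apply: semigroup_L2 => //.
- by apply: semigroup_L2 => //; rewrite addr_gt0.
- by [].
- by apply: filterS (sg_add T_sg s0 t0 u2) => x H /H ->.
Qed.

Definition semigroup_sqr u t := pairing m (Q t u) u.
Local Notation G := semigroup_sqr.

Let Q0 u : Q 0 u = u. Proof. by rewrite /semigroup0 ltxx. Qed.

Let G_sqr t u : 0 <= t -> u \in Lfun m 2%:E -> G u t = pairing m (Q (t / 2) u) (Q (t / 2) u).
Proof.
move=> t0 u2; have t20 : 0 <= t / 2 by rewrite divr_ge0.
by have := QQ t20 t20 u2; rewrite -splitr => ->.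
Qed.

Let G_le s t u : 0 <= s <= t -> u \in Lfun m 2%:E -> G u t <= G u s.
Proof.
move=> /andP[s0 st] u2; have t0 := le_trans s0 st.
rewrite (G_sqr s0 u2) (G_sqr t0 u2).
have s20 : 0 <= s / 2 by rewrite divr_ge0.
move: st; rewrite le_eqVlt => /predU1P[->//|st].
have ts0 : 0 < (t - s) / 2 by rewrite divr_gt0// subr_gt0.
apply: le_trans (semigroup_pairing_le ts0 (Q2 (s / 2) u2)).
rewrite le_eqVlt; apply/orP; left; apply/eqP.
have t20 : 0 < t / 2 by rewrite divr_gt0// (le_lt_trans s0).
move: s20; rewrite le_eqVlt => /predU1P[s20|s20].
  have sE : s = 0 by move: s20; lra.
  by rewrite sE mul0r Q0 subr0 /semigroup0 t20.
have tQ : Q (t / 2) u = P ((t - s) / 2) (Q (s / 2) u) %[ae m].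
  rewrite /semigroup0 s20 t20.
  by rewrite (_ : t / 2 = (t - s) / 2 + s / 2); [exact: (sg_add T_sg)|field].
have PQ2 := semigroup_L2 ts0 (Q2 (s / 2) u2).
have Qt2 := Q2 (t / 2) u2.
rewrite (sf_form_ae L2_form Qt2 PQ2 Qt2 tQ) (sf_form_sym L2_form PQ2 Qt2).
exact: (sf_form_ae L2_form Qt2 PQ2 PQ2 tQ).
Qed.

(** The function (T_t u, u) of [t] is nonincreasing, being the squared norm of T_(t/2) u, and
    midpoint convex, since the squared norm of T_(x/2) u - T_(y/2) u is nonnegative. This replaces
    the spectral theorem. *)
Lemma approx_form_nonincr s t u : 0 < s -> s <= t -> u \in Lfun m 2%:E ->
  approx_form m T u u t <= approx_form m T u u s.
Proof.
move=> s0 st u2; have aE r : 0 < r -> approx_form m T u u r = r^-1 * (G u 0 - G u r).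
  by move=> r0; rewrite approx_formE// /semigroup_sqr Q0 /semigroup0 r0.
rewrite (aE _ s0) (aE _ (lt_le_trans s0 st)).
apply: (@midpoint_convex_quotient _ (G u)) => // [x y x0 y0|x y xy]; last exact: G_le.
have x20 : 0 <= x / 2 by rewrite divr_ge0.
have y20 : 0 <= y / 2 by rewrite divr_ge0.
have := sf_form_ge0 L2_form (domB L2_form (Q2 (x / 2) u2) (Q2 (y / 2) u2)).
rewrite (form_sqrB L2_form (Q2 _ u2) (Q2 _ u2)) -(G_sqr x0 u2) -(G_sqr y0 u2).
rewrite (QQ x20 y20 u2) -mulrDl -/(G u _).
move: (G u x) (G u y) (G u _) => a b c; lra.
Qed.

Lemma approx_form_cvg u (c : R) : u \in Lfun m 2%:E ->
  (\forall t \near 0^'+, approx_form m T u u t <= c) ->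
  cvg (approx_form m T u u @ 0^'+).
Proof.
move=> u2 ub; apply: nonincreasing_at_right_is_cvgr.
  near=> x => s t; rewrite !in_itv/= => /andP[s0 _] /andP[t0 _] st.
  exact: approx_form_nonincr.
case: ub => e /= e0 ub; exists e => //= x /=; rewrite sub0r normrN => xe x0.
exists c => z [y /=]; rewrite in_itv/= => /andP[y0 yx] <-.
apply: ub => //=; rewrite sub0r normrN gtr0_norm// (lt_trans yx)//.
by rewrite -(gtr0_norm x0).
Unshelve. all: by end_near. Qed.

Lemma dom_of_bounded u (c : R) : u \in Lfun m 2%:E ->
  (\forall t \near 0^'+, approx_form m T u u t <= c) -> D u.
Proof. by move=> u2 ub; apply/(sg_domain T_sg); split => //; exact: approx_form_cvg ub. Qed.

Lemma approx_form_le t u : D u -> 0 < t -> approx_form m T u u t <= A u u.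
Proof.
move=> Du t0; have u2 := sf_L2 F Du; have cv := sg_form T_sg Du Du.
rewrite -(cvg_lim _ cv)//; apply: limr_ge; first by apply/cvg_ex; eexists; exact: cv.
near=> s; apply: approx_form_nonincr => //.
by near: s; apply: nbhs_right_le.
Unshelve. all: by end_near. Qed.

Lemma approx_symmetric_form t : 0 < t ->
  Defs.symmetric_form m D (fun u v => approx_form m T u v t).
Proof.
move=> t0; have D2 := sf_L2 F.
have pae u v w : D u -> D v -> D w -> u = v %[ae m] ->
    pairing m (P t u) w = pairing m (P t v) w.
  move=> /D2 u2 /D2 v2 /D2 w2 uv; rewrite !semigroup_sym//.
  by apply: (sf_form_ae L2_form) => //=; exact: semigroup_L2.
split.
- exact: D2.
- exact: (sf_ae F).
- move=> u v w Du Dv Dw uv; rewrite (approx_formE t0 (D2 _ Du) (D2 _ Dw)).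
  rewrite (approx_formE t0 (D2 _ Dv) (D2 _ Dw)) (pae u v w Du Dv Dw uv).
  by rewrite (sf_form_ae L2_form (D2 _ Du) (D2 _ Dv) (D2 _ Dw) uv).
- exact: (sf_zero F).
- exact: (sf_lin F).
- move=> u v /D2 u2 /D2 v2; rewrite !approx_formE// semigroup_sym//.
  congr (_ * (_ - _)); apply: (sf_form_sym L2_form) => //=; exact: semigroup_L2.
- move=> c u v w Du Dv Dw; rewrite !approx_formE ?D2//; last exact: (sf_lin F).
  rewrite !semigroup_sym ?D2//; last exact: (sf_lin F).
  have Pw := semigroup_L2 t0 (D2 _ Dw).
  rewrite !(sf_form_lin L2_form) ?D2 //=; try exact: D2; ring.
- move=> u /D2 u2; rewrite approx_formE// mulr_ge0 ?invr_ge0 ?(ltW t0)// subr_ge0.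
  have := @G_le 0 t u; rewrite /semigroup_sqr Q0 /semigroup0 t0; apply => //; rewrite lexx; exact: ltW.
Qed.

(** Nonnegative because the approximate forms increase to [A]. Young's inequality for this form
    controls the difference between [A] and the approximate form off the diagonal by the defects on
    it. *)
Lemma defect_symmetric_form t : 0 < t ->
  Defs.symmetric_form m D (fun u v => A u v - approx_form m T u v t).
Proof.
move=> t0; have F' := approx_symmetric_form t0.
split.
- exact: (sf_L2 F).
- exact: (sf_ae F).
- move=> u v w Du Dv Dw uv; congr (_ - _); first exact: (sf_form_ae F Du Dv Dw uv).
  exact: (sf_form_ae F' Du Dv Dw uv).
- exact: (sf_zero F).
- exact: (sf_lin F).
- move=> u v Du Dv; congr (_ - _); first exact: (sf_form_sym F Du Dv).
  exact: (sf_form_sym F' Du Dv).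
- move=> c u v w Du Dv Dw; rewrite (sf_form_lin F _ Du Dv Dw).
  have := sf_form_lin F' c Du Dv Dw => /= ->.
  by move: (A u w) (A v w) (approx_form _ _ u _ _) (approx_form _ _ v _ _) => a1 a2 a3 a4; ring.
- by move=> u Du; rewrite subr_ge0 approx_form_le.
Qed.

(* On bounded sets, [A g h] is uniformly close to an approximate form, which is
   bounded on [L^2]. *)
Lemma form_weak_null h (c e : R) : D h -> 0 <= c -> 0 < e ->
  exists2 r, 0 < r & forall g, D g -> A g g <= c -> pairing m g g <= r ->
    `|A g h| <= e.
Proof.
move=> Dh c0 e0; have h2 := sf_L2 F Dh.
(* The weight [l] is chosen for [l * c <= e / 2], then [t] for the defect of [h] divided by [l];
   only then can [v] and the bound [r] on the L^2 norm of [g] be chosen, as they depend on [t]. *)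
pose l := e / (2 * (c + 1)).
have c1 : 0 < c + 1 by lra.
have l0 : 0 < l by rewrite divr_gt0// mulr_gt0.
have [t t0 ht] : exists2 t, 0 < t & l^-1 * (A h h - approx_form m T h h t) <= e / 2.
  have := sg_form T_sg Dh Dh; move/cvgrPdist_lt => /(_ (l * (e / 2))) []; first by rewrite mulr_gt0// divr_gt0.
  move=> r /= r0 H; exists (r / 2); first by rewrite divr_gt0.
  rewrite ler_pdivrMl//; apply/ltW; apply: le_lt_trans (ler_norm _) (H _ _ _) => /=.
    by rewrite sub0r normrN gtr0_norm ?divr_gt0// gtr_pMr// invf_lt1// ltr1n.
  by rewrite divr_gt0.
pose w x := h x - P t h x.
have Pw := semigroup_L2 t0 h2.
have w2 : w \in Lfun m 2%:E by exact: (domB L2_form).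
pose N := pairing m w w.
have N0 : 0 <= N by exact: (sf_form_ge0 L2_form).
pose v := e * t / (2 * (N + 1)).
have N1 : 0 < N + 1 by lra.
have v0 : 0 < v by rewrite divr_gt0 ?mulr_gt0.
exists (v * (e * t / 2)) => [|g Dg gc gr]; first by rewrite mulr_gt0// divr_gt0// mulr_gt0.
have g2 := sf_L2 F Dg.
have H1 := form_young (defect_symmetric_form t0) l0 Dg Dh.
have H2 : `|approx_form m T g h t| <= e / 2.
  rewrite (sf_form_sym (approx_symmetric_form t0) Dg Dh) approx_formE//.
  rewrite -(formBl L2_form)//= -/w normrM gtr0_norm ?invr_gt0// ler_pdivrMl//.
  have := form_young L2_form v0 w2 g2; rewrite -/N.
  have : v * N <= e * t / 2.
    rewrite /v mulrAC ler_pdivrMr ?mulr_gt0//.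
    have -> : e * t / 2 * (2 * (N + 1)) = e * t * (N + 1) by field.
    by rewrite ler_pM2l ?mulr_gt0//; lra.
  have : v^-1 * pairing m g g <= e * t / 2 by rewrite ler_pdivrMl.
  by lra.
have H3 : l * (A g g - approx_form m T g g t) <= e / 2.
  have : l * c <= e / 2.
    rewrite /l mulrAC ler_pdivrMr ?mulr_gt0//.
    have -> : e / 2 * (2 * (c + 1)) = e * (c + 1) by field.
    by rewrite ler_pM2l//; lra.
  apply: le_trans; rewrite ler_pM2l//.
  by have := sf_form_ge0 (approx_symmetric_form t0) Dg; lra.
have := ler_normD (A g h - approx_form m T g h t) (approx_form m T g h t).
rewrite subrK; move: H1 H2 H3 ht; lra.
Qed.

End semigroup.

(** * Symmetric kernels *)

Section kernel_forms.
Context d (R : realType) (E : borelMetricType d R) (m : {measure set E -> \bar R}).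
Context (K : R.-spker E ~> E).
Implicit Types (u v w f g h : E -> R).

Lemma integral_increasing_cvg (mu : {measure set E -> \bar R})
    (h : nat -> E -> \bar R) (l : E -> \bar R) :
  (forall n, measurable_fun setT (h n)) -> (forall n x, (0 <= h n x)%E) ->
  (forall x, {homo h ^~ x : i j / (i <= j)%N >-> (i <= j)%E}) ->
  (forall x, h n x @[n --> \oo] --> l x) ->
  (\int[mu]_x h n x)%E @[n --> \oo] --> (\int[mu]_x l x)%E.
Proof.
move=> mh h0 hh hl.
have -> : l = fun x => limn (h ^~ x).
  by apply/funext => x; apply/esym/cvg_lim => //; exact: hl.
by apply: cvg_monotone_convergence => // x _ i j ij; exact: hh.
Qed.

Definition kint f x := (\int[K x]_y (f y)%:E)%E.

Definition kernel_form f g := (\int[m]_x ((g x)%:E * kint f x))%E.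

Lemma measurable_kint f : measurable_fun setT f -> (forall x, 0 <= f x) ->
  measurable_fun setT (kint f).
Proof.
move=> mf f0; apply: (@measurable_fun_integral_kernel _ _ _ _ _ K _ (EFin \o f)).
- by move=> U mU; exact: measurable_kernel.
- by move=> z; rewrite lee_fin.
- exact/measurable_EFinP.
Qed.

Lemma kint_ge0 f x : (forall x, 0 <= f x) -> (0 <= kint f x)%E.
Proof. by move=> f0; apply: integral_ge0 => y _; rewrite lee_fin. Qed.

Lemma kint_le f g x : measurable_fun setT f -> measurable_fun setT g ->
  (forall x, 0 <= f x) -> (forall x, f x <= g x) -> (kint f x <= kint g x)%E.
Proof.
move=> mf mg f0 fg; apply: ge0_le_integral => //.
- by move=> y _; rewrite lee_fin.
- exact/measurable_EFinP.
- exact/measurable_EFinP.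
- by move=> y _; rewrite lee_fin.
Qed.

Lemma kint_cst (c : R) x : 0 <= c -> (kint (cst c) x <= c%:E)%E.
Proof.
move=> c0.
have -> : kint (cst c) x = (c%:E * K x setT)%E by rewrite -integral_cst.
by rewrite -[leRHS]mule1 lee_wpmul2l ?lee_fin// sprob_kernel_le1.
Qed.

Section symmetry.
Hypothesis K_L2 : forall f, f \in Lfun m 2%:E -> kernel_op K f \in Lfun m 2%:E.
Hypothesis K_sym : forall f g, f \in Lfun m 2%:E -> g \in Lfun m 2%:E ->
  pairing m (kernel_op K f) g = pairing m f (kernel_op K g).

Let kernel_form_fin f g (c : R) : f \in Lfun m 2%:E -> g \in Lfun m 2%:E ->
  (forall x, 0 <= f x <= c) -> kernel_form f g = (pairing m (kernel_op K f) g)%:E.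
Proof.
move=> f2 g2 f0; have mf := Lfun_measurable f2.
have fin x : kint f x \is a fin_num.
  have c0 : 0 <= c by have /andP[] := f0 x; exact: le_trans.
  rewrite ge0_fin_numE; last by apply: kint_ge0 => y; have /andP[] := f0 y.
  apply: (@le_lt_trans _ _ c%:E); last by rewrite ltry.
  apply: le_trans (kint_cst x c0); apply: kint_le => // y; by have /andP[] := f0 y.
rewrite /pairing /Rintegral fineK; last first.
  exact: (integrable_fin_num _ (Lfun2_mul_integrable (K_L2 f2) g2)).
apply: eq_integral => x _; rewrite EFinM muleC; congr (_ * _)%E.
by rewrite /kernel_op /Rintegral fineK//; exact: fin.
Qed.

Let kernel_form_sym_bounded f g (c : R) : f \in Lfun m 2%:E -> g \in Lfun m 2%:E ->
  (forall x, 0 <= f x <= c) -> (forall x, 0 <= g x <= c) ->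
  kernel_form f g = kernel_form g f.
Proof.
move=> f2 g2 f0 g0; rewrite (kernel_form_fin f2 g2 f0) (kernel_form_fin g2 f2 g0).
by rewrite K_sym// (sf_form_sym (pairing_form m) f2 (K_L2 g2)).
Qed.

Context (v : E -> R).
Hypothesis v2 : v \in Lfun m 2%:E.

(** Bounded by n, and in L^2 because it is bounded by n|v|; it increases to [f] whenever [f]
    vanishes where [v] does. *)
Let trunc_by f n x := Num.min (f x) (n%:R * Num.min `|v x| 1).

Let mv : measurable_fun setT v. Proof. exact: Lfun_measurable v2. Qed.

Let trunc_by_measurable f n : measurable_fun setT f ->
  measurable_fun setT (trunc_by f n).
Proof.
move=> mf; apply: measurable_minr => //; apply: measurable_funM => //.
by apply: measurable_minr => //; exact: measurableT_comp.
Qed.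

Let trunc_by_bounds f n x : (forall x, 0 <= f x) ->
  [/\ 0 <= trunc_by f n x, trunc_by f n x <= n%:R & trunc_by f n x <= n%:R * `|v x| ].
Proof.
move=> f0; rewrite /trunc_by; have n0 : (0 : R) <= n%:R by [].
split; first by rewrite le_min f0 mulr_ge0// le_min normr_ge0/=.
- by rewrite ge_min; apply/orP; right; rewrite ler_piMr// ge_min lexx orbT.
- by rewrite ge_min; apply/orP; right; rewrite ler_wpM2l// ge_min lexx.
Qed.

Let trunc_by_L2 f n : measurable_fun setT f -> (forall x, 0 <= f x) ->
  trunc_by f n \in Lfun m 2%:E.
Proof.
move=> mf f0; apply/Lfun2P; split; first exact: trunc_by_measurable.
have /Lfun2P[_ v2'] := v2.
apply: (@le_lt_trans _ _ (\int[m]_x ((n%:R ^+ 2)%:E * (v x ^+ 2)%:E))%E).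
  apply: ge0_le_integral => //.
  - by move=> x _; rewrite lee_fin sqr_ge0.
  - exact/measurable_sqrE/trunc_by_measurable.
  - by apply: measurable_funeM; exact: measurable_sqrE.
  - move=> x _; rewrite -EFinM lee_fin -exprMn -(real_normK (num_real (_ * v x))).
    have [t0 _ tv] := trunc_by_bounds n x f0.
    by rewrite lerXn2r ?nnegrE// normrM ger0_norm.
rewrite ge0_integralZl//=; first by rewrite lte_mul_pinfty// ?lee_fin ?sqr_ge0.
- exact: measurable_sqrE.
- by move=> x _; rewrite lee_fin sqr_ge0.
Qed.

Let trunc_by_homo f x : {homo (trunc_by f) ^~ x : i j / (i <= j)%N >-> i <= j}.
Proof.
move=> i j ij; rewrite /trunc_by le_min ge_min lexx/= ge_min; apply/orP; right.
by apply: ler_wpM2r; [rewrite le_min normr_ge0 ler01|rewrite ler_nat].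
Qed.

Let trunc_by_eventually f x : (v x = 0 -> f x = 0) -> (forall x, 0 <= f x) ->
  \forall n \near \oo, trunc_by f n x = f x.
Proof.
move=> fv f0; have [vx|vx] := eqVneq (v x) 0.
  near=> n; rewrite /trunc_by vx normr0 (min_l ler01) mulr0 fv//; exact: minxx.
have c0 : 0 < Num.min `|v x| 1 by rewrite lt_min normr_gt0 vx/=.
near=> n; rewrite /trunc_by min_l// -ler_pdivrMr//.
by near: n; exact: nbhs_infty_ger.
Unshelve. all: by end_near. Qed.

Let trunc_by_cvg f x : (v x = 0 -> f x = 0) -> (forall x, 0 <= f x) ->
  trunc_by f n x @[n --> \oo] --> f x.
Proof.
move=> fv f0; apply: cvg_near_cst; exact: trunc_by_eventually.
Qed.

Let kernel_form_cvgl f g : measurable_fun setT f -> measurable_fun setT g ->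
    (forall x, 0 <= f x) -> (forall x, 0 <= g x) -> (forall x, v x = 0 -> f x = 0) ->
  kernel_form (trunc_by f k) g @[k --> \oo] --> kernel_form f g.
Proof.
move=> mf mg f0 g0 fv; apply: integral_increasing_cvg.
- move=> k; apply: emeasurable_funM; first exact/measurable_EFinP.
  apply: measurable_kint; first exact: trunc_by_measurable.
  by move=> x; have [] := trunc_by_bounds k x f0.
- move=> k x; apply: mule_ge0; first by rewrite lee_fin.
  by apply: kint_ge0 => y; have [] := trunc_by_bounds k y f0.
- move=> x i j ij; apply: lee_wpmul2l; first by rewrite lee_fin.
  apply: kint_le; [exact: trunc_by_measurable|exact: trunc_by_measurable| |].
    by move=> y; have [] := trunc_by_bounds i y f0.
  by move=> y; exact: trunc_by_homo.
- move=> x; apply: cvgeZl => //; apply: integral_increasing_cvg.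
  + by move=> k; exact/measurable_EFinP/trunc_by_measurable.
  + by move=> k y; rewrite lee_fin; have [] := trunc_by_bounds k y f0.
  + by move=> y i j ij; rewrite lee_fin; exact: trunc_by_homo.
  + move=> y; apply: cvg_EFin; first exact: nearW.
    by apply: trunc_by_cvg => //; exact: fv.
Qed.

Let kernel_form_cvgr f g : measurable_fun setT f -> measurable_fun setT g ->
    (forall x, 0 <= f x) -> (forall x, 0 <= g x) -> (forall x, v x = 0 -> g x = 0) ->
  kernel_form f (trunc_by g k) @[k --> \oo] --> kernel_form f g.
Proof.
move=> mf mg f0 g0 gv; apply: integral_increasing_cvg.
- move=> k; apply: emeasurable_funM; last exact: measurable_kint.
  exact/measurable_EFinP/trunc_by_measurable.
- move=> k x; apply: mule_ge0; last exact: kint_ge0.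
  by rewrite lee_fin; have [] := trunc_by_bounds k x g0.
- move=> x i j ij; apply: lee_wpmul2r; first exact: kint_ge0.
  by rewrite lee_fin; exact: trunc_by_homo.
- move=> x; apply: cvg_near_cst.
  by apply: filterS (trunc_by_eventually (gv x) g0) => k ->.
Qed.

(** [K_sym] is given on L^2 only. The bounded truncations lie there, and monotone convergence
    extends the symmetry, in one argument at a time. *)
Lemma kernel_form_sym f g : measurable_fun setT f -> measurable_fun setT g ->
  (forall x, 0 <= f x) -> (forall x, 0 <= g x) ->
  (forall x, v x = 0 -> f x = 0) -> (forall x, v x = 0 -> g x = 0) ->
  kernel_form f g = kernel_form g f.
Proof.
move=> mf mg f0 g0 fv gv.
have bound h n x : (forall x, 0 <= h x) -> 0 <= trunc_by h n x <= n%:R.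
  by move=> h0; have [t0 tn _] := trunc_by_bounds n x h0; rewrite t0.
have L f' n : measurable_fun setT f' -> (forall x, 0 <= f' x) -> (forall x, v x = 0 -> f' x = 0) ->
    kernel_form f' (trunc_by g n) = kernel_form (trunc_by g n) f'.
  move=> mf' f'0 f'v.
  have mgn := trunc_by_measurable n mg.
  have gn0 x : 0 <= trunc_by g n x by have [] := trunc_by_bounds n x g0.
  apply: (cvg_unique _ (kernel_form_cvgl mf' mgn f'0 gn0 f'v)) => //.
  apply: cvg_trans (kernel_form_cvgr mgn mf' gn0 f'0 f'v).
  apply: near_eq_cvg; near=> k.
  have kn : trunc_by f' k \in Lfun m 2%:E by exact: trunc_by_L2.
  have gn : trunc_by g n \in Lfun m 2%:E by exact: trunc_by_L2.
  apply: (kernel_form_sym_bounded (c := (maxn k n)%:R) gn kn) => x.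
    have /andP[-> le] := bound g n x g0.
    by rewrite (le_trans le)// ler_nat leq_maxr.
  have /andP[-> le] := bound f' k x f'0.
  by rewrite (le_trans le)// ler_nat leq_maxl.
apply: (cvg_unique _ (kernel_form_cvgr mf mg f0 g0 gv)) => //.
apply: cvg_trans (kernel_form_cvgl mg mf g0 f0 gv).
by apply: near_eq_cvg; near=> k; exact/esym/L.
Unshelve. all: by end_near. Qed.

End symmetry.
End kernel_forms.

(** * Representation of the approximate form by jumps and killing *)

Section representation.
Context d (R : realType) (E : borelMetricType d R) (m : {measure set E -> \bar R}).
Context (K : R.-spker E ~> E).
Implicit Types (u f g h : E -> R) (W : E * E -> R) (c : R).

Local Notation KI := (kint K).
Local Notation BF := (kernel_form m K).

Lemma kernel_form_ge0 f g : (forall x, 0 <= f x) -> (forall x, 0 <= g x) ->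
  (0 <= BF f g)%E.
Proof.
move=> f0 g0; apply: integral_ge0 => x _.
by rewrite mule_ge0 ?kint_ge0// lee_fin.
Qed.

Lemma measurable_kernel_form f g : measurable_fun setT f -> measurable_fun setT g ->
  (forall x, 0 <= f x) -> measurable_fun setT (fun x => ((g x)%:E * KI f x)%E).
Proof.
move=> mf mg f0; apply: emeasurable_funM; last exact: measurable_kint.
exact/measurable_EFinP.
Qed.

Context (v : E -> R).
Hypothesis v2 : v \in Lfun m 2%:E.

Definition nonzero x : R := (v x != 0)%:R.

Let mv : measurable_fun setT v. Proof. exact: Lfun_measurable v2. Qed.

Let nz0 x : 0 <= nonzero x. Proof. by rewrite /nonzero. Qed.

Lemma measurable_nonzero : measurable_fun setT nonzero.
Proof.
rewrite (_ : nonzero = \1_(v @^-1` [set~ 0])).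
  apply: measurable_indic; rewrite -[X in measurable X]setTI; apply: mv => //.
  by apply: measurableC; exact: measurable_set1.
apply/funext => x; rewrite /nonzero indicE; congr (nat_of_bool _)%:R.
by apply/idP/idP; rewrite inE/= => /eqP.
Qed.

Let mnz : measurable_fun setT nonzero. Proof. exact: measurable_nonzero. Qed.

Lemma kint_nonzero_le1 x : (KI nonzero x <= 1)%E.
Proof.
apply: le_trans (kint_cst K x ler01); apply: kint_le => // y.
by rewrite /nonzero; case: (_ != _).
Qed.

Lemma kint_nonzero_fin x : KI nonzero x \is a fin_num.
Proof.
by rewrite ge0_fin_numE ?kint_ge0// (le_lt_trans (kint_nonzero_le1 x))// ltry.
Qed.

(* Restricting to [{v <> 0}], where all the integrals are finite, and counting
   the mass sent outside as killing avoids any sigma-finiteness of [m]. *)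
Definition jump_part W :=
  (\int[m]_x \int[K x]_y (nonzero x * nonzero y * W (x, y))%:E)%E.

Definition kill_part f := (\int[m]_x ((f x)%:E * (1 - KI nonzero x)))%E.

Let mnzW W : measurable_fun setT W ->
  measurable_fun setT (fun z : E * E => nonzero z.1 * nonzero z.2 * W z).
Proof.
move=> mW; apply: measurable_funM => //; apply: measurable_funM.
  exact: measurableT_comp mnz measurable_fst.
exact: measurableT_comp mnz measurable_snd.
Qed.

Let mjump W : measurable_fun setT W -> (forall z, 0 <= W z) ->
  measurable_fun setT (fun x => \int[K x]_y (nonzero x * nonzero y * W (x, y))%:E)%E.
Proof.
move=> mW W0.
apply: (measurable_fun_integral_sfinite_kernel
  (fun z : E * E => (nonzero z.1 * nonzero z.2 * W z)%:E) K).
  by move=> z; rewrite lee_fin !mulr_ge0.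
apply/measurable_EFinP; exact: mnzW.
Qed.

Let mjump2 W x : measurable_fun setT W ->
  measurable_fun setT (fun y => nonzero x * nonzero y * W (x, y)).
Proof. by move=> /mnzW mW; exact: measurableT_comp mW (pair1_measurable x). Qed.

Lemma jump_part_lin c W W' : 0 <= c ->
  measurable_fun setT W -> measurable_fun setT W' ->
  (forall z, 0 <= W z) -> (forall z, 0 <= W' z) ->
  jump_part (fun z => W z + c * W' z) = (jump_part W + c%:E * jump_part W')%E.
Proof.
move=> c0 mW mW' W0 W'0; rewrite /jump_part -ge0_integralZl//=; last 2 first.
- exact: mjump.
- by move=> x _; apply: integral_ge0 => y _; rewrite lee_fin !mulr_ge0.
rewrite -ge0_integralD//=; last 4 first.
- by move=> x _; apply: integral_ge0 => y _; rewrite lee_fin !mulr_ge0.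
- exact: mjump.
- by move=> x _; rewrite mule_ge0//; apply: integral_ge0 => y _; rewrite lee_fin !mulr_ge0.
- by apply: measurable_funeM; exact: mjump.
apply: eq_integral => x _; rewrite -ge0_integralZl//=; last 2 first.
- apply/measurable_EFinP; exact: mjump2.
- by move=> y _; rewrite lee_fin !mulr_ge0.
rewrite -ge0_integralD//=; last 4 first.
- by move=> y _; rewrite lee_fin !mulr_ge0.
- apply/measurable_EFinP; exact: mjump2.
- by move=> y _; rewrite mule_ge0// lee_fin !mulr_ge0.
- by apply: measurable_funeM; apply/measurable_EFinP; exact: mjump2.
by apply: eq_integral => y _; rewrite -EFinM -EFinD; congr EFin; ring.
Qed.

Lemma jump_partD W W' : measurable_fun setT W -> measurable_fun setT W' ->
  (forall z, 0 <= W z) -> (forall z, 0 <= W' z) ->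
  jump_part (fun z => W z + W' z) = (jump_part W + jump_part W')%E.
Proof.
move=> mW mW' W0 W'0; have := jump_part_lin ler01 mW mW' W0 W'0.
rewrite mul1e => <-; congr jump_part.
by apply/funext => z; rewrite mul1r.
Qed.

Lemma jump_part_le W W' : measurable_fun setT W -> measurable_fun setT W' ->
  (forall z, 0 <= W z) -> (forall z, W z <= W' z) -> (jump_part W <= jump_part W')%E.
Proof.
move=> mW mW' W0 WW'; have W'0 z : 0 <= W' z := le_trans (W0 z) (WW' z).
apply: ge0_le_integral => //.
- by move=> x _; apply: integral_ge0 => y _; rewrite lee_fin !mulr_ge0.
- exact: mjump.
- exact: mjump.
move=> x _; apply: ge0_le_integral => //.
- by move=> y _; rewrite lee_fin !mulr_ge0.
- apply/measurable_EFinP; exact: mjump2.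
- apply/measurable_EFinP; exact: mjump2.
- by move=> y _; rewrite lee_fin ler_wpM2l// mulr_ge0.
Qed.

Lemma kill_ge0 x : (0 <= 1 - KI nonzero x)%E.
Proof. by rewrite sube_ge0 ?kint_nonzero_le1// kint_nonzero_fin orbT. Qed.

Let kill0 x : (0 <= 1 - KI nonzero x)%E. Proof. exact: kill_ge0. Qed.

Lemma measurable_kill f : measurable_fun setT f ->
  measurable_fun setT (fun x => ((f x)%:E * (1 - KI nonzero x))%E).
Proof.
move=> mf; apply: emeasurable_funM; first exact/measurable_EFinP.
by apply: emeasurable_funB => //; exact: measurable_kint.
Qed.

Lemma kill_part_lin c f g : 0 <= c -> measurable_fun setT f -> measurable_fun setT g ->
  (forall x, 0 <= f x) -> (forall x, 0 <= g x) ->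
  kill_part (fun x => f x + c * g x) = (kill_part f + c%:E * kill_part g)%E.
Proof.
move=> c0 mf mg f0 g0; rewrite /kill_part -ge0_integralZl//=; last 2 first.
- exact: measurable_kill.
- by move=> x _; rewrite mule_ge0// lee_fin.
rewrite -ge0_integralD//=; last 4 first.
- by move=> x _; rewrite mule_ge0// lee_fin.
- exact: measurable_kill.
- by move=> x _; rewrite !mule_ge0// lee_fin.
- by apply: measurable_funeM; exact: measurable_kill.
apply: eq_integral => x _.
rewrite EFinD EFinM ge0_muleDl ?lee_fin ?mulr_ge0//.
by rewrite muleA.
Qed.

Lemma kill_part_le f g : measurable_fun setT f -> measurable_fun setT g ->
  (forall x, 0 <= f x) -> (forall x, f x <= g x) -> (kill_part f <= kill_part g)%E.
Proof.
move=> mf mg f0 fg; apply: ge0_le_integral => //.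
- by move=> x _; rewrite mule_ge0// lee_fin.
- exact: measurable_kill.
- exact: measurable_kill.
- by move=> x _; rewrite lee_wpmul2r// lee_fin.
Qed.

End representation.

Section kernel_representation.
Context d (R : realType) (E : borelMetricType d R) (m : {measure set E -> \bar R}).
Context (K : R.-spker E ~> E).
Implicit Types (u f g h a b : E -> R) (W : E * E -> R) (c : R).
Hypothesis K_L2 : forall f, f \in Lfun m 2%:E -> kernel_op K f \in Lfun m 2%:E.
Hypothesis K_sym : forall f g, f \in Lfun m 2%:E -> g \in Lfun m 2%:E ->
  pairing m (kernel_op K f) g = pairing m f (kernel_op K g).
Context (v : E -> R).
Hypothesis v2 : v \in Lfun m 2%:E.

Let double_sum (j b x1 x2 y1 y2 : \bar R) :
  (0 <= x1)%E -> (0 <= x2)%E -> (0 <= y1)%E -> (0 <= y2)%E ->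
  (j + (2%:E * x1 + 2%:E * x2) = b + b + (2%:E * y1 + 2%:E * y2))%E ->
  (j + 2%:E * (x1 + x2) = 2%:E * b + 2%:E * (y1 + y2))%E.
Proof. by move=> *; rewrite !ge0_muleDr// (mule_natl b 2) mule2n. Qed.

Local Notation KI := (kint K).
Local Notation BF := (kernel_form m K).
Local Notation nz := (nonzero v).

Let mv : measurable_fun setT v. Proof. exact: Lfun_measurable v2. Qed.

Let nz0 x : 0 <= nz x. Proof. by rewrite /nonzero. Qed.

Let mnz : measurable_fun setT nz. Proof. exact: measurable_nonzero v2. Qed.

Let nz_v x : v x = 0 -> nz x = 0. Proof. by rewrite /nonzero => ->; rewrite eqxx. Qed.

Let nzE a x : (v x = 0 -> a x = 0) -> nz x * a x = a x.
Proof.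
rewrite /nonzero; have [vx /(_ vx) ->|_ _] := eqVneq (v x) 0; first by rewrite mulr0.
by rewrite mul1r.
Qed.

Lemma jump_part_tensor W a b : measurable_fun setT a -> (forall x, 0 <= a x) ->
  (forall x, 0 <= b x) -> (forall x y, nz x * nz y * W (x, y) = b x * a y) ->
  jump_part m K v W = BF a b.
Proof.
move=> ma a0 b0 WE; apply: eq_integral => x _; rewrite /kint -ge0_integralZl//=.
- by apply: eq_integral => y _; rewrite WE.
- exact/measurable_EFinP.
- by move=> y _; rewrite lee_fin.
- by rewrite lee_fin.
Qed.

Let sqv x := v x ^+ 2.
Let sqv0 x : 0 <= sqv x. Proof. exact: sqr_ge0. Qed.
Let msqv : measurable_fun setT sqv. Proof. exact: measurable_funX. Qed.
Let sqv_v x : v x = 0 -> sqv x = 0. Proof. by rewrite /sqv => ->; rewrite expr0n. Qed.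

Let BF_nz_sqv : (BF nz sqv < +oo)%E.
Proof.
have /Lfun2P[_] := v2; apply: le_lt_trans; apply: ge0_le_integral => //.
- by move=> x _; rewrite mule_ge0 ?kint_ge0// lee_fin.
- exact: measurable_kernel_form.
- exact: measurable_sqrE.
- move=> x _; rewrite -[leRHS]mule1 lee_wpmul2l ?lee_fin//.
  exact: (kint_nonzero_le1 K v2).
Qed.

(** The tensor b(x) a(y) is compared with c(v(x)^2 + v(y)^2). Symmetry turns the term in v(y)^2 into
    the one in v(x)^2, which is finite because [K x] has mass at most 1. *)
Let BF_lty a b c : measurable_fun setT a -> measurable_fun setT b ->
  (forall x, 0 <= a x) -> (forall x, 0 <= b x) ->
  (forall x, v x = 0 -> a x = 0) -> (forall x, v x = 0 -> b x = 0) -> 0 <= c ->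
  (forall x y, b x * a y <= c * (v x ^+ 2 + v y ^+ 2)) -> (BF a b < +oo)%E.
Proof.
move=> ma mb a0 b0 av bv c0 abc.
rewrite -(@jump_part_tensor (fun z => b z.1 * a z.2))//; last first.
  by move=> x y /=; rewrite mulrACA !nzE//; [exact: av|exact: bv].
apply: (@le_lt_trans _ _ (jump_part m K v (fun z => c * sqv z.1 + c * sqv z.2))).
  apply: jump_part_le => //.
  - apply: measurable_funM; first exact: measurableT_comp mb measurable_fst.
    exact: measurableT_comp ma measurable_snd.
  - apply: measurable_funD; apply: measurable_funM => //.
      exact: measurableT_comp msqv measurable_fst.
    exact: measurableT_comp msqv measurable_snd.
  - by move=> z; rewrite mulr_ge0.
  - by move=> [x y] /=; rewrite -mulrDr.
have csqv0 x : 0 <= c * sqv x by rewrite mulr_ge0.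
have mcsqv : measurable_fun setT (fun x => c * sqv x).
  exact: (@measurable_funM _ _ _ _ (cst c) sqv).
have m1 : measurable_fun setT (fun z : E * E => c * sqv z.1).
  exact: measurableT_comp mcsqv measurable_fst.
have m2 : measurable_fun setT (fun z : E * E => sqv z.2).
  exact: measurableT_comp msqv measurable_snd.
rewrite (jump_part_lin K v2 c0 m1 m2)//.
rewrite (@jump_part_tensor _ nz (fun x => c * sqv x))//; last first.
  move=> x y /=; rewrite mulrAC; congr (_ * _).
  by apply: (@nzE (fun x => c * sqv x)) => vx; rewrite sqv_v// mulr0.
rewrite (@jump_part_tensor _ sqv nz)//; last first.
  by move=> x y /=; rewrite -mulrA nzE//; exact: sqv_v.
rewrite (kernel_form_sym K_L2 K_sym v2 msqv mnz)//.
have BFc : BF nz (fun x => c * sqv x) = (c%:E * BF nz sqv)%E.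
  rewrite /kernel_form -ge0_integralZl//=.
  - by apply: eq_integral => x _; rewrite EFinM muleA.
  - exact: measurable_kernel_form.
  - by move=> x _; rewrite mule_ge0 ?kint_ge0// lee_fin.
by rewrite BFc lte_add_pinfty// lte_mul_pinfty// ?lee_fin.
Qed.

Section product_functions.
Context (f g : E -> R) (c : R).
Hypotheses (mf : measurable_fun setT f) (mg : measurable_fun setT g).
Hypotheses (fv : forall x, v x = 0 -> f x = 0) (gv : forall x, v x = 0 -> g x = 0).
Hypothesis fgc : forall x y, `|f x * g y| <= c * (v x ^+ 2 + v y ^+ 2).
Hypothesis fg0 : forall x, 0 <= f x * g x.
Hypothesis dfg0 : forall x y, 0 <= (f y - f x) * (g y - g x).
Hypothesis c0 : 0 <= c.

(** Only products of values of [f] and [g] are controlled, not the functions separately. The four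
    kernel forms of positive and negative parts are finite, which keeps infinities from being
    subtracted. *)
Let pos h x := Num.max (h x) 0.
Let neg h x := Num.max (- h x) 0.

Let hE h x : h x = pos h x - neg h x.
Proof. by rewrite /pos /neg; case: (leP (h x)) => ?; case: (leP (- h x)) => ?; lra. Qed.

Let pos0 h x : 0 <= pos h x. Proof. by rewrite /pos le_max lexx orbT. Qed.
Let neg0 h x : 0 <= neg h x. Proof. by rewrite /neg le_max lexx orbT. Qed.

Let pos_norm h x : pos h x <= `|h x|.
Proof. by rewrite /pos ge_max ler_norm normr_ge0. Qed.

Let neg_norm h x : neg h x <= `|h x|.
Proof. by rewrite /neg ge_max -normrN ler_norm normr_ge0. Qed.

Let mpos h : measurable_fun setT h -> measurable_fun setT (pos h).
Proof. by move=> mh; exact: measurable_maxr. Qed.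

Let mneg h : measurable_fun setT h -> measurable_fun setT (neg h).
Proof. by move=> mh; apply: measurable_maxr => //; exact: measurableT_comp. Qed.

Let posv h x : (v x = 0 -> h x = 0) -> v x = 0 -> pos h x = 0.
Proof. by move=> hv vx; rewrite /pos hv// maxxx. Qed.

Let negv h x : (v x = 0 -> h x = 0) -> v x = 0 -> neg h x = 0.
Proof. by move=> hv vx; rewrite /neg hv// oppr0 maxxx. Qed.

Let part a h := a = pos h \/ a = neg h.

Let part_facts a h : part a h -> measurable_fun setT h -> (forall x, v x = 0 -> h x = 0) ->
  [/\ measurable_fun setT a, (forall x, 0 <= a x), (forall x, v x = 0 -> a x = 0) &
      forall x, a x <= `|h x|].
Proof.
case=> -> mh hv; split => //.
- exact: mpos.
- by move=> x; apply: posv; exact: hv.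
- exact: mneg.
- by move=> x; apply: negv; exact: hv.
Qed.

Let part_lty a b : part a f -> part b g -> (BF a b < +oo)%E.
Proof.
move=> /part_facts/(_ mf fv)[ma a0 av af] /part_facts/(_ mg gv)[mb b0 bv bg].
apply: (@BF_lty _ _ c) => // x y; rewrite mulrC addrC.
by apply: le_trans (fgc y x); rewrite normrM ler_pM.
Qed.

Let part_sym a b : part a f -> part b g -> BF b a = BF a b.
Proof.
move=> /part_facts/(_ mf fv)[ma a0 av af] /part_facts/(_ mg gv)[mb b0 bv bg].
exact: (kernel_form_sym K_L2 K_sym v2).
Qed.

Let fg x := f x * g x.
Let mfg : measurable_fun setT fg. Proof. exact: measurable_funM. Qed.
Let fg_ge0 x : 0 <= fg x. Proof. exact: fg0. Qed.
Let fgv x : v x = 0 -> fg x = 0. Proof. by move=> vx; rewrite /fg fv// mul0r. Qed.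

Let int_fg_lty : (\int[m]_x (fg x)%:E < +oo)%E.
Proof.
have /Lfun2P[_ v2'] := v2.
apply: (@le_lt_trans _ _ (\int[m]_x ((2 * c)%:E * (v x ^+ 2)%:E))%E).
  apply: ge0_le_integral => //.
  - by move=> x _; rewrite lee_fin; exact: fg0.
  - exact/measurable_EFinP.
  - by apply: measurable_funeM; exact: measurable_sqrE.
  - move=> x _; rewrite -EFinM lee_fin; have := fgc x x.
    by rewrite ger0_norm// /fg; lra.
rewrite ge0_integralZl//= ?lee_fin ?mulr_ge0//.
- by rewrite lte_mul_pinfty// lee_fin mulr_ge0.
- exact: measurable_sqrE.
- by move=> x _; rewrite lee_fin sqr_ge0.
Qed.

(** Mass 1 at each point is split into the mass sent to {v <> 0} and the rest. *)
Let BF_fg : (BF nz fg + kill_part m K v fg = \int[m]_x (fg x)%:E)%E.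
Proof.
rewrite /kernel_form /kill_part -ge0_integralD//=.
- apply: eq_integral => x _; rewrite -ge0_muleDr ?kint_ge0//; last exact: (kill_ge0 K v2).
  by rewrite addeC subeK ?mule1//; exact: (kint_nonzero_fin K v2).
- by move=> x _; rewrite mule_ge0 ?kint_ge0// lee_fin.
- exact: measurable_kernel_form.
- by move=> x _; rewrite mule_ge0 ?(kill_ge0 K v2)// lee_fin.
- exact: (measurable_kill K v2).
Qed.

Let cross_positive := (BF (pos f) (pos g) + BF (neg f) (neg g))%E.
Let cross_negative := (BF (pos f) (neg g) + BF (neg f) (pos g))%E.

Let q (z : E * E) := (f z.2 - f z.1) * (g z.2 - g z.1).

Let m1 h : measurable_fun setT h -> measurable_fun setT (fun z : E * E => h z.1).
Proof. by move=> mh; exact: measurableT_comp mh measurable_fst. Qed.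

Let m2 h : measurable_fun setT h -> measurable_fun setT (fun z : E * E => h z.2).
Proof. by move=> mh; exact: measurableT_comp mh measurable_snd. Qed.

Let mq : measurable_fun setT q.
Proof. by apply: measurable_funM; apply: measurable_funB; [exact: m2|exact: m1|exact: m2|exact: m1]. Qed.

Let tensor a b (z : E * E) := b z.1 * a z.2.

Let mtensor a b : measurable_fun setT a -> measurable_fun setT b ->
  measurable_fun setT (tensor a b).
Proof. by move=> ma mb; apply: measurable_funM; [exact: m1|exact: m2]. Qed.

Let jump_tensor a b : measurable_fun setT a ->
  (forall x, 0 <= a x) -> (forall x, 0 <= b x) ->
  (forall x, v x = 0 -> a x = 0) -> (forall x, v x = 0 -> b x = 0) ->
  jump_part m K v (tensor a b) = BF a b.
Proof.
move=> ma a0 b0 av bv; apply: jump_part_tensor => // x y.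
by rewrite /tensor/= mulrACA !nzE//; [exact: av|exact: bv].
Qed.

Let sym_tensor a b z := tensor a b z + tensor b a z.

Let jump_sym_tensor a b : part a f -> part b g ->
  [/\ measurable_fun setT (sym_tensor a b), forall z, 0 <= sym_tensor a b z &
   jump_part m K v (sym_tensor a b) = (2%:E * BF a b)%E].
Proof.
move=> pa pb; have [ma a0 av af] := part_facts pa mf fv.
have [mb b0 bv bg] := part_facts pb mg gv.
split.
- by apply: measurable_funD; exact: mtensor.
- by move=> z; rewrite addr_ge0// mulr_ge0.
- have t0 z : 0 <= tensor a b z by rewrite mulr_ge0.
  have t'0 z : 0 <= tensor b a z by rewrite mulr_ge0.
  rewrite (jump_partD K v2 (mtensor ma mb) (mtensor mb ma) t0 t'0).
  rewrite (jump_tensor ma a0 b0 av bv) (jump_tensor mb b0 a0 bv av).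
  by rewrite (part_sym pa pb); move: (BF a b) => z; rewrite (mule_natl z 2) mule2n.
Qed.

(** Expansion of (f(y) - f(x))(g(y) - g(x)) with every subtraction moved to the other side, so that
    only nonnegative functions are integrated; symmetry of the kernel merges the terms in pairs. *)
Let jump_identity : (jump_part m K v q + 2%:E * cross_positive =
  2%:E * BF nz fg + 2%:E * cross_negative)%E.
Proof.
have pf : part (pos f) f by left. have nf : part (neg f) f by right.
have pg : part (pos g) g by left. have ng : part (neg g) g by right.
have [m11 p11 e11] := jump_sym_tensor pf pg.
have [m22 p22 e22] := jump_sym_tensor nf ng.
have [m12 p12 e12] := jump_sym_tensor pf ng.
have [m21 p21 e21] := jump_sym_tensor nf pg.
pose S1 z := sym_tensor (pos f) (pos g) z + sym_tensor (neg f) (neg g) z.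
pose S2 z := sym_tensor (pos f) (neg g) z + sym_tensor (neg f) (pos g) z.
pose G (z : E * E) := fg z.2 + fg z.1.
have mS1 : measurable_fun setT S1 by exact: measurable_funD m11 m22.
have mS2 : measurable_fun setT S2 by exact: measurable_funD m12 m21.
have mG : measurable_fun setT G by exact: measurable_funD (m2 mfg) (m1 mfg).
have S10 z : 0 <= S1 z by rewrite addr_ge0.
have S20 z : 0 <= S2 z by rewrite addr_ge0.
have G0 z : 0 <= G z by rewrite addr_ge0.
have q0 z : 0 <= q z by exact: dfg0.
have E0 : (fun z => q z + S1 z) = (fun z => G z + S2 z).
  apply/funext => -[x y]; rewrite /S1 /S2 /G /q /fg /sym_tensor /tensor /=.
  by rewrite (hE f x) (hE f y) (hE g x) (hE g y); ring.
have := congr1 (jump_part m K v) E0.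
rewrite (jump_partD K v2 mq mS1 q0 S10) (jump_partD K v2 mG mS2 G0 S20).
rewrite (jump_partD K v2 m11 m22 p11 p22) (jump_partD K v2 m12 m21 p12 p21) e11 e22 e12 e21.
have fg20 (z : E * E) : 0 <= fg z.2 by [].
have fg10 (z : E * E) : 0 <= fg z.1 by [].
rewrite (jump_partD K v2 (m2 mfg) (m1 mfg) fg20 fg10).
have e1 : jump_part m K v (fun z => fg z.2) = BF fg nz.
  apply: jump_part_tensor => // x y /=.
  by rewrite -mulrA (nzE (a := fg))//; exact: fgv.
have e2 : jump_part m K v (fun z => fg z.1) = BF nz fg.
  apply: jump_part_tensor => // x y /=.
  by rewrite mulrAC (nzE (a := fg))//; exact: fgv.
have e3 := kernel_form_sym K_L2 K_sym v2 mfg mnz fg_ge0 nz0 fgv nz_v.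
rewrite e1 e2 e3; apply: double_sum; exact: kernel_form_ge0.
Qed.

Let kernel_opE x : (KI (pos f) x < +oo)%E -> (KI (neg f) x < +oo)%E ->
  (kernel_op K f x)%:E = (KI (pos f) x - KI (neg f) x)%E.
Proof.
have integ h : measurable_fun setT h -> (forall x, 0 <= h x) -> (KI h x < +oo)%E ->
    (K x).-integrable setT (EFin \o h).
  move=> mh h0 hlty; apply/integrableP; split; first exact/measurable_EFinP.
  by under eq_integral do rewrite /= ger0_norm//.
move=> /(integ _ (mpos mf) (pos0 f)) ip /(integ _ (mneg mf) (neg0 f)) in_.
rewrite /kernel_op /kint -integralB_EFin// /Rintegral.
have -> : (\int[K x]_y (f y)%:E = \int[K x]_y ((pos f y)%:E - (neg f y)%:E))%E.
  by apply: eq_integral => y _; rewrite -EFinB {1}(hE f y).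
rewrite fineK// integralB_EFin// fin_numB.
by rewrite (integrable_fin_num _ ip)// (integrable_fin_num _ in_).
Qed.

Let measurable_kernel_op : measurable_fun setT (kernel_op K f).
Proof.
apply: measurableT_comp => //.
rewrite (_ : (fun x => _) = (fun x => \int[K x]_y ((EFin \o f)^\+ y) - \int[K x]_y ((EFin \o f)^\- y))%E).
  have mef : measurable_fun setT (EFin \o f) by exact/measurable_EFinP.
  apply: emeasurable_funB; apply: measurable_fun_integral_kernel => //.
  - by move=> U mU; exact: measurable_kernel.
  - exact: measurable_funepos.
  - by move=> U mU; exact: measurable_kernel.
  - exact: measurable_funeneg.
by apply/funext => x; rewrite integralE.
Qed.

Let part_integrable a b : part a f -> part b g ->
  m.-integrable setT (fun x => ((b x)%:E * KI a x)%E).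
Proof.
move=> pa pb; have [ma a0 av af] := part_facts pa mf fv.
have [mb b0 bv bg] := part_facts pb mg gv.
apply/integrableP; split; first exact: measurable_kernel_form.
apply: le_lt_trans (part_lty pa pb).
apply: ge0_le_integral => //.
- exact: measurableT_comp (measurable_kernel_form _ ma mb a0).
- exact: measurable_kernel_form.
- by move=> x _; rewrite gee0_abs// mule_ge0 ?kint_ge0// lee_fin.
Qed.

(** Where g(x) is nonzero, finiteness of the four products makes [f] integrable for [K x], so that
    [kernel_op K f x] is a genuine integral. Where g(x) = 0 both sides vanish, whatever its
    value. *)
Let kernel_op_pointwise : {ae m, forall x, (kernel_op K f x * g x)%:E =
  (((pos g x)%:E * KI (pos f) x + (neg g x)%:E * KI (neg f) x)
   - ((neg g x)%:E * KI (pos f) x + (pos g x)%:E * KI (neg f) x))%E}.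
Proof.
have pf : part (pos f) f by left. have nf : part (neg f) f by right.
have pg : part (pos g) g by left. have ng : part (neg g) g by right.
have A1 := integrable_ae measurableT (part_integrable nf ng).
have A2 := integrable_ae measurableT (part_integrable nf pg).
have A3 := integrable_ae measurableT (part_integrable pf ng).
have A4 := integrable_ae measurableT (part_integrable pf pg).
apply: filterS2 (filterI A1 A2) (filterI A3 A4) => x [/(_ I) F1 /(_ I) F2] [/(_ I) F3 /(_ I) F4].
have [gx0|gx0] := eqVneq (g x) 0.
  have -> : pos g x = 0 by rewrite /pos gx0 maxxx.
  have -> : neg g x = 0 by rewrite /neg gx0 oppr0 maxxx.
  by rewrite gx0 mulr0 !mul0e !adde0 sube0.
have fin h : (forall x, 0 <= h x) -> ((pos g x)%:E * KI h x)%E \is a fin_num ->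
    ((neg g x)%:E * KI h x)%E \is a fin_num -> (KI h x < +oo)%E.
  move=> h0; rewrite -ge0_fin_numE ?kint_ge0//.
  have := kint_ge0 K x h0; case: (KI h x) => // _.
  have [g0|g0|g0] := ltgtP (g x) 0; last by rewrite g0 eqxx in gx0.
  - move=> _; have -> : neg g x = - g x by rewrite /neg max_l// oppr_ge0 ltW.
    by rewrite gt0_muley ?lte_fin ?oppr_gt0.
  - move=> + _; have -> : pos g x = g x by rewrite /pos max_l// ltW.
    by rewrite gt0_muley ?lte_fin.
have fp := fin _ (pos0 f) F4 F3; have fn := fin _ (neg0 f) F2 F1.
have := kernel_opE fp fn.
have : KI (pos f) x \is a fin_num by rewrite ge0_fin_numE ?kint_ge0.
have : KI (neg f) x \is a fin_num by rewrite ge0_fin_numE ?kint_ge0.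
case: (KI (neg f) x) => // r _; case: (KI (pos f) x) => // s _ [->].
rewrite -!EFinM -!EFinD; congr EFin; rewrite {1}(hE g x); ring.
Qed.

Let pairing_kernel : m.-integrable setT (fun x => (kernel_op K f x * g x)%:E) /\
  (\int[m]_x (kernel_op K f x * g x)%:E = cross_positive - cross_negative)%E.
Proof.
have pf : part (pos f) f by left. have nf : part (neg f) f by right.
have pg : part (pos g) g by left. have ng : part (neg g) g by right.
have ip := integrableD measurableT (part_integrable pf pg) (part_integrable nf ng).
have in_ := integrableD measurableT (part_integrable pf ng) (part_integrable nf pg).
have mkg : measurable_fun setT (fun x => (kernel_op K f x * g x)%:E).
  by apply/measurable_EFinP; exact: measurable_funM.
have ae_kg := kernel_op_pointwise.
have i := integrableB measurableT ip in_.
split.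
  apply/integrableP; split => //; have /integrableP[mi] := i.
  rewrite (@ae_eq_integral _ _ _ _ _ (fun x => `|(kernel_op K f x * g x)%:E|%E))//.
  - exact: measurableT_comp mi.
  - exact: measurableT_comp mkg.
  - by apply: filterS ae_kg => x ->.
have /integrableP[mi _] := i.
rewrite (ae_eq_integral _ _ measurableT mkg mi); last by apply: filterS ae_kg => x ->.
rewrite integralB// !integralD//; [exact: part_integrable..].
Qed.

(** Summation by parts for a symmetric kernel: half of [jump_identity], with [BF_fg] for the
    diagonal terms and [pairing_kernel] for the cross terms. The other terms being finite, so is the
    jump part, and linear arithmetic concludes. *)
Lemma kernel_representation :
  ((2^-1)%:E * jump_part m K v q + kill_part m K v fg =
   (\int[m]_x ((f x - kernel_op K f x) * g x))%:E)%E.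
Proof.
have [ikg ekg] := pairing_kernel.
have ifg : m.-integrable setT (EFin \o fg).
  apply/integrableP; split; first exact/measurable_EFinP.
  by under eq_integral do rewrite /= ger0_norm//.
have -> : \int[m]_x ((f x - kernel_op K f x) * g x) =
    \int[m]_x fg x - \int[m]_x (kernel_op K f x * g x).
  by rewrite -RintegralB//; apply: eq_Rintegral => x _; rewrite /fg; ring.
rewrite EFinB /Rintegral !fineK ?(integrable_fin_num _ ifg)// ?(integrable_fin_num _ ikg)//.
rewrite ekg -BF_fg.
have pf : part (pos f) f by left. have nf : part (neg f) f by right.
have pg : part (pos g) g by left. have ng : part (neg g) g by right.
have lty a b : part a f -> part b g -> BF a b \is a fin_num.
  move=> pa pb; rewrite ge0_fin_numE; first exact: part_lty.
  have [_ a0 _ _] := part_facts pa mf fv; have [_ b0 _ _] := part_facts pb mg gv.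
  exact: kernel_form_ge0.
have cpfin : cross_positive \is a fin_num by rewrite fin_numD !lty.
have cnfin : cross_negative \is a fin_num by rewrite fin_numD !lty.
have sfin : (BF nz fg + kill_part m K v fg)%E \is a fin_num.
  by rewrite BF_fg ge0_fin_numE// integral_ge0// => x _; rewrite lee_fin.
move: sfin jump_identity; rewrite fin_numD => /andP[bfin kfin].
move: cpfin cnfin bfin kfin.
case: (cross_positive) => // p _; case: (cross_negative) => // n _.
case: (BF nz fg) => // b _; case: (kill_part m K v fg) => // k _.
case: (jump_part m K v q) => // j [] H; congr EFin; lra.
Qed.

End product_functions.
End kernel_representation.

(** * Quasi-continuous modifications *)

Section geometric_sequences.
Context {R : realType}.
Local Notation half := (2^-1 : R).

Lemma geometric_small (c z e : R) : 0 < c -> 0 < z < 1 -> 0 < e ->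
  exists N, c * z ^+ N < e.
Proof.
move=> c0 /andP[z0 z1] e0; have := @cvg_expr R z; rewrite gtr0_norm// => /(_ z1).
move/cvgrPdist_lt => /(_ (e / c)); rewrite divr_gt0// => /(_ isT)[N _ HN].
exists N; have := HN N (leqnn _); rewrite /= sub0r normrN gtr0_norm ?exprn_gt0//.
by rewrite ltr_pdivlMr// mulrC.
Qed.

Lemma geometric_cvg (w : nat -> R) n :
  (forall k, (n <= k)%N -> `|w k.+1 - w k| <= half ^+ k) ->
  cvg (w @ \oo) /\ forall i, (n <= i)%N -> `|lim (w @ \oo) - w i| <= 2 * half ^+ i.
Proof.
move=> wD.
have h0 : 0 < half by rewrite invr_gt0.
(* Subtracting the remaining tail strengthens the bound enough for an induction on [l]. *)
have W i l : (n <= i)%N -> `|w (i + l)%N - w i| <= 2 * half ^+ i - 2 * half ^+ (i + l).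
  move=> ni; elim: l => [|l IH]; first by rewrite addn0 !subrr normr0.
  have := wD (i + l)%N (leq_trans ni (leq_addr _ _)).
  have := ler_normD (w (i + l).+1 - w (i + l)%N) (w (i + l)%N - w i).
  rewrite addnS subrKA exprS; move: IH; set x := half ^+ (i + l); set y := half ^+ i.
  have -> : 2 * (half * x) = x by rewrite mulrA divff// mul1r.
  lra.
have W2 i j : (n <= i)%N -> (i <= j)%N -> `|w j - w i| <= 2 * half ^+ i.
  move=> ni ij; have := W i (j - i)%N ni; rewrite subnKC//.
  have : 0 <= half ^+ j by rewrite exprn_ge0// ltW.
  by lra.
have hN (e : R) : 0 < e -> exists N, 2 * half ^+ N < e.
  by apply: geometric_small => //; rewrite h0 invf_lt1// ltr1n.
have cw : cvg (w @ \oo).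
  apply/cauchy_cvgP/cauchy_exP => e e0.
  have [N NE] := hN _ e0; exists (w (maxn n N)), (maxn n N) => // j /= ij.
  rewrite /ball /= distrC; apply: le_lt_trans (W2 _ _ (leq_maxl n N) ij) _.
  apply: le_lt_trans NE; rewrite ler_pM2l// ler_wiXn2l ?leq_maxr// ?(ltW h0)//.
  by rewrite invf_le1// ler1n.
split => // i ni.
have C : `|w j - w i| @[j --> \oo] --> `|lim (w @ \oo) - w i|.
  by apply: cvg_norm; apply: cvgB => //; exact: cvg_cst.
rewrite -(cvg_lim _ C)//; apply: limr_le; first by apply/cvg_ex; eexists; exact: C.
by near=> j; apply: W2 => //; near: j; exact: nbhs_infty_ge.
Unshelve. all: by end_near. Qed.

End geometric_sequences.

Section quasi_continuity.
Context d (R : realType) (E : borelMetricType d R) (m : {measure set E -> \bar R}).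
Context (D : set (E -> R)) (A : (E -> R) -> (E -> R) -> R).
Hypothesis dir : dirichlet_form m D A.
Implicit Types (u v w f g : E -> R).

Let F := df_form dir.

Definition energy1 u v := A u v + pairing m u v.

Lemma form1E u : D u -> form1 m A u = energy1 u u.
Proof. by move=> Du; rewrite /form1 l2norm_pairing//; exact: (sf_L2 F). Qed.

Lemma energy1_form : Defs.symmetric_form m D energy1.
Proof.
have L2 := pairing_form m; have D2 := sf_L2 F.
split.
- exact: D2.
- exact: (sf_ae F).
- move=> u v w Du Dv Dw uv; congr (_ + _); first exact: (sf_form_ae F Du Dv Dw uv).
  exact: (sf_form_ae L2 (D2 _ Du) (D2 _ Dv) (D2 _ Dw) uv).
- exact: (sf_zero F).
- exact: (sf_lin F).
- move=> u v Du Dv; congr (_ + _); first exact: (sf_form_sym F Du Dv).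
  exact: (sf_form_sym L2 (D2 _ Du) (D2 _ Dv)).
- move=> c u v w Du Dv Dw; rewrite /energy1 (sf_form_lin F _ Du Dv Dw).
  rewrite (sf_form_lin L2 _ (D2 _ Du) (D2 _ Dv) (D2 _ Dw)).
  by move: (A u w) (A v w) (pairing m u w) (pairing m v w) => a1 a2 a3 a4; ring.
- by move=> u Du; rewrite addr_ge0 ?(sf_form_ge0 F)// (sf_form_ge0 L2)//; exact: D2.
Qed.

Let F1 := energy1_form.

Lemma pairing_le_energy1 u : D u -> pairing m u u <= energy1 u u.
Proof. by move=> Du; rewrite lerDr (sf_form_ge0 F). Qed.

Lemma form_le_energy1 u : D u -> A u u <= energy1 u u.
Proof. by move=> Du; rewrite lerDl (sf_form_ge0 (pairing_form m))//; exact: (sf_L2 F). Qed.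

Lemma pairing_le f g : f \in Lfun m 2%:E -> g \in Lfun m 2%:E ->
  (forall x, `|f x| <= `|g x|) -> pairing m f f <= pairing m g g.
Proof.
move=> f2 g2 fg; rewrite -lee_fin !pairing_sqr//; apply: ge0_le_integral => //.
- by move=> x _; rewrite lee_fin sqr_ge0.
- exact: measurable_sqrE (Lfun_measurable f2).
- exact: measurable_sqrE (Lfun_measurable g2).
- move=> x _; rewrite lee_fin -(real_normK (num_real (f x))) -(real_normK (num_real (g x))).
  by rewrite lerXn2r ?nnegrE.
Qed.

Lemma norm_dom u : D u -> D (fun x => `|u x|) /\
  energy1 (fun x => `|u x|) (fun x => `|u x|) <= energy1 u u.
Proof.
move=> Du; have [Dn le] : D (fun x => `|u x|) /\ A (fun x => `|u x|) (fun x => `|u x|) <= A u u.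
  apply: (df_markov dir) => //; split=> [x|x y]; first by rewrite normr_id.
  exact: ler_dist_dist.
split => //; rewrite lerD// /pairing le_eqVlt; apply/orP; left; apply/eqP.
by apply: eq_Rintegral => x _; rewrite -normrM ger0_norm// -expr2 sqr_ge0.
Qed.

(** Summed from the front to suit the energy estimate: splitting off the first term costs a factor 2
    on the rest, which the ratio 1/16 absorbs. *)
Fixpoint partial_sum (a : nat -> E -> R) n l : E -> R :=
  if l is l'.+1 then fun x => a n x + partial_sum a n.+1 l' x else cst 0.

Section summable.
Context (a : nat -> E -> R) (c : R).
Hypotheses (aD : forall k, D (a k)) (a0 : forall k x, 0 <= a k x).
Hypotheses (c0 : 0 < c) (ac : forall k, energy1 (a k) (a k) <= c * (16^-1) ^+ k).

Let S := partial_sum a.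

Let SD n l : D (S n l).
Proof.
elim: l n => [|l IH] n /=; first exact: (sf_zero F).
by apply: (domD F).
Qed.

Let S_energy n l : energy1 (S n l) (S n l) <= 4 * c * (16^-1) ^+ n.
Proof.
elim: l n => [|l IH] n /=.
  by rewrite (form0l F1 (sf_zero F)) mulr_ge0 ?exprn_ge0// mulr_ge0// ltW.
apply: le_trans (form_sqrD_le F1 (aD n) (SD n.+1 l)) _.
have := IH n.+1; have := ac n; rewrite exprS.
have : 0 <= c * 16^-1 ^+ n by rewrite mulr_ge0 ?exprn_ge0// ltW.
rewrite (mulrA (4 * c)) -!(mulrA 4) (mulrAC c).
by set z := c * _ ^+ n; lra.
Qed.

Let S_tail n l k x : S n (l + k)%N x = S n l x + S (n + l)%N k x.
Proof.
elim: l n => [|l IH] n; first by rewrite add0n addn0 /S/= add0r.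
have -> : S n (l.+1 + k)%N x = a n x + S n.+1 (l + k)%N x by [].
by rewrite IH addrA addSnnS.
Qed.

Let S_ge0 n l x : 0 <= S n l x.
Proof. by elim: l n => [|l IH] n //=; rewrite addr_ge0. Qed.

Let S_ge n l k x : (n <= k < n + l)%N -> a k x <= S n l x.
Proof.
elim: l n => [|l IH] n /=; first by rewrite addn0 => /andP[/leq_ltn_trans] + H => /(_ _ H); rewrite ltnn.
rewrite leq_eqVlt => /andP[/predU1P[->|nk kl]]; first by rewrite lerDl.
by apply: le_trans (IH n.+1 _) _; rewrite ?lerDr// nk addSnnS.
Qed.

(** This plays the part of Chebyshev's inequality: [h] is a test function for the capacity of the
    set where some a_k with k >= n exceeds 1. It is the limit in [D] of the partial sums, whose
    energy is at most 4c/16^n; a remainder of energy below c/16^n gives 10 = 2 * 4 + 2. The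
    domination holds because the positive part of S_l - h is at most |S_l' - h| for l' >= l, which
    tends to 0 in L^2. *)
Lemma summable_bound n : exists h, [/\ D h, form1 m A h <= 10 * c * (16^-1) ^+ n &
  {ae m, forall x, forall k, (n <= k)%N -> a k x <= h x}].
Proof.
have q0 k : 0 < c * 16^-1 ^+ k by rewrite mulr_gt0// exprn_gt0.
have small (e : R) : 0 < e -> exists N, 4 * c * (16^-1) ^+ N < e.
  by apply: geometric_small; rewrite ?mulr_gt0// invr_gt0 invf_lt1// ltr0n ltr1n.
have [|h Dh hS] := df_closed dir (s := S n) (SD n).
  move=> e e0; have [N NE] := small e e0; exists N => i j Ni Nj.
  wlog ij : i j Ni Nj / (j <= i)%N.
    move=> wlg; have [|/ltnW] := leqP j i; [exact: wlg|move=> ij].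
    have := wlg j i Nj Ni ij; rewrite !form1E; [|exact: (domB F)..].
    have DB := domB F (SD n i) (SD n j).
    have -> : S n j \- S n i = fun x => - (S n i \- S n j) x.
      by apply/funext => x /=; rewrite opprB.
    by rewrite (formNl F1) ?(formNr F1) ?opprK//; exact: (domN F).
  rewrite form1E; last by exact: (domB F).
  have -> : S n i \- S n j = S (n + j)%N (i - j)%N.
    by apply/funext => x /=; rewrite -{1}(subnKC ij) S_tail addrAC subrr add0r.
  apply: le_lt_trans (S_energy _ _) _; apply: le_lt_trans NE.
  rewrite ler_pM2l ?mulr_gt0// ler_wiXn2l//; last by rewrite (leq_trans Nj)// leq_addl.
  by rewrite invf_le1// ler1n.
have hS' e : 0 < e -> exists N, forall l, (N <= l)%N -> energy1 (fun x => S n l x - h x) (fun x => S n l x - h x) < e.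
  move=> e0; move/cvgr0Pnorm_lt : hS => /(_ _ e0)[N _ H]; exists N => l Nl.
  have := H l Nl; rewrite form1E; last exact: (domB F).
  by apply: le_lt_trans; exact: ler_norm.
exists h; split => //.
- have [N /(_ N (leqnn _)) SN] := hS' _ (q0 n).
  rewrite form1E//.
  have -> : h = fun x => S n N x - (S n N x - h x) by apply/funext => x; rewrite opprB addrC subrK.
  have DB : D (fun x => S n N x - h x) by exact: (domB F).
  apply: le_trans (form_sqrB_le F1 (SD n N) DB) _.
  by have := S_energy n N; move: SN; rewrite -!(mulrA _ c); set z := c * _; lra.
- have le l : {ae m, forall x, S n l x <= h x}.
    pose g x := Num.max 0 (S n l x - h x).
    have [Dg _] : D g /\ A g g <= _ :=
      half_contraction_dom (df_markov dir) half_contraction_max0 (domB F (SD n l) Dh).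
    have g2 := sf_L2 F Dg.
    have g_small e : 0 < e -> pairing m g g <= e.
      move=> e0; have [N /(_ (maxn N l) (leq_maxl _ _)) H] := hS' e e0.
      have DB : D (fun x => S n (maxn N l) x - h x) by exact: (domB F).
      apply: (le_trans _ (ltW H)); apply: le_trans (pairing_le_energy1 DB).
      apply: pairing_le => //; first exact: (sf_L2 F).
      move=> x; rewrite /g; have : S n l x <= S n (maxn N l) x.
        by rewrite -(subnKC (leq_maxr N l)) S_tail lerDl S_ge0.
      have := ler_norm (S n (maxn N l) x - h x); have := normr_ge0 (S n (maxn N l) x - h x).
      case: (leP 0 (S n l x - h x)) => y0; last by rewrite normr0.
      by rewrite (ger0_norm y0); lra.
    have g0 : pairing m g g = 0.
      apply/eqP; rewrite eq_le (sf_form_ge0 (pairing_form m) g2).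
      rewrite andbT; apply/ler_addgt0Pr => e e0; by rewrite add0r g_small.
    have mg2 := measurable_sqrE (Lfun_measurable g2).
    have /(ae_eq_integral_abs m measurableT mg2) : (\int[m]_x `|(g x ^+ 2)%:E| = 0)%E.
      under eq_integral do rewrite gee0_abs ?lee_fin ?sqr_ge0//.
      by rewrite -pairing_sqr// g0.
    apply: filterS => x /(_ I)/= [/eqP]; rewrite sqrf_eq0 /g => /eqP.
    by rewrite -subr_le0; case: (leP 0 (S n l x - h x)) => [_ ->|/ltW].
  have : {ae m, forall x, forall l, S n l x <= h x} by exact: ae_foralln.
  apply: filterS => x H k nk; apply: le_trans (H (k - n).+1).
  by apply: S_ge; rewrite nk/= addnS subnKC.
Qed.

End summable.
End quasi_continuity.

Section quasi_continuous_modification.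
Context d (R : realType) (E : borelMetricType d R) (m : {measure set E -> \bar R}).
Context (D : set (E -> R)) (A : (E -> R) -> (E -> R) -> R).
Implicit Types (u v w f g : E -> R).

Lemma open_measurable (U : set E) : open U -> measurable U.
Proof. by move=> oU; rewrite measurable_borel; exact: sub_sigma_algebra. Qed.

Lemma extend0_continuous w : Cc w -> continuous (extend0 w).
Proof.
move=> [cw Kw] [x|].
  by move=> V /cw; exact.
move=> V /nbhs_singleton /= V0.
exists (closure [set x | w x != 0]); first by split => //; exact: closed_closure.
move=> z [[x /= Kx <-]|->] //=.
suff -> : w x = 0 by [].
by apply/eqP/negPn/negP => wx; apply: Kx; exact: subset_closure.
Qed.

Lemma quasi_continuous_comp (h : R -> R) u : continuous h -> h 0 = 0 ->
  quasi_continuous m D A u -> quasi_continuous m D A (h \o u).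
Proof.
move=> ch h0 qu e e0; have [G [oG capG cG]] := qu e e0.
exists G; split => //.
have -> : extend0 (h \o u) = h \o extend0 u by apply/funext => -[x|] /=.
move/subspace_continuousP : cG => cG; apply/subspace_continuousP => x Ax.
by apply: cvg_comp; [exact: cG|exact: ch].
Qed.

Lemma qc_modification_comp (h : R -> R) u ut : continuous h -> h 0 = 0 ->
  qc_modification m D A u ut -> qc_modification m D A (h \o u) (h \o ut).
Proof.
move=> ch h0 [mut qut uut]; split.
- by apply: measurableT_comp => //; exact: continuous_measurable_fun.
- exact: quasi_continuous_comp.
- by apply: filterS uut => x /= H Ix; rewrite H.
Qed.

Hypotheses (dir : dirichlet_form m D A) (reg : regular m D A).
Let F := df_form dir.
Let F1 := energy1_form dir.

(** Approximants with error 64^-n still have energies of order 16^-n after multiplication by 2^n, as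
    [summable_bound] requires. Outside the open set [G n], of small capacity, consecutive
    approximants differ by at most 2^-k for k >= n, so they converge uniformly. *)
Lemma qc_modification_exists v : D v -> exists vt, qc_modification m D A v vt.
Proof.
move=> Dv.
have h0 : (0 : R) < 2^-1 by rewrite invr_gt0.
have W n : exists w, [/\ D w, Cc w & form1 m A (v \- w) < 64^-1 ^+ n].
  by apply: (reg_form reg Dv); rewrite exprn_gt0// invr_gt0.
have [w wP] := boolp.choice W.
have wD n : D (w n) by have [] := wP n.
have wC n : Cc (w n) by have [] := wP n.
have vwD n : D (fun x => v x - w n x) by exact: (domB F).
have wE n : energy1 m A (fun x => v x - w n x) (fun x => v x - w n x) <= 64^-1 ^+ n.
  by have [_ _ /ltW] := wP n; rewrite (form1E dir) //; exact: vwD.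
pose a k x := 2 ^+ k * `|w k.+1 x - w k x|.
pose b k x := 2 ^+ k * `|v x - w k x|.
have p16 k : 2 ^+ k ^+ 2 * 64^-1 ^+ k = 16^-1 ^+ k :> R.
  by rewrite exprAC -exprMn; congr (_ ^+ k); rewrite -natrX; field.
have scaled f k c : D f -> energy1 m A f f <= c * 64^-1 ^+ k ->
    D (fun x => 2 ^+ k * `|f x|) /\
    energy1 m A (fun x => 2 ^+ k * `|f x|) (fun x => 2 ^+ k * `|f x|) <= c * 16^-1 ^+ k.
  move=> Df fc; have [Dn le] := norm_dom dir Df; split; first exact: (domZ F).
  rewrite (form_sqrZ F1)// -p16 mulrCA ler_wpM2l ?sqr_ge0//; exact: le_trans fc.
have rE k : energy1 m A (fun x => w k.+1 x - w k x) (fun x => w k.+1 x - w k x) <= 4 * 64^-1 ^+ k.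
  have -> : (fun x => w k.+1 x - w k x) = (fun x => (v x - w k x) - (v x - w k.+1 x)).
    by apply/funext => x; ring.
  apply: le_trans (form_sqrB_le F1 (vwD k) (vwD k.+1)) _.
  have := wE k; have := wE k.+1; rewrite exprS.
  have : (0 : R) <= 64^-1 ^+ k by rewrite exprn_ge0.
  by set z := 64^-1 ^+ k; lra.
have aP k := scaled _ k 4 (domB F (wD k.+1) (wD k)) (rE k).
have bP k : D (b k) /\ energy1 m A (b k) (b k) <= 4 * 16^-1 ^+ k.
  apply: scaled => //; apply: le_trans (wE k) _.
  by rewrite ler_peMl ?exprn_ge0// ler1n.
have a0 k x : 0 <= a k x by rewrite mulr_ge0// exprn_ge0.
(* The almost everywhere bound on [b] will show that [w k] tends to [v], which identifies the
   limit. *)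
have b0 k x : 0 <= b k x by rewrite mulr_ge0// exprn_ge0.
have c4 : (0 : R) < 4 by [].
have hA := summable_bound dir (fun k => (aP k).1) a0 c4 (fun k => (aP k).2).
have [h [_ _ hb]] := summable_bound dir (fun k => (bP k).1) b0 c4 (fun k => (bP k).2) 0%N.
pose G n := \bigcup_(k in [set k | (n <= k)%N]) [set x | 1 < a k x].
have oG n : open (G n).
  apply: bigcup_open => k _.
  apply: (@open_comp _ _ (a k) [set y | 1 < y]); last exact: open_gt.
  move=> x _; apply: cvgM; first exact: cvg_cst.
  apply: cvg_norm; apply: cvgB; [exact: (wC k.+1).1|exact: (wC k).1].
have GS i j : (i <= j)%N -> G j `<=` G i.
  by move=> ij x [k /= jk ak]; exists k => //=; exact: leq_trans jk.
have capG (e : R) : 0 < e -> exists n, (capacity m D A (G n) < e%:E)%E.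
  move=> e0; have [n nE] : exists n, 10 * 4 * 16^-1 ^+ n < e.
    by apply: geometric_small => //; rewrite invr_gt0 invf_lt1// ltr0n ltr1n.
  exists n; have [g [Dg gE ag]] := hA n.
  apply: (@le_lt_trans _ _ (form1 m A g)%:E); last by rewrite lte_fin (le_lt_trans gE).
  apply: ereal_inf_lbound; exists g => //; split => //.
  apply: filterS ag => x H [k /= nk ak]; exact: le_trans (ltW ak) (H k nk).
have step n x k : ~ G n x -> (n <= k)%N -> `|w k.+1 x - w k x| <= 2^-1 ^+ k.
  move=> nG nk; rewrite leNgt; apply/negP => ak; apply: nG; exists k => //=.
  by rewrite /a -ltr_pdivrMl ?exprn_gt0// mulr1 -exprVn.
(* Putting [v] on [G n] makes the sequence converge at every point, with limit [v] on the
   intersection of all [G n]; the limit is then Borel on the whole space. *)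
pose u n x : R := \1_(G n) x * v x + (1 - \1_(G n) x) * w n x.
have uG n x : G n x -> u n x = v x.
  by move=> Gx; rewrite /u indicE mem_set// mul1r subrr mul0r addr0.
have unG n x : ~ G n x -> u n x = w n x.
  by move=> Gx; rewrite /u indicE memNset// mul0r add0r subr0 mul1r.
have u_w n x : ~ G n x -> \forall i \near \oo, u i x = w i x.
  by move=> nG; exists n => // i /= ni; apply: unG => Gi; exact: nG (GS _ _ ni _ Gi).
pose vt x := lim (u ^~ x @ \oo).
have vt_lim n x : ~ G n x -> vt x = lim (w ^~ x @ \oo) /\ cvg (u ^~ x @ \oo).
  move=> nG; have [cw _] := geometric_cvg (fun k => step n x k nG).
  have cu : u ^~ x @ \oo --> lim (w ^~ x @ \oo).
    apply: cvg_trans cw; apply: near_eq_cvg.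
    by apply: filterS (u_w n x nG) => i ->.
  by split; [exact: cvg_lim cu|apply/cvg_ex; eexists; exact: cu].
have vt_bound n x i : ~ G n x -> (n <= i)%N -> `|vt x - w i x| <= 2 * 2^-1 ^+ i.
  move=> nG ni; have [_ wb] := geometric_cvg (fun k => step n x k nG).
  by rewrite (vt_lim n x nG).1; exact: wb.
have allG x : (forall n, G n x) -> u ^~ x @ \oo --> v x.
  by move=> Gx; apply: cvg_near_cst; apply: nearW => n; exact: uG.
have cvgu x : u ^~ x @ \oo --> vt x.
  have [Gx|/existsNP[n nG]] := pselect (forall n, G n x).
    by apply/cvg_ex; exists (v x); exact: allG.
  by have [_] := vt_lim n x nG.
exists vt; split.
- apply: (@measurable_fun_cvg _ _ _ setT u) => [n|x _]; last exact: cvgu.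
  have mG : measurable_fun setT (\1_(G n) : E -> R).
    by apply: measurable_indic; exact/open_measurable.
  have mL f : D f -> measurable_fun setT f by move=> /(sf_L2 F)/Lfun_measurable.
  apply: measurable_funD; apply: measurable_funM => //; [exact: mL|  |exact: mL].
  exact: measurable_funB.
- move=> e e0; have [n nE] := capG e e0; exists (G n); split => //.
  apply/subspace_continuousP => z Gz; apply/cvgrPdist_lt => r r0.
  have [N NE] : exists N, 2 * 2^-1 ^+ N < r / 3.
    by apply: geometric_small; rewrite ?divr_gt0// h0 invf_lt1// ltr1n.
  pose i := maxn n N.
  have iE : 2 * 2^-1 ^+ i < r / 3.
    apply: le_lt_trans NE; rewrite ler_pM2l// ler_wiXn2l ?leq_maxr// ?(ltW h0)//.
    by rewrite invf_le1// ler1n.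
  have near_w y : ~ (Some @` G n) y -> `|extend0 vt y - extend0 (w i) y| < r / 3.
    case: y => [y|_] /=; last by rewrite subrr normr0 divr_gt0.
    move=> nG; apply: le_lt_trans (vt_bound n y i _ (leq_maxl _ _)) iE.
    by move=> Gy; apply: nG; exists y.
  have : extend0 (w i) y @[y --> z] --> extend0 (w i) z by exact: extend0_continuous.
  move/cvgrPdist_lt => /(_ (r / 3)).
  rewrite divr_gt0// => /(_ isT) H.
  apply: filterS H => y H1 Gy.
  have H2 := near_w z Gz; have H3 := near_w y Gy.
  have -> : extend0 vt z - extend0 vt y = (extend0 vt z - extend0 (w i) z) +
      (extend0 (w i) z - extend0 (w i) y) - (extend0 vt y - extend0 (w i) y) by ring.
  apply: le_lt_trans (ler_normB _ _) _.
  have := ler_normD (extend0 vt z - extend0 (w i) z) (extend0 (w i) z - extend0 (w i) y).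
  by move: H1 H2 H3; set z1 := `|_|; set z2 := `|_|; set z3 := `|_|; set z4 := `|_|; lra.
- apply: filterS hb => x H _.
  have [Gx|/existsNP[n nG]] := pselect (forall n, G n x).
    exact: cvg_lim (allG x Gx).
  apply/eqP; rewrite -subr_eq0 -normr_eq0 eq_le normr_ge0 andbT.
  apply/ler_addgt0Pr => e e0; rewrite add0r.
  have hx : 0 <= h x := le_trans (b0 0%N x) (H 0%N (leqnn _)).
  have [N NE] : exists N, (2 + h x) * 2^-1 ^+ N < e.
    by apply: geometric_small; rewrite ?ltr_wpDr// h0 invf_lt1// ltr1n.
  pose i := maxn n N.
  have -> : vt x - v x = (vt x - w i x) - (v x - w i x) by ring.
  apply: le_trans (ler_normB _ _) _.
  have H1 := vt_bound n x i nG (leq_maxl _ _).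
  have H2 : `|v x - w i x| <= h x * 2^-1 ^+ i.
    by rewrite exprVn ler_pdivlMr ?exprn_gt0// mulrC; exact: H.
  apply: le_trans (lerD H1 H2) _; rewrite -mulrDl; apply/ltW; apply: le_lt_trans NE.
  rewrite ler_wpM2l ?addr_ge0// ler_wiXn2l ?leq_maxr// ?(ltW h0)//.
  by rewrite invf_le1// ler1n.
Qed.

End quasi_continuous_modification.

(** * Strong locality *)

Section local_part.
Context d (R : realType) (E : borelMetricType d R) (m : {measure set E -> \bar R}).
Context (D : set (E -> R)) (A : (E -> R) -> (E -> R) -> R).
Hypotheses (dir : dirichlet_form m D A) (reg : regular m D A).
Context (T : R -> R.-spker E ~> E).
Hypothesis T_sg : semigroup_of m D A T.
Context (Ac : (E -> R) -> (E -> R) -> R).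
Context (J : {measure set (E * E)%type -> \bar R}) (k : {measure set E -> \bar R}).
Hypothesis bd : beurling_deny m D A Ac J k.
Implicit Types (u v w f g X Y : E -> R).

Let F := df_form dir.
Let M := df_markov dir.
Let Fc := bd_local_form bd.
Let Mc := bd_local_markov bd.
Let L2 := pairing_form m.

(** The jump and killing terms are nonnegative, but the Beurling-Deny formula speaks of given
    quasi-continuous modifications, so one must first be shown to exist. *)
Lemma local_form_le u : D u -> Ac u u <= A u u.
Proof.
move=> Du; have [ut uut] := qc_modification_exists dir reg Du.
have [_ _ ->] := bd_formula bd Du Du uut uut.
rewrite -addrA lerDl addr_ge0//.
  rewrite mulr_ge0// Rintegral_ge0// => z _.
  by rewrite /jump_integrand -expr2 sqr_ge0.
by rewrite Rintegral_ge0// => x _; rewrite -expr2 sqr_ge0.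
Qed.

Lemma local_young (l : R) u v : 0 < l -> D u -> D v ->
  `|Ac u v| * 2 <= l * A u u + l^-1 * A v v.
Proof.
move=> l0 Du Dv; apply: le_trans (form_young Fc l0 Du Dv) _.
by rewrite lerD// ler_wpM2l ?invr_ge0 ?(ltW l0)// local_form_le.
Qed.

Lemma energy1_sqrZ (c : R) u : D u ->
  energy1 m A (fun x => c * u x) (fun x => c * u x) = c ^+ 2 * energy1 m A u u.
Proof. exact: (form_sqrZ (energy1_form dir)). Qed.

(* The complement [id - r] is a contraction killing [u], so that
   [A(f - r f) <= A(f - r f, f)] is small by weak convergence. *)
Lemma half_contraction_stable (r : R -> R) u (e : R) : half_contraction r -> D u ->
  (forall x, r (u x) = u x) -> 0 < e ->
  exists2 dl, 0 < dl & forall f, D f ->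
    energy1 m A (fun x => f x - u x) (fun x => f x - u x) <= dl ->
    D (r \o f) /\ A (fun x => (r \o f) x - u x) (fun x => (r \o f) x - u x) <= e.
Proof.
move=> rC Du ru e0.
pose c := 2 * A u u + 2.
have c0 : 0 < c by have := sf_form_ge0 F Du; rewrite /c; lra.
have [r0 r00 weak] := form_weak_null F T_sg Du (ltW c0) (divr_gt0 e0 (ltr0n R 16)).
pose l := e / (8 * c).
have l0 : 0 < l by rewrite divr_gt0// mulr_gt0.
pose dl := Num.min 1 (Num.min r0 (Num.min (e / 16) (l * (e / 8)))).
have dl0 : 0 < dl by rewrite !lt_min ltr01 r00 !divr_gt0//= mulr_gt0// divr_gt0.
have [dl1 dlr dle dll] : [/\ dl <= 1, dl <= r0, dl <= e / 16 & dl <= l * (e / 8)].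
  by split; rewrite /dl !ge_min ?lexx ?orbT.
exists dl => // f Df fu; pose w x := f x - u x.
have Dw : D w by exact: (domB F).
have Aw : A w w <= dl := le_trans (form_le_energy1 dir Dw) fu.
have pC := half_contractionN rC.
pose g := (fun y => y - r y) \o f.
have [Dg Agf] := half_contraction_dom M pC Df.
have [Drf _] := half_contraction_dom M rC Df.
split => //.
have gw x : `|g x| <= `|w x|.
  have := half_contraction_norm (f x) (u x) pC; rewrite ru subrr subr0.
  exact.
have gr : pairing m g g <= r0.
  apply: le_trans dlr; apply: le_trans fu; apply: le_trans (pairing_le_energy1 dir Dw).
  by apply: pairing_le => //; exact: (sf_L2 F).
have Ag : A g g <= c.
  apply: le_trans Agf _.
  have -> : f = fun x => u x + w x by apply/funext => x; rewrite /w addrC subrK.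
  apply: le_trans (form_sqrD_le F Du Dw) _; rewrite /c lerD2l.
  by rewrite -[leRHS]mulr1 ler_pM2l// (le_trans Aw).
have Agu := weak g Dg Ag gr.
have Agw := form_young F l0 Dg Dw.
have : A g g <= A g u + A g w.
  apply: le_trans (half_contraction_form F M pC Df) _.
  by rewrite -(formDr F)// le_eqVlt; apply/orP; left; apply/eqP; congr A; apply/funext => x; rewrite /w addrC subrK.
have lc : l * A g g <= e / 8.
  apply: (@le_trans _ _ (l * c)); first by rewrite ler_pM2l.
  by rewrite (_ : l * c = e / 8)// /l; field; rewrite gt_eqF.
have lw : l^-1 * A w w <= e / 8 by rewrite ler_pdivrMl// (le_trans Aw).
have E0 : (fun x => (r \o f) x - u x) = fun x => w x - g x.
  by apply/funext => x; rewrite /w /g /=; ring.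
rewrite E0; have := form_sqrB_le F Dw Dg.
have := ler_norm (A g u); have := ler_norm (A g w).
move: e0 Agu Agw lc lw Aw dle; set q := A _ (fun x => w x - g x); clearbody dl l; lra.
Qed.

(** By [local_form_le] and Young's inequality, [Ac] is continuous for convergence in the energy
    [A]. *)
Lemma local_strong_limit X Y : D X -> D Y ->
  (forall e : R, 0 < e -> exists X' Y', [/\ D X', D Y',
     A (fun x => X' x - X x) (fun x => X' x - X x) <= e,
     A (fun x => Y' x - Y x) (fun x => Y' x - Y x) <= e & Ac X' Y' = 0]) ->
  Ac X Y = 0.
Proof.
move=> DX DY H; apply/eqP; rewrite -normr_eq0 eq_le normr_ge0 andbT.
apply/ler_addgt0Pr => n n0; rewrite add0r.
pose c := A X X + A Y Y + 1.
have AX0 := sf_form_ge0 F DX; have AY0 := sf_form_ge0 F DY.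
have c1 : 0 < c by rewrite /c; lra.
pose l := n / (2 * c); have l0 : 0 < l by rewrite divr_gt0// mulr_gt0.
pose e := Num.min (2^-1) (l * (n / 2)).
have e0 : 0 < e by rewrite lt_min invr_gt0 ltr0n/= mulr_gt0// divr_gt0.
have [e1 el] : e <= 2^-1 /\ e <= l * (n / 2) by rewrite /e !ge_min !lexx orbT.
have [X' [Y' [DX' DY' XX YY XY0]]] := H e e0.
have DdX : D (fun x => X' x - X x) by exact: (domB F).
have DdY : D (fun x => Y' x - Y x) by exact: (domB F).
have XYE : Ac X Y = - Ac (fun x => X' x - X x) Y - Ac X' (fun x => Y' x - Y x).
  by rewrite (formBl Fc)// (formBr Fc)// XY0; ring.
have H1 : l * A Y Y + l^-1 * A (fun x => X' x - X x) (fun x => X' x - X x) <= n / 2 + l * A Y Y.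
  by rewrite addrC lerD2r ler_pdivrMl// (le_trans XX).
have H2 : l * A X' X' + l^-1 * A (fun x => Y' x - Y x) (fun x => Y' x - Y x) <= n / 2 + l * A X' X'.
  by rewrite addrC lerD2r ler_pdivrMl// (le_trans YY).
have Y1 := local_young l0 DY DdX.
have Y2 := local_young l0 DX' DdY.
have AX' : A X' X' <= 2 * A X X + 1.
  have -> : X' = fun x => X x + (X' x - X x) by apply/funext => x; rewrite addrC subrK.
  by apply: le_trans (form_sqrD_le F DX DdX) _; move: XX e1; lra.
have lc : l * (A X' X' + A Y Y) <= n.
  apply: (@le_trans _ _ (l * (2 * c))); first by rewrite ler_pM2l// /c; move: AX' AY0; lra.
  by rewrite (_ : l * (2 * c) = n)// /l; field; rewrite gt_eqF.
rewrite XYE (sf_form_sym Fc DdX DY).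
have := ler_normB (- Ac Y (fun x => X' x - X x)) (Ac X' (fun x => Y' x - Y x)).
rewrite normrN; rewrite mulrDr in lc; move: H1 H2 Y1 Y2 lc; lra.
Qed.

(* For [f] continuous close to [v], perturbing [X] and [Y] by a multiple of
   [|v - f|] makes [X] constant on an open level set of [f] which contains the
   support of [Y], up to an error which is small in the form norm. *)
Lemma local_separated X Y v (c s1 s2 K : R) : D X -> D Y -> D v ->
  0 <= c -> 0 < K -> s1 < s2 ->
  (forall x, 0 <= Y x <= K) -> (forall x, c - K <= X x <= c) ->
  (forall x, 0 < Y x -> s2 <= v x) -> (forall x, s1 <= v x -> X x = c) ->
  Ac X Y = 0.
Proof.
move=> DX DY Dv c0 K0 s12 YK XK Yv Xv; apply: local_strong_limit => // e e0.
pose q := (s2 - s1) / 4; have q0 : 0 < q by rewrite divr_gt0// subr_gt0.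
have sq : s2 = s1 + 4 * q by rewrite /q; field.
have XC := half_contraction_min c0.
have [d1 d10 HX] := half_contraction_stable XC DX (fun x => min_r (andP (XK x)).2) e0.
have [d2 d20 HY] := half_contraction_stable half_contraction_max0 DY (fun x => max_r (andP (YK x)).1) e0.
(* Where [v] and [f] differ by at least [q], the perturbation [z * |v - f|] reaches [K], which
   bounds both Y and c - X. The levels s1 + q and s1 + 3q of [f] lie at distance [q] from s1 and
   from s2. *)
pose z := K / q; have z0 : 0 < z by rewrite divr_gt0.
pose d3 := Num.min d1 d2 / z ^+ 2.
have d30 : 0 < d3 by rewrite divr_gt0 ?exprn_gt0// lt_min d10.
have [f [Df Cf vf]] := reg_form reg Dv d30.
have Dvf : D (fun x => v x - f x) by exact: (domB F).
have [Dn nE] := norm_dom dir Dvf.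
pose b x := z * `|v x - f x|.
have Db : D b by exact: (domZ F).
have bE : energy1 m A b b <= Num.min d1 d2.
  rewrite energy1_sqrZ// mulrC -ler_pdivlMr ?exprn_gt0//; apply: le_trans nE _.
  by move: vf; rewrite (form1E dir Dvf) => /ltW.
have [bE1 bE2] : energy1 m A b b <= d1 /\ energy1 m A b b <= d2.
  by move: bE; rewrite le_min => /andP.
have Xb : (fun x => X x + b x - X x) = b by apply/funext => x; rewrite addrC addKr.
have Yb : (fun x => Y x - b x - Y x) = (fun x => -1 * b x) by apply/funext => x; ring.
have [||DX' X'E] := HX (fun x => X x + b x); [exact: (domD F)|by rewrite Xb|].
have [||DY' Y'E] := HY (fun x => Y x - b x).
- exact: (domB F).
- by rewrite Yb energy1_sqrZ// sqrrN expr1n mul1r.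
set X' := Num.min c \o _ in DX' X'E; set Y' := Num.max 0 \o _ in DY' Y'E.
exists X', Y'; split => //.
rewrite (sf_form_sym Fc)//; apply: (bd_local bd) => //.
have of_ (y : R) : open [set x | f x < y].
  by apply: (@open_comp _ _ f [set x | x < y]); [move=> x _; exact: Cf.1|exact: open_lt].
exists [set x | s1 + q < f x], c; split.
- by apply: (@open_comp _ _ f [set x | s1 + q < x]); [move=> x _; exact: Cf.1|exact: open_gt].
- move=> x Sx; rewrite /= ltNge; apply/negP => fx; apply: Sx.
  exists [set x | f x < s1 + 3 * q]; last by rewrite /=; lra.
  split; first exact: of_.
  apply: aeW => y /= fy; rewrite /Y' /= max_l// subr_le0.
  have [Yy|Yy] := leP (Y y) 0; first by rewrite (le_trans Yy)// mulr_ge0// ltW.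
  have vy := Yv y Yy; apply: (@le_trans _ _ K); first by have /andP[] := YK y.
  have : q <= `|v y - f y| by apply: le_trans (ler_norm _); move: fy vy; rewrite sq; lra.
  by move=> qb; rewrite /b /z mulrAC ler_pdivlMr// ler_pM2l.
- apply: aeW => y /= fy; rewrite /X' /=.
  have [vy|vy] := leP s1 (v y).
    by rewrite Xv// min_l// lerDl mulr_ge0// ltW.
  rewrite min_l//; have /andP[XKy _] := XK y.
  have : q <= `|v y - f y|.
    by rewrite distrC; apply: le_trans (ler_norm _); move: fy vy; lra.
  have Kb : q <= `|v y - f y| -> K <= b y.
    by move=> qb; rewrite /b /z mulrAC ler_pdivlMr// ler_pM2l.
  by move=> /Kb; move: XKy; lra.
Qed.

End local_part.

(** * Contractions with vanishing energy *)

Section vanishing_contractions.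
Context d (R : realType) (E : borelMetricType d R) (m : {measure set E -> \bar R}).
Context (D : set (E -> R)) (A : (E -> R) -> (E -> R) -> R).
Hypothesis dir : dirichlet_form m D A.
Context (T : R -> R.-spker E ~> E).
Hypothesis T_sg : semigroup_of m D A T.
Implicit Types (u v f g X Y : E -> R) (r : nat -> R -> R).

Let F := df_form dir.
Let M := df_markov dir.

Lemma pairing_vanish (g : nat -> E -> R) u : u \in Lfun m 2%:E ->
  (forall n, g n \in Lfun m 2%:E) -> (forall n x, `|g n x| <= `|u x|) ->
  (forall x, g n x @[n --> \oo] --> 0) ->
  pairing m (g n) (g n) @[n --> \oo] --> 0.
Proof.
move=> u2 g2 gu g0.
have [|||||_ _] := @dominated_convergence _ _ _ m setT measurableT
  (fun n x => (g n x ^+ 2)%:E) (cst 0%E) (fun x => (u x ^+ 2)%:E).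
- by move=> n; exact: measurable_sqrE (Lfun_measurable (g2 n)).
- exact: measurable_cst.
- apply: aeW => x _; apply: cvg_EFin; first exact: nearW.
  rewrite [X in _ --> X](_ : _ = 0 * 0); last by rewrite mulr0.
  by apply: (@cvgM _ _ _ _ (g ^~ x) (g ^~ x)); exact: g0.
- exact: Lfun2_integrable_sqr.
- apply: aeW => x n _; rewrite gee0_abs ?lee_fin ?sqr_ge0//.
  rewrite -(real_normK (num_real (g n x))) -(real_normK (num_real (u x))).
  by rewrite lerXn2r ?nnegrE.
have pE n : pairing m (g n) (g n) = fine (\int[m]_x (g n x ^+ 2)%:E)%E.
  by rewrite -pairing_sqr.
rewrite integral0 => /fine_cvg; apply: cvg_trans; apply: near_eq_cvg.
by apply: nearW => n /=; rewrite pE.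
Qed.

(** The energy is at most [A (r n \o u) u] by [half_contraction_form]. This tends to 0, since the
    functions [r n \o u] have bounded energy and tend to 0 in L^2 by dominated convergence. *)
Lemma contraction_vanish r u (e : R) : (forall n, half_contraction (r n)) ->
  (forall x, r n x @[n --> \oo] --> 0) -> D u -> 0 < e ->
  exists N, forall n, (N <= n)%N -> A (r n \o u) (r n \o u) <= e.
Proof.
move=> rC r0 Du e0; have Auu := sf_form_ge0 F Du.
have [dl dl0 weak] := form_weak_null F T_sg Du Auu e0.
have rD n := half_contraction_dom M (rC n) Du.
have g2 n : r n \o u \in Lfun m 2%:E by exact: (sf_L2 F (rD n).1).
have gu n x : `|(r n \o u) x| <= `|u x|.
  by have := half_contraction_norm (u x) 0 (rC n); rewrite (rC n).1 !subr0.
have := pairing_vanish (sf_L2 F Du) g2 gu (fun x => r0 (u x)).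
move/cvgrPdist_lt => /(_ _ dl0)[N _ HN]; exists N => n Nn.
have := HN n Nn; rewrite sub0r normrN => /ltW small.
have [Drn Arn] := rD n.
apply: le_trans (half_contraction_form F M (rC n) Du) _.
apply: le_trans (ler_norm _) (weak _ Drn Arn _).
by apply: le_trans small; exact: ler_norm.
Qed.

Lemma clamp_vanish u (e : R) : D u -> 0 < e ->
  exists N, forall n, (N <= n)%N ->
    A (clamp (- n.+1%:R^-1) n.+1%:R^-1 \o u) (clamp (- n.+1%:R^-1) n.+1%:R^-1 \o u) <= e.
Proof.
apply: (@contraction_vanish (fun n => clamp (- n.+1%:R^-1) n.+1%:R^-1)).
  by move=> n; apply: half_contraction_clamp; rewrite invr_ge0.
move=> x; apply/cvgr0Pnorm_lt => z z0; near=> n.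
have n0 : (0 : R) <= n.+1%:R^-1 by rewrite invr_ge0.
have nn : - n.+1%:R^-1 <= n.+1%:R^-1 :> R by rewrite (le_trans _ n0)// oppr_le0.
apply: (@le_lt_trans _ _ n.+1%:R^-1); last first.
  by near: n; exact: (near_infty_natSinv_lt (PosNum z0)).
by rewrite ler_norml; case: (clampP x nn) => -[+ ->] => [_|//|_]; rewrite ?lexx ?nn.
Unshelve. all: by end_near. Qed.

Lemma far_vanish u (e : R) : D u -> 0 < e ->
  exists N, forall n, (N <= n)%N ->
    A (fun x => u x - clamp (- n%:R) n%:R (u x)) (fun x => u x - clamp (- n%:R) n%:R (u x)) <= e.
Proof.
apply: (@contraction_vanish (fun n y => y - clamp (- n%:R) n%:R y)).
  by move=> n; apply/half_contractionN/half_contraction_clamp.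
move=> x; apply: cvg_near_cst; near=> n.
rewrite (@clamp_id _ _ `|x|) ?subrr//.
- by rewrite lerNl ler_normr lexx orbT.
- exact: ler_norm.
- by near: n; exact: nbhs_infty_ger.
Unshelve. all: by end_near. Qed.

End vanishing_contractions.

(** * Additivity of the strongly local part over level intervals *)

Section chain_rule.
Context d (R : realType) (E : borelMetricType d R) (m : {measure set E -> \bar R}).
Context (D : set (E -> R)) (A : (E -> R) -> (E -> R) -> R).
Hypotheses (dir : dirichlet_form m D A) (reg : regular m D A).
Context (T : R -> R.-spker E ~> E).
Hypothesis T_sg : semigroup_of m D A T.
Context (Ac : (E -> R) -> (E -> R) -> R).
Context (J : {measure set (E * E)%type -> \bar R}) (kill : {measure set E -> \bar R}).
Hypothesis bd : beurling_deny m D A Ac J kill.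
Implicit Types (u v w X Y : E -> R) (f g : R -> R) (r s t a k : R).

Let F := df_form dir.
Let M := df_markov dir.
Let Fc := bd_local_form bd.
Let Mc := bd_local_markov bd.

(** The two level sets touch at [s]. Removing from [Y] its clamp at a small height z, of small
    energy, opens a gap: the rest lives where Y > z, hence where v >= s + z/L. *)
Lemma local_adjacent X Y v (c s K L : R) : D X -> D Y -> D v ->
  0 <= c -> 0 < K -> 0 < L ->
  (forall x, 0 <= Y x <= K) -> (forall x, c - K <= X x <= c) ->
  (forall x, Y x <= L * Num.max 0 (v x - s)) -> (forall x, s <= v x -> X x = c) ->
  Ac X Y = 0.
Proof.
move=> DX DY Dv c0 K0 L0 YK XK YL Xv.
apply: (local_strong_limit dir reg bd DX DY) => e e0.
have [n nE] := clamp_vanish dir T_sg DY e0.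
have {nE} := nE n (leqnn n).
set z : R := n.+1%:R^-1; have z0 : 0 < z by rewrite invr_gt0.
have zC := half_contraction_clamp (ltW z0).
have [Dcl _] := half_contraction_dom M zC DY.
have [DY' _] := half_contraction_dom M (half_contractionN zC) DY.
move=> clE; exists X, ((fun y => y - clamp (- z) z y) \o Y); split => //.
- have -> : (fun x => X x - X x) = cst 0 by apply/funext => x; rewrite subrr.
  by rewrite (form0l F (sf_zero F)) ltW.
- have -> : (fun x => ((fun y => y - clamp (- z) z y) \o Y) x - Y x) =
      fun x => - (clamp (- z) z \o Y) x by apply/funext => x /=; ring.
  rewrite (formNl F) ?(formNr F) ?opprK//; exact: (domN F).
apply: (local_separated dir reg T_sg bd (v := v) (c := c) (s1 := s) (s2 := s + z / L) (K := K)) => //.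
- by rewrite ltrDl divr_gt0.
- move=> x /=; have /andP[Y0 YK'] := YK x.
  have := (half_contractionN zC).2 _ _ Y0; rewrite (half_contractionN zC).1 !subr0.
  by move=> /andP[-> /le_trans]; apply.
- move=> x /=; have /andP[Y0 YK'] := YK x => Yz.
  have zY : z < Y x.
    rewrite ltNge; apply/negP => Yx; move: Yz; rewrite (@clamp_id _ _ (Y x)) ?subrr ?ltxx//.
    by rewrite (le_trans _ Y0)// oppr_le0.
  have := lt_le_trans zY (YL x); have [vs|vs] := leP 0 (v x - s).
    by rewrite -ltr_pdivrMl// mulrC; lra.
  by rewrite mulr0 ltNge (ltW z0).
Qed.

Definition lipschitz_on f r s (L : R) :=
  forall x y, r <= x <= s -> r <= y <= s -> `|f x - f y| <= L * `|x - y|.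

Lemma clamp_in r s x : r <= s -> r <= clamp r s x <= s.
Proof. by move=> rs; case: (clampP x rs) => -[+ ->]; lra. Qed.

Lemma clamp_contract r s x y : r <= s -> `|clamp r s x - clamp r s y| <= `|x - y|.
Proof.
move=> rs; wlog xy : x y / x <= y.
  move=> wlg; have [/wlg//|/ltW/wlg] := leP x y.
  by rewrite distrC (distrC x).
rewrite (distrC (clamp _ _ x)) (distrC x) !ger0_norm ?subr_ge0 ?clamp_homo//.
by case: (clampP x rs) => -[+ ->]; case: (clampP y rs) => -[+ ->]; lra.
Qed.

Lemma cut_lipschitz f r s L x y : r <= s -> 0 <= L -> lipschitz_on f r s L ->
  `|cut f r s x - cut f r s y| <= L * `|x - y|.
Proof.
move=> rs L0 fL; rewrite /cut opprB addrA subrK.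
by apply: le_trans (fL _ _ (clamp_in _ rs) (clamp_in _ rs)) _; rewrite ler_wpM2l// clamp_contract.
Qed.

Lemma cut_dom f r s L v : 0 <= r -> r <= s -> 0 <= L -> lipschitz_on f r s L ->
  D v -> D (cut f r s \o v).
Proof.
move=> r0 rs L0 fL Dv; have [//||//] := @lipschitz_dom _ _ _ _ _ _ F M L v (cut f r s \o v) Dv.
- move=> x /=; have := cut_lipschitz (v x) 0 rs L0 fL.
  by rewrite (cut_le0 _ rs r0) !subr0.
- by move=> x y; exact: cut_lipschitz.
Qed.

(** The first function is constant where v >= s, and the second vanishes where v <= s. *)
Lemma cut_orthogonal f g r s t L v : 0 <= r -> r <= s -> s <= t -> 0 < L ->
  {homo f : x y / x <= y} -> {homo g : x y / x <= y} ->
  lipschitz_on f r t L -> lipschitz_on g r t L -> D v ->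
  Ac (cut f r s \o v) (cut g s t \o v) = 0.
Proof.
move=> r0 rs st L0 fi gi fL gL Dv.
have sub (h : R -> R) : lipschitz_on h r t L -> lipschitz_on h r s L /\ lipschitz_on h s t L.
  move=> hL; split=> x y /andP[x1 x2] /andP[y1 y2]; apply: hL.
  - by rewrite x1 (le_trans x2).
  - by rewrite y1 (le_trans y2).
  - by rewrite x2 (le_trans _ x1).
  - by rewrite y2 (le_trans _ y1).
have [fL1 _] := sub _ fL; have [_ gL2] := sub _ gL.
have fc : 0 <= f s - f r by rewrite subr_ge0 fi.
have gc : 0 <= g t - g s by rewrite subr_ge0 gi.
apply: (@local_adjacent _ _ v (f s - f r) s (f s - f r + (g t - g s) + 1) L) => //.
- exact: cut_dom (ltW L0) fL1 Dv.
- exact: cut_dom (le_trans r0 rs) st (ltW L0) gL2 Dv.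
- by lra.
- move=> x /=; rewrite /cut; have /andP[c1 c2] := clamp_in (v x) st.
  by have := gi _ _ c1; have := gi _ _ c2; lra.
- move=> x /=; rewrite /cut; have /andP[c1 c2] := clamp_in (v x) rs.
  by have := fi _ _ c1; have := fi _ _ c2; lra.
- move=> x /=; have [vs|vs] := leP 0 (v x - s); last first.
    by rewrite mulr0 cut_le0//; lra.
  apply: le_trans (ler_norm _) _.
  have := cut_lipschitz (v x) s st (ltW L0) gL2.
  by rewrite (cut_le0 _ st (lexx s)) subr0 (ger0_norm vs).
- move=> x /= vs; rewrite /cut (_ : clamp r s (v x) = s)//.
  by case: (clampP (v x) rs) => -[+ ->]; lra.
Qed.

Let P f g v r s := Ac (cut f r s \o v) (cut g r s \o v).

Lemma cut_additive f g r s t L v : 0 <= r -> r <= s -> s <= t -> 0 < L ->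
  {homo f : x y / x <= y} -> {homo g : x y / x <= y} ->
  lipschitz_on f r t L -> lipschitz_on g r t L -> D v ->
  P f g v r t = P f g v r s + P f g v s t.
Proof.
move=> r0 rs st L0 fi gi fL gL Dv; have rt := le_trans rs st.
have s0 := le_trans r0 rs.
have sub (h : R -> R) : lipschitz_on h r t L -> lipschitz_on h r s L /\ lipschitz_on h s t L.
  move=> hL; split=> x y /andP[x1 x2] /andP[y1 y2]; apply: hL.
  - by rewrite x1 (le_trans x2).
  - by rewrite y1 (le_trans y2).
  - by rewrite x2 (le_trans _ x1).
  - by rewrite y2 (le_trans _ y1).
have [fL1 fL2] := sub _ fL; have [gL1 gL2] := sub _ gL.
have Df1 := cut_dom r0 rs (ltW L0) fL1 Dv; have Df2 := cut_dom s0 st (ltW L0) fL2 Dv.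
have Dg1 := cut_dom r0 rs (ltW L0) gL1 Dv; have Dg2 := cut_dom s0 st (ltW L0) gL2 Dv.
have E0 h : cut h r t \o v = fun x => (cut h r s \o v) x + (cut h s t \o v) x.
  by apply/funext => x /=; rewrite -cutD// rs.
rewrite /P !E0 (formDl Fc Df1 Df2) ?(formDr Fc Dg1 Dg2)//; last exact: (domD F).
have O1 := cut_orthogonal r0 rs st L0 fi gi fL gL Dv.
have O2 := cut_orthogonal r0 rs st L0 gi fi gL fL Dv.
by rewrite O1 (sf_form_sym Fc Df2 Dg1) O2; ring.
Qed.

(** Both sides are additive over adjacent intervals, so the estimate needs checking on intervals of
    length at most [h] only; induction on the number of such steps. *)
Lemma telescoping_estimate (p n : R -> R -> R) k t (c e h : R) : 0 < h ->
  (forall r s q, k <= r -> r <= s -> s <= q -> q <= t -> p r q = p r s + p s q) ->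
  (forall r s q, k <= r -> r <= s -> s <= q -> q <= t -> n r q = n r s + n s q) ->
  (forall r s, k <= r -> r <= s -> s <= t -> s <= r + h ->
     `|p r s - c * n r s| <= e * n r s) ->
  k <= t -> `|p k t - c * n k t| <= e * n k t.
Proof.
move=> h0 pD nD loc kt.
have H N r s : k <= r -> r <= s -> s <= t -> s <= r + N.+1%:R * h ->
    `|p r s - c * n r s| <= e * n r s.
  elim: N r s => [|N IH] r s kr rs st sN; first by apply: loc => //; rewrite mul1r in sN.
  have [sh|sh] := leP s (r + h); first exact: loc.
  have rh : r <= r + h by rewrite lerDl ltW.
  rewrite (pD r (r + h) s)// ?(nD r (r + h) s)// ?(ltW sh)//.
  have H1 := loc _ _ kr rh (le_trans (ltW sh) st) (lexx _).
  have H2 : `|p (r + h) s - c * n (r + h) s| <= e * n (r + h) s.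
    apply: IH => //; [exact: le_trans rh|exact: ltW|].
    by move: sN; rewrite -(natr1 N.+1) mulrDl mul1r; lra.
  rewrite !mulrDr; apply: le_trans (lerD H1 H2); apply: le_trans (ler_normD _ _).
  by rewrite le_eqVlt; apply/orP; left; apply/eqP; congr (`|_|); ring.
apply: (H (Num.truncn ((t - k) / h))) => //.
by rewrite addrC -lerBlDr -ler_pdivrMr// ltW// truncnS_gt.
Qed.

End chain_rule.

(** * The strongly local part of powers *)

Section power_chain_rule.
Context d (R : realType) (E : borelMetricType d R) (m : {measure set E -> \bar R}).
Context (D : set (E -> R)) (A : (E -> R) -> (E -> R) -> R).
Hypotheses (dir : dirichlet_form m D A) (reg : regular m D A).
Context (T : R -> R.-spker E ~> E).
Hypothesis T_sg : semigroup_of m D A T.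
Context (Ac : (E -> R) -> (E -> R) -> R).
Context (J : {measure set (E * E)%type -> \bar R}) (kill : {measure set E -> \bar R}).
Hypothesis bd : beurling_deny m D A Ac J kill.
Implicit Types (u v w X Y : E -> R) (f g : R -> R) (r s t a b k : R).

Let F := df_form dir.
Let M := df_markov dir.
Let Fc := bd_local_form bd.
Let Mc := bd_local_markov bd.

Lemma spow_taylor a k r h x y : 0 < a < 2 -> 0 < k <= r ->
  r <= x <= r + h -> r <= y <= r + h ->
  `|spow x a - spow y a - a * r `^ (a - 1) * (x - y)|
    <= a * `|a - 1| * k `^ (a - 2) * h * `|x - y|.
Proof.
move=> a02 kr xr yr; have /andP[k0 kr'] := kr; have r0 := lt_le_trans k0 kr'.
rewrite !spow_gt0E; first exact: powR_taylor.
  by move: yr => /andP[/(lt_le_trans r0)].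
by move: xr => /andP[/(lt_le_trans r0)].
Qed.

Lemma spow_lipschitz_on a r s : 0 < a < 2 -> 0 < r -> r <= s ->
  exists2 L, 0 < L & lipschitz_on (fun x => spow x a) r s L.
Proof.
move=> a02 r0 rs; have /andP[a0 a2] := a02.
pose C := a * `|a - 1| * r `^ (a - 2) * (s - r).
have C0 : 0 <= C by rewrite !mulr_ge0 ?powR_ge0 ?subr_ge0 ?(ltW a0).
pose B := a * r `^ (a - 1); have B0 : 0 <= B by rewrite mulr_ge0 ?powR_ge0 ?(ltW a0).
exists (B + C + 1); first by lra.
move=> x y xr yr.
have rr : 0 < r <= r by rewrite r0 lexx.
have := @spow_taylor a r r (s - r) x y a02 rr; rewrite addrC subrK => /(_ xr yr).
rewrite -/C -/B => H.
have := ler_normD (spow x a - spow y a - B * (x - y)) (B * (x - y)).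
rewrite subrK normrM (ger0_norm B0) => H2.
by have := normr_ge0 (x - y); move: H H2; set z := `|x - y|; set q := `|_|; set q' := `|_|; nra.
Qed.

(** The exponent may have either sign, so the power may be largest at either end. *)
Lemma powR_between b k r t : 0 < k -> k <= r -> r <= t -> r `^ b <= k `^ b + t `^ b.
Proof.
move=> k0 kr rt; have r0 := lt_le_trans k0 kr; have t0 := lt_le_trans r0 rt.
have [b0|b0] := leP 0 b.
  by rewrite ler_wpDl ?powR_ge0// ge0_ler_powR// nnegrE ltW.
rewrite ler_wpDr ?powR_ge0// -(opprK b) !(powRN _ (- b)) lef_pV2 ?posrE ?powR_gt0//.
by apply: ge0_ler_powR; rewrite ?nnegrE ?oppr_ge0 ?(ltW b0) ?(ltW k0) ?(ltW r0).
Qed.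

Let P f g v r s := Ac (cut f r s \o v) (cut g r s \o v).

Lemma cut_id_dom r s v : 0 <= r -> r <= s -> D v -> D (cut id r s \o v).
Proof.
move=> r0 rs Dv; apply: (cut_dom dir r0 rs (ltW ltr01) _ Dv).
by move=> x y _ _; rewrite mul1r.
Qed.

(** Removing the linear part from [f] leaves a remainder with Lipschitz constant [dl], whose energy
    is at most dl^2 times that of [cut id r s \o v]; likewise for [g]. The three remaining terms of
    the expanded product are bounded with factors al dl, be dl and dl^2. *)
Lemma cut_chain_local f g r s v (al be dl : R) : 0 <= r -> r <= s -> 0 <= al -> 0 <= be ->
  0 < dl -> D v ->
  (forall x y, r <= x <= s -> r <= y <= s ->
     `|f x - f y - al * (x - y)| <= dl * `|x - y|) ->
  (forall x y, r <= x <= s -> r <= y <= s ->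
     `|g x - g y - be * (x - y)| <= dl * `|x - y|) ->
  `|P f g v r s - al * be * P id id v r s| <= (al + be + dl) * dl * P id id v r s.
Proof.
move=> r0 rs al0 be0 dl0 Dv fT gT; rewrite /P.
set G := cut id r s \o v; have DG : D G by exact: cut_id_dom.
have rem (h : R -> R) c : (forall x y, r <= x <= s -> r <= y <= s ->
     `|h x - h y - c * (x - y)| <= dl * `|x - y|) ->
    exists t : E -> R, [/\ D t, cut h r s \o v = (fun x => c * G x + t x) & Ac t t <= dl ^+ 2 * Ac G G].
  move=> hT; exists (fun x => (cut h r s \o v) x - c * G x).
  have bnd x y : `|(cut h r s (v x) - c * G x) - (cut h r s (v y) - c * G y)| <= dl * `|G x - G y|.
    have := hT _ _ (clamp_in (v x) rs) (clamp_in (v y) rs).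
    rewrite /G /= /cut; set p := clamp r s (v x); set q := clamp r s (v y) => H.
    rewrite [X in `|X| <= _](_ : _ = h p - h q - c * (p - q)); last by ring.
    by rewrite (_ : p - r - (q - r) = p - q)//; ring.
  have bnd0 x : `|cut h r s (v x) - c * G x| <= dl * `|G x|.
    have rr : r <= r <= s by rewrite lexx.
    have := hT _ _ (clamp_in (v x) rs) rr.
    by rewrite /G /= /cut; congr (`|_| <= _); ring.
  have [Dt _] := lipschitz_dom F M DG bnd0 bnd.
  have [_ tE] := lipschitz_dom Fc Mc DG bnd0 bnd.
  split => //; apply/funext => x /=; ring.
have [t [Dt -> tE]] := rem f al fT; have [t' [Dt' -> t'E]] := rem g be gT.
have DaG := domZ F al DG; have DbG := domZ F be DG.
rewrite (formDl Fc DaG Dt) ?(formDr Fc DbG Dt')//; last exact: (domD F).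
rewrite !(formZl Fc)// !(formZr Fc)//.
have Y1 := form_young Fc dl0 DG Dt'; have Y2 := form_young Fc dl0 DG Dt.
have Y3 := form_young Fc ltr01 Dt Dt'.
have N0 := sf_form_ge0 Fc DG.
have I1 : dl^-1 * Ac t' t' <= dl * Ac G G by rewrite ler_pdivrMl// mulrA -expr2.
have I2 : dl^-1 * Ac t t <= dl * Ac G G by rewrite ler_pdivrMl// mulrA -expr2.
rewrite (sf_form_sym Fc Dt DG); rewrite invr1 !mul1r in Y3.
have A1 : `|Ac G t'| <= dl * Ac G G by move: Y1 I1; lra.
have A2 : `|Ac G t| <= dl * Ac G G by move: Y2 I2; lra.
have A3 : `|Ac t t'| <= dl ^+ 2 * Ac G G by move: Y3 tE t'E; lra.
rewrite [X in `|X| <= _](_ : _ = al * Ac G t' + (be * Ac G t + Ac t t')); last by ring.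
apply: le_trans (ler_normD _ _) _; rewrite normrM (ger0_norm al0).
have := ler_normD (be * Ac G t) (Ac t t'); rewrite normrM (ger0_norm be0).
have B1 := ler_wpM2l al0 A1; have B2 := ler_wpM2l be0 A2.
rewrite expr2 in A3.
by move: B1 B2 A3; set q := `|_ + _|; lra.
Qed.

(** The slopes at r are a r^(a-1) and (2 - a) r^(1-a). The powers of r cancel in their product, so
    every piece of the subdivision has the same constant. *)
Lemma cut_chain a k t v : 0 < a < 2 -> 0 < k -> k <= t -> D v ->
  P (fun x => spow x a) (fun x => spow x (2 - a)) v k t = a * (2 - a) * P id id v k t.
Proof.
move=> a02 k0 kt Dv; have /andP[a0 a2] := a02.
have a02' : 0 < 2 - a < 2 by lra.
have [L1 L10 lip1] := spow_lipschitz_on a02 k0 kt.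
have [L2 L20 lip2] := spow_lipschitz_on a02' k0 kt.
pose L := L1 + L2 + 1; have L0 : 0 < L by rewrite /L; lra.
have lipW (f : R -> R) L' r s : L' <= L -> lipschitz_on f k t L' -> k <= r -> s <= t -> lipschitz_on f r s L.
  move=> LL fL kr st x y /andP[x1 x2] /andP[y1 y2].
  apply: le_trans (fL x y _ _) _.
  - by rewrite (le_trans kr x1) (le_trans x2 st).
  - by rewrite (le_trans kr y1) (le_trans y2 st).
  - by rewrite ler_wpM2r.
have lip_id : lipschitz_on id k t 1 by move=> x y _ _; rewrite mul1r.
have [L1L L2L L3L] : [/\ L1 <= L, L2 <= L & 1 <= L] by rewrite /L; split; lra.
have add f g L' L'' r s q : {homo f : x y / x <= y} -> {homo g : x y / x <= y} ->
    L' <= L -> L'' <= L -> lipschitz_on f k t L' -> lipschitz_on g k t L'' ->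
    k <= r -> r <= s -> s <= q -> q <= t -> P f g v r q = P f g v r s + P f g v s q.
  move=> fi gi L'L L''L fL gL kr rs sq qt.
  apply: (cut_additive dir reg T_sg bd (L := L)) => //; first by rewrite (le_trans (ltW k0)).
    exact: (lipW _ L').
  exact: (lipW _ L'').
(* [B] bounds the sum of the slopes, and [C] both Taylor constants, on all of [k, t], so that a
   single step length serves for every piece. *)
pose B := a * (k `^ (a - 1) + t `^ (a - 1)) + (2 - a) * (k `^ (2 - a - 1) + t `^ (2 - a - 1)).
have [la0 la2] : 0 <= a /\ 0 <= 2 - a by split; lra.
have B0 : 0 <= B by apply: addr_ge0; apply: mulr_ge0 => //; rewrite addr_ge0 ?powR_ge0.
pose C := a * `|a - 1| * k `^ (a - 2) + (2 - a) * `|2 - a - 1| * k `^ (2 - a - 2) + 1.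
have C1 : 0 <= a * `|a - 1| * k `^ (a - 2) by rewrite !mulr_ge0 ?powR_ge0.
have C2 : 0 <= (2 - a) * `|2 - a - 1| * k `^ (2 - a - 2).
  by rewrite !mulr_ge0 ?powR_ge0.
have C0 : 0 < C by rewrite /C; lra.
have N0 : 0 <= P id id v k t by apply: (sf_form_ge0 Fc); exact: cut_id_dom (ltW k0) kt Dv.
have key e : 0 < e -> `|P (fun x => spow x a) (fun x => spow x (2 - a)) v k t
    - a * (2 - a) * P id id v k t| <= e * P id id v k t.
  (* As [dl <= 1], the local error factor (al + be + dl) dl is at most (B + 1) dl <= e. *)
  move=> e0; pose dl := Num.min 1 (e / (B + 1)).
  have dl0 : 0 < dl by rewrite lt_min ltr01 divr_gt0//; lra.
  have [dl1 dle] : dl <= 1 /\ dl <= e / (B + 1) by rewrite /dl !ge_min !lexx orbT.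
  have h0 : 0 < dl / C by rewrite divr_gt0.
  apply: (telescoping_estimate h0) => //.
  - move=> r s q kr rs sq qt; apply: (add _ _ L1 L2) => //.
    + by apply: spow_homo; exact: ltW.
    + by apply: spow_homo; lra.
  - move=> r s q kr rs sq qt; exact: (add id id 1 1).
  move=> r s kr rs st sh; have r0 := lt_le_trans k0 kr.
  have rt := le_trans rs st.
  have T1 b x y : 0 < b < 2 -> b * `|b - 1| * k `^ (b - 2) <= C -> r <= x <= s -> r <= y <= s ->
      `|spow x b - spow y b - b * r `^ (b - 1) * (x - y)| <= dl * `|x - y|.
    move=> b02 bC /andP[x1 x2] /andP[y1 y2].
    have kr' : 0 < k <= r by rewrite k0.
    apply: le_trans (@spow_taylor b k r (dl / C) x y b02 kr' _ _) _.
    - by rewrite x1 (le_trans x2).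
    - by rewrite y1 (le_trans y2).
    - by rewrite ler_wpM2r// mulrA ler_pdivrMr// mulrC ler_wpM2l// ltW.
  have al0 : 0 <= a * r `^ (a - 1) by rewrite mulr_ge0 ?powR_ge0 ?ltW.
  have be0 : 0 <= (2 - a) * r `^ (2 - a - 1) by rewrite mulr_ge0 ?powR_ge0.
  have := @cut_chain_local (fun x => spow x a) (fun x => spow x (2 - a)) r s v _ _ dl
    (ltW r0) rs al0 be0 dl0 Dv.
  have -> : a * r `^ (a - 1) * ((2 - a) * r `^ (2 - a - 1)) = a * (2 - a).
    rewrite mulrACA -powRD; last by rewrite (gt_eqF r0) implybT.
    by rewrite (_ : a - 1 + (2 - a - 1) = 0) ?powRr0 ?mulr1//; ring.
  move=> H; apply: (le_trans (H _ _)).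
  - by move=> x y; apply: T1 => //; rewrite /C; lra.
  - by move=> x y; apply: T1 => //; rewrite /C; lra.
  have Nrs : 0 <= P id id v r s by apply: (sf_form_ge0 Fc); exact: cut_id_dom (ltW r0) rs Dv.
  rewrite ler_wpM2r//.
  have Bb : a * r `^ (a - 1) + (2 - a) * r `^ (2 - a - 1) <= B.
    by rewrite lerD// ler_wpM2l ?powR_between.
  have : (B + 1) * dl <= e by rewrite mulrC -ler_pdivlMr//; lra.
  apply: le_trans; rewrite ler_wpM2r ?(ltW dl0)//; lra.
apply/eqP; rewrite -subr_eq0 -normr_eq0 eq_le normr_ge0 andbT.
apply/ler_addgt0Pr => e e0; rewrite add0r.
have N1 : 0 < P id id v k t + 1 by lra.
apply: le_trans (key (e / (P id id v k t + 1)) _) _; first by rewrite divr_gt0.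
by rewrite mulrAC ler_pdivrMr// ler_pM2l//; lra.
Qed.

(** The two halves of a truncation live on {v > k} and {v < -k}. Because k > 0 there is a gap
    between these sets, so [local_separated] makes the halves orthogonal, and [cut_chain] applies to
    v and to -v. *)
Lemma trunc_chain a k t v : 0 < a < 2 -> 0 < k -> k <= t -> D v ->
  Ac (trunc (fun x => spow x a) k t \o v) (trunc (fun x => spow x (2 - a)) k t \o v) =
  a * (2 - a) * Ac (trunc id k t \o v) (trunc id k t \o v).
Proof.
move=> a02 k0 kt Dv; have /andP[a0 a2] := a02.
have a02' : 0 < 2 - a < 2 by lra.
pose vN x := - v x; have DvN : D vN by exact: (domN F).
have lip b : 0 < b < 2 -> exists2 L, 0 < L & lipschitz_on (fun x => spow x b) k t L.
  by move=> b02; exact: spow_lipschitz_on.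
have Dcut b w : 0 < b < 2 -> D w -> D (cut (fun x => spow x b) k t \o w).
  move=> b02 Dw; have [L L0 fL] := lip b b02; exact: (cut_dom dir (ltW k0) kt (ltW L0) fL Dw).
have Did w : D w -> D (cut id k t \o w) by exact: cut_id_dom (ltW k0) kt.
have orth f g : {homo f : x y / x <= y} -> {homo g : x y / x <= y} ->
    D (cut f k t \o v) -> D (cut g k t \o vN) ->
    Ac (cut f k t \o v) (cut g k t \o vN) = 0.
  move=> fi gi Df Dg.
  have DgN := domN F Dg.
  have : Ac (fun x => - (cut g k t \o vN) x) (cut f k t \o v) = 0.
    pose K := (f t - f k) + (g t - g k) + 1.
    have ftk : 0 <= f t - f k by rewrite subr_ge0 fi.
    have gtk : 0 <= g t - g k by rewrite subr_ge0 gi.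
    apply: (local_separated dir reg T_sg bd (v := v) (c := 0) (s1 := 0) (s2 := k) (K := K)) => //.
    - by rewrite /K; lra.
    - move=> x /=; rewrite /cut; have /andP[c1 c2] := clamp_in (v x) kt.
      by have := fi _ _ c1; have := fi _ _ c2; rewrite /K; lra.
    - move=> x /=; rewrite /cut; have /andP[c1 c2] := clamp_in (vN x) kt.
      by have := gi _ _ c1; have := gi _ _ c2; rewrite /K; lra.
    - move=> x /=; have [//|vk] := leP k (v x); rewrite cut_le0 ?ltxx//; exact: ltW.
    - by move=> x /= vx; rewrite cut_le0 ?oppr0// /vN; lra.
  by rewrite (formNl Fc)// (sf_form_sym Fc Dg Df); lra.
have E0 f : trunc f k t \o v = fun x => (cut f k t \o v) x - (cut f k t \o vN) x by [].
have split_sq f g : {homo f : x y / x <= y} -> {homo g : x y / x <= y} ->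
    D (cut f k t \o v) -> D (cut f k t \o vN) -> D (cut g k t \o v) -> D (cut g k t \o vN) ->
    Ac (trunc f k t \o v) (trunc g k t \o v) = P f g v k t + P f g vN k t.
  move=> fi gi Df Df' Dg Dg'; rewrite !E0 (formBl Fc Df Df' (domB F Dg Dg')).
  rewrite (formBr Fc Dg Dg' Df) (formBr Fc Dg Dg' Df') (orth f g fi gi Df Dg') (sf_form_sym Fc Df' Dg) (orth g f gi fi Dg Df').
  by rewrite /P; ring.
have si b : 0 < b < 2 -> {homo (fun x : R => spow x b) : x y / x <= y}.
  by move=> /andP[b0 _]; apply: spow_homo; exact: ltW.
rewrite !split_sq//; try (by exact: si); try (by exact: Dcut); try (by exact: Did).
by rewrite (cut_chain a02 k0 kt Dv) (cut_chain a02 k0 kt DvN) -mulrDr.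
Qed.

End power_chain_rule.

(** * Comparison of energies *)

Section increments.
Context (R : realType).
Implicit Types (f g : R -> R) (r s k e a b x y : R) (W : R * R -> R).

Definition increments f g (z : R * R) := (f z.2 - f z.1) * (g z.2 - g z.1).

Lemma continuous_clamp r s : continuous (clamp r s).
Proof.
move=> x; apply: (@continuous_min _ _ (id \max cst r) (cst s)); last exact: cvg_cst.
by apply: (@continuous_max _ _ id (cst r)); [exact: cvg_id|exact: cvg_cst].
Qed.

Lemma continuous_trunc f r s : continuous f -> continuous (trunc f r s).
Proof.
move=> cf; have ccut : continuous (cut f r s).
  move=> x; apply: cvgB; last exact: cvg_cst.
  by apply: continuous_comp; [exact: continuous_clamp|exact: cf].
move=> x; apply: cvgB; first exact: ccut.
by apply: (@continuous_comp _ _ _ -%R); [exact: opp_continuous|exact: ccut].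
Qed.

Lemma measurable_increments f g : continuous f -> continuous g ->
  measurable_fun setT (increments f g).
Proof.
move=> /continuous_measurable_fun mf /continuous_measurable_fun mg.
apply: measurable_funM; apply: measurable_funB.
- exact: measurableT_comp mf measurable_snd.
- exact: measurableT_comp mf measurable_fst.
- exact: measurableT_comp mg measurable_snd.
- exact: measurableT_comp mg measurable_fst.
Qed.

Lemma increments_ge0 f g z : {homo f : x y / x <= y} -> {homo g : x y / x <= y} ->
  0 <= increments f g z.
Proof.
move=> fi gi; rewrite /increments; have [xy|/ltW xy] := leP z.1 z.2.
  by rewrite mulr_ge0// subr_ge0; [exact: fi|exact: gi].
by rewrite mulr_le0// subr_le0; [exact: fi|exact: gi].
Qed.

Lemma half_contraction_homo f : half_contraction f -> {homo f : x y / x <= y}.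
Proof. by move=> [_ fD] x y /fD /andP[]; rewrite subr_ge0. Qed.

(** By homogeneity, (rho k)^a b^(2-a) <= rho^a b^2 for b >= k, so the fraction rho does not depend
    on [k], which is dictated by the energy near 0. Each of the two terms gets e/32, and 16 * 2 *
    e/32 = e; [rho <= 2^-1] gives 2r <= k for r = rho k. *)
Lemma powR_scale_small a e : 0 < a < 2 -> 0 < e -> exists rho, [/\ 0 < rho, rho <= 2^-1 &
  forall k b, 0 < k -> k <= b -> 16 * ((rho * k) `^ a * b `^ (2 - a) +
                       (rho * k) `^ (2 - a) * b `^ a) <= e * b ^+ 2].
Proof.
move=> /andP[a0 a2] e0; have a2' : 0 < 2 - a by lra.
pose q := e / 32; have q0 : 0 < q by rewrite divr_gt0.
pose rho := Num.min 2^-1 (Num.min (q `^ a^-1) (q `^ (2 - a)^-1)).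
have rho0 : 0 < rho by rewrite !lt_min !powR_gt0// invr_gt0 ltr0n.
have small c : 0 < c -> rho <= q `^ c^-1 -> rho `^ c <= q.
  move=> c0 rq; have : rho `^ c <= (q `^ c^-1) `^ c.
    by apply: ge0_ler_powR; rewrite ?nnegrE ?powR_ge0 ?(ltW c0) ?(ltW rho0).
  by rewrite -powRrM (mulVf (lt0r_neq0 c0)) powRr1 ?(ltW q0).
have sa : rho `^ a <= q by apply: small => //; rewrite !ge_min lexx !orbT.
have sb : rho `^ (2 - a) <= q by apply: small => //; rewrite !ge_min lexx !orbT.
exists rho; split => //; first by rewrite ge_min lexx.
move=> k b k0 kb; have b0 := lt_le_trans k0 kb.
have bound c c' : 0 < c -> c + c' = 2 -> rho `^ c <= q -> (rho * k) `^ c * b `^ c' <= q * b ^+ 2.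
  move=> c0 cc rq; have -> : b ^+ 2 = b `^ c * b `^ c'.
    by rewrite -powRD ?cc ?powR_mulrn ?ltW// (gt_eqF b0) implybT.
  rewrite mulrA ler_wpM2r ?powR_ge0// powRM ?(ltW rho0) ?(ltW k0)//.
  rewrite ler_pM ?powR_ge0//.
  by apply: ge0_ler_powR; rewrite ?nnegrE ?(ltW c0) ?(ltW k0) ?(ltW b0).
have Ba := bound a (2 - a) a0 (subrKC _ _) sa.
have Bb := bound (2 - a) a a2' (subrK _ _) sb.
have -> : e = 32 * q by rewrite /q mulrC divfK.
by lra.
Qed.

(* The energies of functions of a fixed [v], for the kernels [T t] as for the
   jumping and killing measures, are positive functionals of the weight. *)
Definition positive_functional (L : (R * R -> R) -> \bar R) :=
  [/\ (forall c W W', 0 <= c -> measurable_fun setT W -> measurable_fun setT W' ->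
    (forall z, 0 <= W z) -> (forall z, 0 <= W' z) ->
    L (fun z => W z + c * W' z) = (L W + c%:E * L W')%E),
  (forall W W', measurable_fun setT W -> measurable_fun setT W' ->
    (forall z, 0 <= W z) -> (forall z, W z <= W' z) -> (L W <= L W')%E) &
  (0 <= L (cst 0%R))%E].

Lemma trunc_squeeze (L : (R * R -> R) -> \bar R) f g r k s e :
  positive_functional L -> 0 < r -> 2 * r <= k -> k <= s -> 0 <= e ->
  continuous f -> continuous g ->
  {homo f : x y / x <= y} -> (forall x, f (- x) = - f x) ->
  {homo g : x y / x <= y} -> (forall x, g (- x) = - g x) ->
  (forall x y, (f y - f x) * (g y - g x) <= 2 * (y - x) ^+ 2) ->
  (forall b, k <= b -> 16 * (f r * g b + g r * f b) <= e * b ^+ 2) ->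
  let tr := increments (trunc f r s) (trunc g r s) in
  let cl := clamp (- k) k in
  let far x := x - clamp (- (s / 2)) (s / 2) x in
  (L tr <= L (increments f g) /\
   L (increments f g) <= L tr + e%:E * L (increments id id) + 2%:E * L (increments cl cl)
     + 32%:E * L (increments far far))%E.
Proof.
move=> [Llin Lle _] r0 rk ks e0 cf cg fi fN gi gN fg small tr cl far.
have E := trunc_product_error r0 rk ks fi fN gi gN fg small.
have s0 : 0 <= s / 2 by lra. have k0 : 0 <= k by lra.
have ccl : continuous cl by exact: continuous_clamp.
have cfar : continuous far.
  by move=> x; apply: cvgB; [exact: cvg_id|exact: continuous_clamp].
have cid : continuous (id : R -> R) by move=> x; exact: cvg_id.
have mtr : measurable_fun setT tr by apply: measurable_increments; exact: continuous_trunc.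
have mfg := measurable_increments cf cg.
have mcl := measurable_increments ccl ccl.
have mfar := measurable_increments cfar cfar.
have mid := measurable_increments cid cid.
have clC : half_contraction cl by exact: half_contraction_clamp.
have farC : half_contraction far by apply/half_contractionN/half_contraction_clamp.
have cli := half_contraction_homo clC. have fari := half_contraction_homo farC.
have tr0 z : 0 <= tr z by have [/andP[]] := E z.1 z.2.
have id0 z : 0 <= increments id id z by apply: increments_ge0.
have cl0 z : 0 <= increments cl cl z by apply: increments_ge0.
have far0 z : 0 <= increments far far z by apply: increments_ge0.
have mlin c W W' : measurable_fun setT W -> measurable_fun setT W' ->
    measurable_fun setT (fun z => W z + c * W' z).
  move=> mW mW'; apply: measurable_funD => //; exact: measurable_funM.
have plin c W W' : 0 <= c -> (forall z, 0 <= W z) -> (forall z, 0 <= W' z) ->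
    forall z, 0 <= W z + c * W' z.
  by move=> c0 W0 W'0 z; rewrite addr_ge0// mulr_ge0.
split; first by apply: Lle => // z; have [/andP[]] := E z.1 z.2.
pose W1 z := tr z + e * increments id id z.
pose W2 z := W1 z + 2 * increments cl cl z.
have mW1 : measurable_fun setT W1 by exact: mlin. have W10 : forall z, 0 <= W1 z by exact: plin.
have mW2 : measurable_fun setT W2 by exact: mlin. have W20 : forall z, 0 <= W2 z by exact: plin.
rewrite -Llin// -/W1 -Llin// -/W2 -Llin//; apply: Lle => //.
- exact: mlin.
- by move=> z; exact: increments_ge0.
- by move=> z; have [_] := E z.1 z.2; rewrite /W2 /W1 /increments -!expr2.
Qed.

End increments.

Section offdiagonal.
Context d (R : realType) (E : borelMetricType d R).

Lemma open_mball (s : E) (r : R) : open (ball s r).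
Proof.
rewrite ballEmdist openE => y /= sy; apply/nbhs_ballP.
exists (r - mdist s y) => /=; first by rewrite subr_gt0.
move=> z; rewrite ballEmdist/= => yz.
by have := metric_triangle s y z; move: sy yz; lra.
Qed.

(** Distinct points x and y are separated by a ball of radius 1/(k+1), centred in the dense set,
    that contains x and not y. Countability is an injection [f] into the naturals, so [G n k] is the
    ball about the point numbered [n], or empty. *)
Lemma measurable_offdiag : @separable_space E -> measurable (@offdiag E).
Proof.
move=> [S /countable_injP[f f_inj] S_dense].
pose G n k : set E := \bigcup_(s in [set s | S s /\ f s = n]) ball s k.+1%:R^-1.
have mG n k : measurable (G n k).
  by apply: open_measurable; apply: bigcup_open => s _; exact: open_mball.
rewrite (_ : offdiag = \bigcup_n \bigcup_k (G n k `*` ~` G n k)).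
  do 2 apply: bigcupT_measurable => ?; apply: measurableX => //; exact: measurableC.
apply/seteqP; split => [[x y] /= /eqP xy|[x y] [n _ [k _ [Gx Gy]]] xy]; last first.
  by apply: Gy; rewrite [y](esym xy).
rewrite -(@mdist_gt0 R) in xy; pose e := mdist x y / 2.
have e0 : 0 < e by rewrite divr_gt0.
have [k ke] : exists k : nat, k.+1%:R^-1 < e.
  by have [N _ /(_ N (leqnn N)) /= H] := near_infty_natSinv_lt (PosNum e0); exists N.
have [s [sx Ss]] : ball x (k.+1%:R^-1 : R) `&` S !=set0.
  apply: S_dense; last exact: open_mball.
  by exists x; rewrite ballEmdist/= mdistxx.
rewrite ballEmdist /= in sx.
exists (f s) => //; exists k => //; split => /=.
  by exists s => //; rewrite ballEmdist/= metric_sym.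
move=> [s' [Ss' fs]]; rewrite (f_inj s' s) ?inE// ballEmdist /= => sy.
have := le_lt_trans (metric_triangle x s y) (ltrD sx sy).
move: ke; rewrite /e; set q := _^-1; set D := mdist x y.
by rewrite ltr_pdivlMr// mulr_natr mulr2n => /lt_trans h /h; rewrite ltxx.
Qed.

End offdiagonal.

(** * Energies as functionals of a weight on pairs of values *)

Section energies.
Context d (R : realType) (E : borelMetricType d R) (m : {measure set E -> \bar R}).
Implicit Types (v : E -> R) (f g : R -> R) (c a : R) (W : R * R -> R).

Let ereal_combine (h c : R) (x y z w : \bar R) : 0 <= c -> 0 <= h ->
  (0 <= x)%E -> (0 <= y)%E -> (0 <= z)%E -> (0 <= w)%E ->
  (h%:E * (x + c%:E * y) + (z + c%:E * w) = (h%:E * x + z) + c%:E * (h%:E * y + w))%E.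
Proof.
move=> c0 h0 x0 y0 z0 w0.
rewrite !ge0_muleDr ?mule_ge0 ?lee_fin// !muleA -!EFinM (mulrC h).
by rewrite addeACA.
Qed.

Section kernel.
Context (K : R.-spker E ~> E) (v : E -> R).
Hypothesis v2 : v \in Lfun m 2%:E.

(** Killing counts as a jump between the values 0 and v(x), so that one weight determines both
    terms. *)
Definition kernel_energy W := ((2^-1)%:E * jump_part m K v (fun z => W (v z.1, v z.2))
  + kill_part m K v (fun x => W (0%R, v x)))%E.

Let mv : measurable_fun setT v. Proof. exact: Lfun_measurable v2. Qed.

Let mpair W : measurable_fun setT W ->
  measurable_fun setT (fun z : E * E => W (v z.1, v z.2)).
Proof.
move=> mW; apply: (measurableT_comp mW); apply/measurable_fun_pairP; split => /=.
  exact: measurableT_comp mv measurable_fst.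
exact: measurableT_comp mv measurable_snd.
Qed.

Let mkill W : measurable_fun setT W -> measurable_fun setT (fun x => W (0, v x)).
Proof.
move=> mW; apply: (measurableT_comp mW); apply/measurable_fun_pairP; split => //=.
exact: measurable_cst.
Qed.

Lemma kernel_energy_positive : positive_functional kernel_energy.
Proof.
split => [c W W' c0 mW mW' W0 W'0|W W' mW mW' W0 WW'|]; last first.
- apply: adde_ge0; last by apply: integral_ge0 => x _; rewrite mul0e.
  rewrite mule_ge0 ?lee_fin ?invr_ge0//.
  by apply: integral_ge0 => x _; apply: integral_ge0 => y _; rewrite mulr0.
- apply: leeD; last by apply: kill_part_le => //; exact: mkill.
  by rewrite lee_wpmul2l ?lee_fin ?invr_ge0//; apply: jump_part_le => //; exact: mpair.
- rewrite /kernel_energy jump_part_lin//; [|exact: mpair..].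
  rewrite kill_part_lin//; [|exact: mkill..].
  apply: ereal_combine => //.
  - apply: integral_ge0 => x _; apply: integral_ge0 => y _.
    by rewrite lee_fin /nonzero !mulr_ge0.
  - apply: integral_ge0 => x _; apply: integral_ge0 => y _.
    by rewrite lee_fin /nonzero !mulr_ge0.
  - by apply: integral_ge0 => x _; apply: mule_ge0; rewrite ?lee_fin//; exact: kill_ge0 v2 x.
  - by apply: integral_ge0 => x _; apply: mule_ge0; rewrite ?lee_fin//; exact: kill_ge0 v2 x.
Qed.

Hypothesis K_L2 : forall f : E -> R, f \in Lfun m 2%:E -> kernel_op K f \in Lfun m 2%:E.
Hypothesis K_sym : forall f g : E -> R, f \in Lfun m 2%:E -> g \in Lfun m 2%:E ->
  pairing m (kernel_op K f) g = pairing m f (kernel_op K g).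

(** The growth exponents add up to 2: with M = max(|v(x)|, |v(y)|), the product f(v(x)) g(v(y)) is
    at most M^2 <= v(x)^2 + v(y)^2, as [kernel_representation] requires. The bounds cover the
    powers, their truncations and, for a = 1, all half contractions. *)
Lemma kernel_energyE a f g : 0 < a < 2 -> continuous f -> continuous g ->
  {homo f : x y / x <= y} -> {homo g : x y / x <= y} ->
  (forall x, `|f x| <= `|x| `^ a) -> (forall x, `|g x| <= `|x| `^ (2 - a)) ->
  kernel_energy (increments f g) =
    (\int[m]_x ((f (v x) - kernel_op K (f \o v) x) * g (v x)))%:E.
Proof.
move=> a02 cf cg fi gi fa ga; have /andP[a0 a2] := a02; have a2' : 0 < 2 - a by lra.
have van h b : 0 < b -> (forall x : R, `|h x| <= `|x| `^ b) -> h 0 = 0 :> R.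
  move=> b0 /(_ 0); rewrite normr0 powR0 ?gt_eqF// => h0.
  by apply/eqP; rewrite -normr_eq0 eq_le h0 normr_ge0.
have f0 := van _ _ a0 fa; have g0 := van _ _ a2' ga.
have mf := continuous_measurable_fun cf. have mg := continuous_measurable_fun cg.
rewrite -(kernel_representation K_L2 K_sym v2 (f := f \o v) (g := g \o v) (c := 1))//.
- rewrite /kernel_energy; congr (_ + kill_part _ _ _ _)%E.
  by apply/funext => x; rewrite /increments /= f0 g0 !subr0.
- exact: measurableT_comp mf mv.
- exact: measurableT_comp mg mv.
- by move=> x /= ->.
- by move=> x /= ->.
- move=> x y /=; rewrite mul1r normrM.
  apply: le_trans (ler_pM _ _ (fa _) (ga _)) _ => //.
  pose M := Num.max `|v x| `|v y|.
  have M0 : 0 <= M by rewrite le_max normr_ge0.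
  apply: (@le_trans _ _ (M `^ a * M `^ (2 - a))).
    by rewrite ler_pM ?powR_ge0// ge0_ler_powR ?nnegrE// ?le_max ?lexx ?orbT// ltW.
  rewrite -powRD; last by rewrite subrKC pnatr_eq0.
  rewrite subrKC powR_mulrn// -(real_normK (num_real (v x))) -(real_normK (num_real (v y))).
  by rewrite /M /Num.max; case: ifP => _; rewrite ?lerDl ?lerDr sqr_ge0.
- move=> x /=; have := increments_ge0 (0, v x) fi gi.
  by rewrite /increments /= f0 g0 !subr0.
- by move=> x y; exact: (increments_ge0 (v x, v y)).
Qed.

End kernel.

Section measures.
Hypothesis E_sep : @separable_space E.
Context (J : {measure set (E * E)%type -> \bar R}) (kill : {measure set E -> \bar R}).
Context (v : E -> R).
Hypothesis mv : measurable_fun setT v.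

Definition measure_energy W := ((2^-1)%:E *
  \int[J]_(z in offdiag) (W (v z.1, v z.2))%:E + \int[kill]_x (W (0%R, v x))%:E)%E.

Let mpair W : measurable_fun setT W ->
  measurable_fun offdiag (fun z : E * E => (W (v z.1, v z.2))%:E).
Proof.
move=> mW; apply/measurable_EFinP; apply: measurable_funTS.
apply: (measurableT_comp mW); apply/measurable_fun_pairP; split => /=.
  exact: measurableT_comp mv measurable_fst.
exact: measurableT_comp mv measurable_snd.
Qed.

Let mkill W : measurable_fun setT W -> measurable_fun setT (fun x => (W (0, v x))%:E).
Proof.
move=> mW; apply/measurable_EFinP.
apply: (measurableT_comp mW); apply/measurable_fun_pairP; split => //=.
exact: measurable_cst.
Qed.

Lemma measure_energy_positive : positive_functional measure_energy.
Proof.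
have moff := measurable_offdiag E_sep.
split => [c W W' c0 mW mW' W0 W'0|W W' mW mW' W0 WW'|]; last first.
- apply: adde_ge0; last exact: integral_ge0.
  by rewrite mule_ge0 ?lee_fin ?invr_ge0//; exact: integral_ge0.
- apply: leeD; last first.
    apply: ge0_le_integral => //.
    + by move=> x _; rewrite lee_fin.
    + exact: mkill.
    + exact: mkill.
    + by move=> x _; rewrite lee_fin.
  rewrite lee_wpmul2l ?lee_fin ?invr_ge0//; apply: ge0_le_integral => //.
  + by move=> x _; rewrite lee_fin.
  + exact: mpair.
  + exact: mpair.
  + by move=> x _; rewrite lee_fin.
- have lin d' (X : measurableType d') (mu : {measure set X -> \bar R}) B (h h' : X -> R) :
      measurable B -> measurable_fun B (EFin \o h) -> measurable_fun B (EFin \o h') ->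
      (forall x, 0 <= h x) -> (forall x, 0 <= h' x) ->
      (\int[mu]_(x in B) (h x + c * h' x)%:E =
       \int[mu]_(x in B) (h x)%:E + c%:E * \int[mu]_(x in B) (h' x)%:E)%E.
    move=> mB mh mh' h0 h'0; under eq_integral do rewrite EFinD EFinM.
    rewrite ge0_integralD//=.
    - by rewrite ge0_integralZl// => x _; rewrite lee_fin.
    - by move=> x _; rewrite lee_fin.
    - by move=> x _; rewrite mule_ge0 ?lee_fin.
    - exact: measurable_funeM.
  rewrite /measure_energy lin//; [|exact: mpair..].
  rewrite lin//; [|exact: mkill..].
  by apply: ereal_combine => //; apply: integral_ge0 => x _; rewrite lee_fin.
Qed.

Lemma measure_energyE D (A Ac : (E -> R) -> (E -> R) -> R) u f g :
  beurling_deny m D A Ac J kill -> qc_modification m D A u v ->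
  continuous f -> continuous g -> f 0 = 0 -> g 0 = 0 -> D (f \o u) -> D (g \o u) ->
  measure_energy (increments f g) = (A (f \o u) (g \o u) - Ac (f \o u) (g \o u))%:E.
Proof.
move=> bd uv cf cg f0 g0 Df Dg.
have [iJ ik ->] := bd_formula bd Df Dg (qc_modification_comp cf f0 uv) (qc_modification_comp cg g0 uv).
have cancel (x y z : R) : x + y + z - x = y + z by ring.
have moff := measurable_offdiag E_sep.
rewrite cancel EFinD EFinM /Rintegral !fineK.
- rewrite /measure_energy; congr (_ * _ + _)%E.
  by apply: eq_integral => x _; rewrite /increments/= f0 g0 !subr0.
- exact: integrable_fin_num ik.
- exact: integrable_fin_num iJ.
Qed.

End measures.
End energies.

(** * The limit of the approximate forms *)

Section clamp_identities.
Context (R : realType).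
Implicit Types (r k s x : R).

Lemma clamp_clamp r k x : 0 <= r -> r <= k -> clamp (- r) r (clamp (- k) k x) = clamp (- r) r x.
Proof.
move=> r0 rk; have rr : - r <= r by lra. have kk : - k <= k by lra.
case: (clampP x kk) => -[? ->] //; [case: (clampP (- k) rr)|case: (clampP k rr)] => -[? ->];
  case: (clampP x rr) => -[? ->]; lra.
Qed.

(** The excess over s is the excess over s/2 taken twice. It is thus a contraction of the latter,
    whose energy is known to be small. *)
Lemma clamp_far s x : 0 <= s ->
  x - clamp (- (s / 2)) (s / 2) x
    - clamp (- (s / 2)) (s / 2) (x - clamp (- (s / 2)) (s / 2) x) = x - clamp (- s) s x.
Proof.
move=> s0; have ss : - s <= s by lra. have hh : - (s / 2) <= s / 2 by lra.
case: (clampP x hh) => -[? ->];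
  [case: (clampP (x - - (s / 2)) hh)|case: (clampP (x - x) hh)|case: (clampP (x - s / 2) hh)] => -[? ->];
  case: (clampP x ss) => -[? ->]; lra.
Qed.

Lemma trunc_idE r s x : 0 <= r -> r <= s ->
  trunc id r s x = clamp (- s) s x - clamp (- r) r x.
Proof.
move=> r0 rs; have rr : - r <= r by lra. have ss : - s <= s by lra.
rewrite /trunc /cut; case: (clampP x rs) => -[? ->]; case: (clampP (- x) rs) => -[? ->];
  case: (clampP x rr) => -[? ->]; case: (clampP x ss) => -[? ->]; lra.
Qed.

End clamp_identities.

Section limit_formula.
Context d (R : realType) (E : borelMetricType d R) (m : {measure set E -> \bar R}).
Hypothesis E_sep : @separable_space E.
Context (D : set (E -> R)) (A : (E -> R) -> (E -> R) -> R).
Hypotheses (dir : dirichlet_form m D A) (reg : regular m D A).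
Context (T : R -> R.-spker E ~> E).
Hypothesis T_sg : semigroup_of m D A T.
Context (Ac : (E -> R) -> (E -> R) -> R).
Context (J : {measure set (E * E)%type -> \bar R}) (kill : {measure set E -> \bar R}).
Hypothesis bd : beurling_deny m D A Ac J kill.
Implicit Types (v : E -> R) (f g : R -> R) (a e k r s : R).

Let F := df_form dir.
Let M := df_markov dir.
Let Fc := bd_local_form bd.
Let Mc := bd_local_markov bd.

Lemma trunc_dom a r s v : 0 < a < 2 -> 0 < r -> r <= s -> D v ->
  D (trunc (fun x => spow x a) r s \o v).
Proof.
move=> a02 r0 rs Dv; have [L L0 fL] := spow_lipschitz_on a02 r0 rs.
have Dcut w : D w -> D (cut (fun x => spow x a) r s \o w).
  by move=> Dw; exact: (cut_dom dir (ltW r0) rs (ltW L0) fL Dw).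
exact: (domB F (Dcut _ Dv) (Dcut _ (domN F Dv))).
Qed.

Lemma trunc_parameters a v e : 0 < a < 2 -> D v -> 0 < e -> exists r k s,
  [/\ 0 < r, 2 * r <= k <= s,
    forall b, k <= b -> 16 * (spow r a * spow b (2 - a) + spow r (2 - a) * spow b a) <= e * b ^+ 2,
    A (clamp (- k) k \o v) (clamp (- k) k \o v) <= e &
    A (fun x => v x - clamp (- (s / 2)) (s / 2) (v x))
      (fun x => v x - clamp (- (s / 2)) (s / 2) (v x)) <= e].
Proof.
move=> a02 Dv e0.
have [N /(_ N (leqnn N)) HN] := clamp_vanish dir T_sg Dv e0.
have [N' HN'] := far_vanish dir T_sg Dv e0.
have [rho [rho0 rho1 small]] := powR_scale_small a02 e0.
have k0 : 0 < N.+1%:R^-1 :> R by rewrite invr_gt0.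
have k1 : N.+1%:R^-1 <= 1 :> R by rewrite invf_le1// ler1n.
(* The level s is doubled because [far_vanish] is applied at s/2, and k <= 1 <= s. *)
exists (rho * N.+1%:R^-1), N.+1%:R^-1, (N'.+1%:R * 2); split => //.
- by rewrite mulr_gt0.
- have N1 : 1 <= N'.+1%:R :> R by rewrite ler1n.
  apply/andP; split; last by move: k1; set k := _^-1; lra.
  by have := ler_wpM2r (ltW k0) rho1; set k := _.+1%:R^-1; lra.
- move=> b kb; have b0 := lt_le_trans k0 kb.
  by rewrite !spow_gt0E ?mulr_gt0//; exact: small.
- by rewrite mulfK ?pnatr_eq0//; apply: HN'.
Qed.

(** The truncated identity differs from [v] by a clamp of the clamp at [k] plus the excess over [s],
    each of energy at most e^2, together at most 4e^2. Young's inequality with weight [e] divides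
    this by [e], whence the squares in the hypotheses; the linear and the quadratic term contribute
    4e each, hence 8. *)
Lemma local_trunc_close v r k s e : 0 < r -> 2 * r <= k -> k <= s -> D v -> 0 < e -> e <= 1 ->
  A (clamp (- k) k \o v) (clamp (- k) k \o v) <= e ^+ 2 ->
  A (fun x => v x - clamp (- (s / 2)) (s / 2) (v x))
    (fun x => v x - clamp (- (s / 2)) (s / 2) (v x)) <= e ^+ 2 ->
  `|Ac (trunc id r s \o v) (trunc id r s \o v) - Ac v v| <= e * (Ac v v + 8).
Proof.
move=> r0 rk ks Dv e0 e1 near far.
have s0 : 0 <= s / 2 by lra.
pose q x := x - clamp (- (s / 2)) (s / 2) x.
have qC : half_contraction q by apply/half_contractionN/half_contraction_clamp.
have rC : half_contraction (clamp (- r) r) by apply: half_contraction_clamp; lra.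
have kC : half_contraction (clamp (- k) k) by apply: half_contraction_clamp; lra.
have [Dk _] := half_contraction_dom M kC Dv; have [Dq _] := half_contraction_dom M qC Dv.
have [Dr Ar] := half_contraction_dom M rC Dk; have [Dqq Aq] := half_contraction_dom M qC Dq.
set X := clamp (- r) r \o (clamp (- k) k \o v) in Dr Ar.
set Y := q \o (q \o v) in Dqq Aq.
have tE : trunc id r s \o v = fun x => v x - (X x + Y x).
  apply/funext => x; rewrite /X /Y /q /= clamp_clamp ?clamp_far ?trunc_idE//; lra.
have DXY := domD F Dr Dqq.
have cX : Ac X X <= e ^+ 2 := le_trans (local_form_le dir reg bd Dr) (le_trans Ar near).
have cY : Ac Y Y <= e ^+ 2 := le_trans (local_form_le dir reg bd Dqq) (le_trans Aq far).
have cXY := form_sqrD_le Fc Dr Dqq.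
rewrite tE (form_sqrB Fc Dv DXY).
have := form_young Fc e0 Dv DXY; set Z := Ac _ (fun x => X x + Y x) in cXY *.
have Z0 : 0 <= Z := sf_form_ge0 Fc DXY.
have Z4 : Z <= 4 * e ^+ 2 by lra.
have Ze : e^-1 * Z <= 4 * e by rewrite ler_pdivrMl//; move: Z4; rewrite expr2; lra.
have Z4e : Z <= 4 * e.
  by apply: le_trans Z4 _; rewrite ler_pM2l// expr2 ler_piMl// ltW.
set p := Ac v _; move=> Y1; rewrite ler_norml.
have := ler_norm p; have := ler_norm (- p); rewrite normrN; move: Y1; set n := `|p|.
by move=> *; apply/andP; split; lra.
Qed.

End limit_formula.

Section power_form_limit.
Context d (R : realType) (E : borelMetricType d R) (m : {measure set E -> \bar R}).
Hypothesis E_sep : @separable_space E.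
Context (D : set (E -> R)) (A : (E -> R) -> (E -> R) -> R).
Hypotheses (dir : dirichlet_form m D A) (reg : regular m D A).
Context (T : R -> R.-spker E ~> E).
Hypothesis T_sg : semigroup_of m D A T.
Context (Ac : (E -> R) -> (E -> R) -> R).
Context (J : {measure set (E * E)%type -> \bar R}) (kill : {measure set E -> \bar R}).
Hypothesis bd : beurling_deny m D A Ac J kill.
Implicit Types (v : E -> R) (f g : R -> R) (a e k r s t : R).

Let F := df_form dir.
Let M := df_markov dir.
Let Fc := bd_local_form bd.

Lemma approx_kernel_energy a v t f g : 0 < t -> 0 < a < 2 -> v \in Lfun m 2%:E ->
  continuous f -> continuous g ->
  {homo f : x y / x <= y} -> {homo g : x y / x <= y} ->
  (forall x, `|f x| <= `|x| `^ a) -> (forall x, `|g x| <= `|x| `^ (2 - a)) ->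
  kernel_energy m (T t) v (increments f g) = (t * approx_form m T (f \o v) (g \o v) t)%:E.
Proof.
move=> t0 a02 v2 cf cg fi gi fa ga.
rewrite (kernel_energyE v2 _ _ a02)//.
- by rewrite /approx_form mulrA mulfV ?gt_eqF// mul1r.
- by move=> f' f'2; have [] := sg_contraction T_sg t0 f'2.
- by move=> f' g' f'2 g'2; exact: (sg_sym T_sg t0).
Qed.

Section fixed_power.
Context (a : R) (v vt : E -> R).
Hypotheses (a02 : 0 < a < 2) (Dv : D v) (vvt : qc_modification m D A v vt).

Local Notation f := (fun x : R => spow x a).
Local Notation g := (fun x : R => spow x (2 - a)).

Let a0 : 0 < a. Proof. by case/andP: a02. Qed.
Let b0 : 0 < 2 - a. Proof. by case/andP: a02; lra. Qed.
Let b02 : 0 < 2 - a < 2. Proof. by case/andP: a02; lra. Qed.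

Let mvt : measurable_fun setT vt. Proof. by case: vvt. Qed.

Let trunc_norm b r s x : 0 < b -> 0 < r -> r <= s ->
  `|trunc (fun x : R => spow x b) r s x| <= `|x| `^ b.
Proof.
move=> b0' r0 rs.
have hi : {homo (fun x : R => spow x b) : x y / x <= y} by apply: spow_homo; exact: ltW.
have hN (y : R) : spow (- y) b = - spow y b by exact: spowN.
have rs' : 0 <= r <= s by rewrite (ltW r0).
wlog x0 : x / 0 <= x.
  move=> wlg; have [/wlg//|/ltW x0] := leP 0 x.
  by rewrite -normrN -(truncN _ r s) -[in leRHS]normrN; apply: wlg; rewrite oppr_ge0.
have := trunc_increment hi hN rs' x0.
rewrite (trunc0 (fun x : R => spow x b) r s) spow0 !subr0 => /andP[t0 tx].
by rewrite ger0_norm// -normr_spow ?gt_eqF// (le_trans tx)// ler_norm.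
Qed.

Let power_norm b (x : R) : 0 < b -> `|spow x b| <= `|x| `^ b.
Proof. by move=> b0'; rewrite normr_spow// gt_eqF. Qed.

(** One pair of levels serves for all [t] and for the jump and killing measures, since all the error
    energies are bounded through [A]. The number 34 is 2 + 32 from [trunc_squeeze]. *)
Let small_energy e : 0 < e -> e <= 1 -> exists r s,
  [/\ 0 < r, r <= s,
   `|Ac (trunc id r s \o v) (trunc id r s \o v) - Ac v v| <= e * (Ac v v + 8),
   (forall t, 0 < t ->
      approx_form m T (trunc f r s \o v) (trunc g r s \o v) t <=
      approx_form m T (f \o v) (g \o v) t <=
      approx_form m T (trunc f r s \o v) (trunc g r s \o v) t + e * (A v v + 34)) &
   exists2 j, measure_energy J kill vt (increments f g) = j%:E &
     A (trunc f r s \o v) (trunc g r s \o v) - Ac (trunc f r s \o v) (trunc g r s \o v)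
     <= j <=
     A (trunc f r s \o v) (trunc g r s \o v) - Ac (trunc f r s \o v) (trunc g r s \o v)
       + e * (A v v + 34)].
Proof.
move=> e0 e1; have ee : e ^+ 2 <= e by rewrite expr2 ler_piMl// ltW.
have ee0 : 0 < e ^+ 2 by rewrite exprn_gt0.
have [r [k [s [r0 /andP[rk ks] small cle fare]]]] := trunc_parameters dir T_sg a02 Dv ee0.
have rs : r <= s by lra.
have s0 : 0 <= s / 2 by lra.
have k0 : 0 <= k by lra.
pose cl := clamp (- k) k; pose far (x : R) := x - clamp (- (s / 2)) (s / 2) x.
have clC : half_contraction cl by exact: half_contraction_clamp.
have farC : half_contraction far by apply/half_contractionN/half_contraction_clamp.
have [Dcl _] := half_contraction_dom M clC Dv; have [Dfar _] := half_contraction_dom M farC Dv.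
have cle' : A (cl \o v) (cl \o v) <= e by exact: le_trans cle ee.
have fare' : A (far \o v) (far \o v) <= e by exact: le_trans fare ee.
have cf : continuous f by exact: continuous_spow.
have cg : continuous g by exact: continuous_spow.
have ccl : continuous cl by exact: continuous_clamp.
have cfar : continuous far.
  by move=> x; apply: cvgB; [exact: cvg_id|exact: continuous_clamp].
have cid : continuous (id : R -> R) by move=> x; exact: cvg_id.
have ctf : continuous (trunc f r s) by exact: continuous_trunc.
have ctg : continuous (trunc g r s) by exact: continuous_trunc.
have fi : {homo f : x y / x <= y} by apply: spow_homo; exact: ltW.
have gi : {homo g : x y / x <= y} by apply: spow_homo; exact: ltW.
have rs' : 0 <= r <= s by rewrite (ltW r0).
have fN (x : R) : spow (- x) a = - spow x a by exact: spowN.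
have gN (x : R) : spow (- x) (2 - a) = - spow x (2 - a) by exact: spowN.
have tfi : {homo trunc f r s : x y / x <= y}.
  by move=> x y /(trunc_increment fi fN rs') /andP[]; rewrite subr_ge0.
have tgi : {homo trunc g r s : x y / x <= y}.
  by move=> x y /(trunc_increment gi gN rs') /andP[]; rewrite subr_ge0.
have cli := half_contraction_homo clC. have fari := half_contraction_homo farC.
have tf0 : trunc f r s 0 = 0 by exact: trunc0.
have tg0 : trunc g r s 0 = 0 by exact: trunc0.
have Dtf : D (trunc f r s \o v) by exact: (trunc_dom dir a02 r0 rs).
have Dtg : D (trunc g r s \o v) by exact: (trunc_dom dir b02 r0 rs).
have fg x y : (spow y a - spow x a) * (spow y (2 - a) - spow x (2 - a)) <= 2 * (y - x) ^+ 2.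
  by case/andP: (spow_increments_bounds x y a02).
have small' b : k <= b -> 16 * (spow r a * spow b (2 - a) + spow r (2 - a) * spow b a) <= e * b ^+ 2.
  by move=> kb; apply: le_trans (small b kb) _; rewrite ler_wpM2r ?sqr_ge0.
have squeeze L (LP : positive_functional L) :=
  trunc_squeeze LP r0 rk ks (ltW e0) cf cg fi fN gi gN fg small'.
have v2 := sf_L2 F Dv.
have contraction_norm (h : R -> R) (x : R) : half_contraction h -> `|h x| <= `|x| `^ 1.
  by move=> hC; have := half_contraction_norm x 0 hC; rewrite hC.1 !subr0 powRr1.
have one02 : 0 < (1 : R) < 2 by rewrite ltr01 ltr1n.
have one : 2 - 1 = 1 :> R by ring.
have Avv := sf_form_ge0 F Dv.
exists r, s; split => //.
- exact: (local_trunc_close dir reg bd r0 rk ks Dv e0 e1 cle fare).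
- move=> t t0; have [] := squeeze _ (kernel_energy_positive (T t) v2).
  rewrite (approx_kernel_energy t0 a02)//; [|by move=> x; exact: trunc_norm..].
  rewrite (approx_kernel_energy t0 a02)//; [|by move=> x; exact: power_norm..].
  rewrite (approx_kernel_energy t0 one02)//; [|by move=> x; rewrite ?one powRr1..].
  rewrite (approx_kernel_energy (f := cl) (g := cl) t0 one02)//; [|by move=> x; rewrite ?one; exact: contraction_norm..].
  rewrite (approx_kernel_energy (f := far) (g := far) t0 one02)//; [|by move=> x; rewrite ?one; exact: contraction_norm..].
  rewrite -!EFinM -!EFinD !lee_fin ler_pM2l// => -> /=.
  have -> (x y z w : R) : t * x + e * (t * y) + 2 * (t * z) + 32 * (t * w) =
    t * (x + e * y + 2 * z + 32 * w) by ring.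
  rewrite ler_pM2l// => /le_trans; apply.
  have A1 := approx_form_le F T_sg Dv t0.
  have A2 := approx_form_le F T_sg Dcl t0.
  have A3 := approx_form_le F T_sg Dfar t0.
  have := ler_wpM2l (ltW e0) A1; rewrite -[id \o v]/v.
  by move: (approx_form m T v v t) A1 A2 A3 => q A1 A2 A3 A4; lra.
have [] := squeeze _ (measure_energy_positive E_sep J kill mvt).
have cl0 : cl 0 = 0 := clC.1. have far0 : far 0 = 0 := farC.1.
rewrite (measure_energyE E_sep bd vvt)//.
rewrite (measure_energyE (f := id) (g := id) E_sep bd vvt)//.
rewrite (measure_energyE (f := cl) (g := cl) E_sep bd vvt)//.
rewrite (measure_energyE (f := far) (g := far) E_sep bd vvt)//.
rewrite -!EFinM -!EFinD.
case: (measure_energy _ _ _ (increments f g)) => // j; rewrite !lee_fin => lo hi.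
exists j => //; rewrite lo /=; apply: le_trans hi _.
have C1 := sf_form_ge0 Fc Dv; have C2 := sf_form_ge0 Fc Dcl; have C3 := sf_form_ge0 Fc Dfar.
have := mulr_ge0 (ltW e0) C1; rewrite -[id \o v]/v.
by move: C1 C2 C3 => C1 C2 C3 C4; lra.
Qed.

Lemma power_energy_fin : measure_energy J kill vt (increments f g) \is a fin_num.
Proof. by have [r [s [_ _ _ _ [j -> _]]]] := small_energy ltr01 (lexx 1). Qed.

Lemma power_form_cvg : approx_form m T (f \o v) (g \o v) @ 0^'+ -->
  a * (2 - a) * Ac v v + fine (measure_energy J kill vt (increments f g)).
Proof.
have Avv := sf_form_ge0 F Dv; have Cvv := sf_form_ge0 Fc Dv.
(* The local part contributes e(Ac v v + 8), the limit for the truncations e, and truncation e(A v v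
   + 34). The last counts once only, as its errors in the approximate form and in the measures have
   the same sign. Now 8 + 1 + 34 < 44. *)
pose C := A v v + Ac v v + 44; have C0 : 0 < C by rewrite /C; lra.
apply/cvgrPdist_lt => eps eps0.
pose e := Num.min 1 (eps / C).
have e0 : 0 < e by rewrite lt_min ltr01 divr_gt0.
have [e1 eC] : e <= 1 /\ e * C <= eps.
  by rewrite -ler_pdivlMr// /e !ge_min !lexx orbT.
have [r [s [r0 rs local squeeze [j jE jb]]]] := small_energy e0 e1.
rewrite jE /=.
have Dtf := trunc_dom dir a02 r0 rs Dv; have Dtg := trunc_dom dir b02 r0 rs Dv.
have chain := trunc_chain dir reg T_sg bd a02 r0 rs Dv.
have c1 : 0 <= a * (2 - a) <= 1 by have := sqr_ge0 (a - 1); move: a0 b0; rewrite expr2; nra.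
have local' : `|a * (2 - a) * Ac (trunc id r s \o v) (trunc id r s \o v) - a * (2 - a) * Ac v v|
    <= e * (Ac v v + 8).
  case/andP: c1 => c0 c1; rewrite -mulrBr normrM (ger0_norm c0).
  by apply: le_trans (ler_piMl _ c1) local.
rewrite -chain in local'.
have /cvgrPdist_lt/(_ _ e0) lim := sg_form T_sg Dtf Dtg.
near=> t.
have t0 : 0 < t by near: t; exact: nbhs_right_gt.
have : `|A (trunc f r s \o v) (trunc g r s \o v)
         - approx_form m T (trunc f r s \o v) (trunc g r s \o v) t| < e by near: t.
have := squeeze t t0; move: jb local'.
set X := approx_form _ _ (trunc _ _ _ \o _) _ _; set Y := approx_form _ _ _ _ _.
set B := A (trunc _ _ _ \o _) _; set B' := Ac (trunc _ _ _ \o _) _.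
set c := a * (2 - a) * Ac v v => jb; rewrite ler_norml => /andP[l1 l2] /andP[h1 h2].
rewrite ltr_norml => /andP[n1 n2]; move: eC; rewrite /C => eC.
rewrite ltr_norml; apply/andP; split; lra.
Unshelve. all: by end_near. Qed.

End fixed_power.
End power_form_limit.

(** * The Sobolev--Bregman form *)

Section power_energy_bounds.
Context (R : realType) (a : R).
Hypothesis a02 : 0 < a < 2.

Local Notation f := (fun x : R => spow x a).
Local Notation g := (fun x : R => spow x (2 - a)).

(** Multiples are reached through [W + c * W']: with W = 0 in the lower bound, where
    [0 <= L (cst 0)] enters, and with W = W' in the upper one. *)
Lemma power_energy_bounds (L : (R * R -> R) -> \bar R) : positive_functional L ->
  ((a * (2 - a))%:E * L (increments id id) <= L (increments f g)
    <= 2%:E * L (increments id id))%E.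
Proof.
move=> [Llin Lle L0]; have /andP[a0 a2] := a02; have b0 : 0 < 2 - a by lra.
have cid : continuous (id : R -> R) by move=> y; exact: cvg_id.
have mi := measurable_increments cid cid.
have mfg : measurable_fun setT (increments f g).
  by apply: measurable_increments; exact: continuous_spow.
have i0 (z : R * R) : 0 <= increments id id z by apply: increments_ge0.
have fg0 z : 0 <= increments f g z by apply: increments_ge0; apply: spow_homo; exact: ltW.
have c0 : 0 <= a * (2 - a) by rewrite mulr_ge0 ?ltW.
have m0 : measurable_fun setT (cst 0 : R * R -> R) by exact: measurable_cst.
have mlin (c : R) (W : R * R -> R) : measurable_fun setT W ->
    measurable_fun setT (fun z => W z + c * increments id id z).
  by move=> mW; apply: measurable_funD => //; apply: measurable_funM; first exact: measurable_cst.
have bounds (z : R * R) : a * (2 - a) * increments id id z <= increments f g z <= 2 * increments id id z.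
  exact: spow_increments_bounds.
apply/andP; split.
  apply: (@le_trans _ _ (L (fun z => cst 0 z + a * (2 - a) * increments id id z))).
    by rewrite Llin// leeDr.
  apply: Lle => // [|z|z]; first exact: mlin.
    by rewrite add0r mulr_ge0.
  by rewrite /= add0r; have /andP[] := bounds z.
rewrite (mule_natl _ 2) mule2n -[X in (_ <= _ + X)%E]mul1e -Llin//.
apply: Lle => //; first exact: mlin.
by move=> z; have /andP[_] := bounds z; rewrite mul1r mulr_natl mulr2n.
Qed.

End power_energy_bounds.

Section sobolev_bregman.
Context d (R : realType) (E : borelMetricType d R) (m : {measure set E -> \bar R}).
Hypothesis E_sep : @separable_space E.
Context (D : set (E -> R)) (A : (E -> R) -> (E -> R) -> R).
Hypotheses (dir : dirichlet_form m D A) (reg : regular m D A).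
Context (T : R -> R.-spker E ~> E).
Hypothesis T_sg : semigroup_of m D A T.
Context (Ac : (E -> R) -> (E -> R) -> R).
Context (J : {measure set (E * E)%type -> \bar R}) (kill : {measure set E -> \bar R}).
Hypothesis bd : beurling_deny m D A Ac J kill.
Context (p : R).
Hypothesis p1 : 1 < p.
Implicit Types u v ut vt : E -> R.

Let F := df_form dir.
Let a := 2 / p.
Let c := 4 * (p - 1) / p ^+ 2.

Local Notation f := (fun x : R => spow x a).
Local Notation g := (fun x : R => spow x (2 - a)).

Let p0 : 0 < p. Proof. exact: lt_trans ltr01 p1. Qed.

Let pN0 : p != 0. Proof. by rewrite gt_eqF. Qed.

Let a02 : 0 < a < 2.
Proof. by rewrite /a divr_gt0//= ltr_pdivrMr// ltr_pMr. Qed.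

Let cE : c = a * (2 - a).
Proof. by rewrite /c /a; field. Qed.

Let c0 : 0 < c.
Proof. by rewrite cE; case/andP: a02 => *; rewrite mulr_gt0// subr_gt0. Qed.

Let fK u : f \o fspow u (p / 2) = u.
Proof.
apply/funext => x; rewrite /= /fspow spow_spow /a.
by rewrite (_ : p / 2 * (2 / p) = 1) ?spow1//; field.
Qed.

Let gK u : g \o fspow u (p / 2) = fspow u (p - 1).
Proof.
apply/funext => x; rewrite /= /fspow spow_spow /a.
by congr spow; field.
Qed.

Let sb_qc u ut : qc_modification m D A u ut ->
  qc_modification m D A (fspow u (p / 2)) (fspow ut (p / 2)).
Proof.
apply: (@qc_modification_comp _ _ _ _ _ _ (fun x => spow x (p / 2))); last exact: spow0.
by apply: continuous_spow; rewrite divr_gt0.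
Qed.

Lemma Lfun_fspow u : u \in Lfun m p%:E -> fspow u (p / 2) \in Lfun m 2%:E.
Proof.
move=> up; apply/Lfun2P; split.
  have mh : measurable_fun setT (fun x : R => spow x (p / 2)).
    by apply: continuous_measurable_fun; apply: continuous_spow; rewrite divr_gt0.
  exact: measurableT_comp mh (Lfun_measurable up).
have /integrableP[_] := Lfun_integrable (ltW p1) up.
congr (_ < _)%E; apply: eq_integral => x _ /=.
rewrite ger0_norm ?powR_ge0// -real_normK ?num_real// normr_spow; last by rewrite mulf_neq0 ?invr_neq0.
by rewrite -powR_mulrn ?powR_ge0// -powRrM divfK.
Qed.

Lemma measure_energy_sb ut : measure_energy J kill (fspow ut (p / 2)) (increments f g) =
  ((2^-1)%:E * sb_jump J p ut + sb_kill kill p ut)%E.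
Proof.
have fx x : spow (fspow ut (p / 2) x) a = ut x := congr1 (@^~ x) (fK ut).
have gx x : spow (fspow ut (p / 2) x) (2 - a) = fspow ut (p - 1) x := congr1 (@^~ x) (gK ut).
rewrite /measure_energy /sb_jump /sb_kill; congr (_ * _ + _)%E.
  by apply: eq_integral => z _; rewrite /increments /jump_integrand /= !fx !gx.
apply: eq_integral => x _; rewrite /increments /= !spow0 !subr0 fx gx /fspow.
by rewrite -{1}(spow1 (ut x)) spowM ?(subrKC p 1)// subrKC.
Qed.

Let approxE u : approx_form m T u (fspow u (p - 1)) =
  approx_form m T (f \o fspow u (p / 2)) (g \o fspow u (p / 2)).
Proof. by rewrite fK gK. Qed.

(** When the approximate forms on the right converge, this bounds those of u^<p/2>, and
    [dom_of_bounded] applies. *)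
Lemma approx_sb_ge u t : fspow u (p / 2) \in Lfun m 2%:E -> 0 < t ->
  c * approx_form m T (fspow u (p / 2)) (fspow u (p / 2)) t
    <= approx_form m T u (fspow u (p - 1)) t.
Proof.
move=> v2 t0; have /andP[a0 a2] := a02; have b0 : 0 < 2 - a by lra.
have cid : continuous (id : R -> R) by move=> y; exact: cvg_id.
have one02 : 0 < (1 : R) < 2 by rewrite ltr01 ltr1n.
have one : 2 - 1 = 1 :> R by ring.
have idn (x : R) : `|x| <= `|x| `^ 1 by rewrite powRr1.
have idn' (x : R) : `|x| <= `|x| `^ (2 - 1) by rewrite one.
have /andP[+ _] := power_energy_bounds a02 (kernel_energy_positive (T t) v2).
rewrite (approx_kernel_energy T_sg (f := id) (g := id) t0 one02 v2)//.
rewrite (approx_kernel_energy T_sg t0 a02 v2)//.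
- by rewrite approxE -EFinM lee_fin cE mulrCA ler_pM2l.
- exact: continuous_spow.
- exact: continuous_spow.
- by apply: spow_homo; exact: ltW.
- by apply: spow_homo; exact: ltW.
- by move=> x; rewrite normr_spow// gt_eqF.
- by move=> x; rewrite normr_spow// gt_eqF.
Qed.

Lemma sb_form_cvg u ut : D (fspow u (p / 2)) -> qc_modification m D A u ut ->
  [/\ measure_energy J kill (fspow ut (p / 2)) (increments f g) \is a fin_num &
   approx_form m T u (fspow u (p - 1)) @ 0^'+ -->
     c * Ac (fspow u (p / 2)) (fspow u (p / 2)) +
     fine (measure_energy J kill (fspow ut (p / 2)) (increments f g))].
Proof.
move=> Dv /sb_qc uut; split; first exact: (power_energy_fin E_sep dir reg T_sg bd a02 Dv uut).
by rewrite approxE cE; exact: (power_form_cvg E_sep dir reg T_sg bd a02 Dv uut).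
Qed.

(** The power [a] undoes the power p/2 and is continuous, so it turns a modification of u^<p/2> into
    one of u. *)
Let fspow_qc_exists u : D (fspow u (p / 2)) -> exists ut, qc_modification m D A u ut.
Proof.
move=> Dv; have [vt vvt] := qc_modification_exists dir reg Dv.
exists (f \o vt); rewrite -[X in qc_modification _ _ _ X]fK.
apply: qc_modification_comp vvt; last exact: spow0.
by apply: continuous_spow; case/andP: a02.
Qed.

Lemma sb_domP u : sb_dom m T p u <-> u \in Lfun m p%:E /\ D (fspow u (p / 2)).
Proof.
split=> [[up /cvg_ex[l ul]]|[up Dv]]; last first.
  split => //; have [ut uut] := fspow_qc_exists Dv.
  by have [_ cv] := sb_form_cvg Dv uut; apply/cvg_ex; eexists; exact: cv.
split => //; have v2 := Lfun_fspow up.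
apply: (dom_of_bounded T_sg (c := c^-1 * (l + 1)) v2); near=> t.
have t0 : 0 < t by near: t; exact: nbhs_right_gt.
rewrite ler_pdivlMl//; apply: le_trans (approx_sb_ge v2 t0) _.
near: t; apply: (cvgr_le _ ul); lra.
Unshelve. all: by end_near. Qed.

Lemma sb_qc_exists u : sb_dom m T p u -> exists ut, qc_modification m D A u ut.
Proof. by move=> /sb_domP[_ /fspow_qc_exists]. Qed.

(** The comparison of energies is applied to the jump and killing part A - Ac only; the local part
    enters with the exact factor [c], and c <= 2. *)
Lemma sb_form_bounds u : sb_dom m T p u ->
  c * A (fspow u (p / 2)) (fspow u (p / 2)) <= sb_form m T p u
    <= 2 * A (fspow u (p / 2)) (fspow u (p / 2)).
Proof.
move=> /sb_domP[up Dv]; have [ut uut] := fspow_qc_exists Dv.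
have [fin cv] := sb_form_cvg Dv uut; rewrite /sb_form (cvg_lim _ cv)//.
have mv : measurable_fun setT (fspow ut (p / 2)) by have [] := sb_qc uut.
have := power_energy_bounds a02 (measure_energy_positive E_sep J kill mv).
have cid : continuous (id : R -> R) by move=> y; exact: cvg_id.
rewrite (measure_energyE E_sep (f := id) (g := id) bd (sb_qc uut))//.
rewrite -[measure_energy _ _ _ _]fineK// -!EFinM !lee_fin -cE => /andP[].
set v := fspow u _; set j := fine _; rewrite -[id \o v]/v => lo hi.
have C0 := sf_form_ge0 (bd_local_form bd) Dv.
have c1 : c * Ac v v <= 2 * Ac v v.
  rewrite ler_wpM2r// cE; have := sqr_ge0 (a - 1); rewrite expr2; lra.
rewrite mulrBr in lo; move: lo hi c1; set x := c * A v v; set y := c * Ac v v => lo hi c1 /=.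
by apply/andP; split; lra.
Qed.

Lemma sb_formE u ut : sb_dom m T p u -> qc_modification m D A u ut ->
  (sb_form m T p u)%:E =
    ((c * Ac (fspow u (p / 2)) (fspow u (p / 2)))%:E
     + (2^-1)%:E * sb_jump J p ut + sb_kill kill p ut)%E.
Proof.
move=> /sb_domP[up Dv] uut; have [fin cv] := sb_form_cvg Dv uut.
by rewrite /sb_form (cvg_lim _ cv)// EFinD fineK// measure_energy_sb addeA.
Qed.

Let sb_jump_ge0 ut z : 0 <= jump_integrand ut (fspow ut (p - 1)) z.
Proof.
have /andP[a0 a2] := a02.
have := @increments_ge0 _ f g (fspow ut (p / 2) z.1, fspow ut (p / 2) z.2).
rewrite /increments /=.
have fx x : spow (fspow ut (p / 2) x) a = ut x := congr1 (@^~ x) (fK ut).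
have gx x : spow (fspow ut (p / 2) x) (2 - a) = fspow ut (p - 1) x := congr1 (@^~ x) (gK ut).
by rewrite !fx !gx; apply; apply: spow_homo; lra.
Qed.

Lemma sb_energies_fin u ut : sb_dom m T p u -> qc_modification m D A u ut ->
  (sb_jump J p ut < +oo)%E /\ (sb_kill kill p ut < +oo)%E.
Proof.
move=> /sb_domP[up Dv] uut; have [] := sb_form_cvg Dv uut.
have j0 : (0 <= sb_jump J p ut)%E by apply: integral_ge0 => z _; rewrite lee_fin.
have k0 : (0 <= sb_kill kill p ut)%E by apply: integral_ge0 => z _; rewrite lee_fin powR_ge0.
rewrite measure_energy_sb => + _; move: j0 k0.
case: (sb_jump _ _ _) => [j| |]//; case: (sb_kill _ _ _) => [k| |]//.
- by rewrite !ltry.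
- by rewrite gt0_muley.
- by rewrite gt0_muley.
Qed.

(** [power_energy_bounds] holds for the energy of any measurable function, so it carries finiteness
    from the integrals of u to those of the squares for u^<p/2>, the ones that maximality speaks
    of. *)
Lemma maximal_sb_dom u ut : maximally_defined m D A J kill -> u \in Lfun m p%:E ->
  qc_modification m D A u ut -> (sb_jump J p ut < +oo)%E -> (sb_kill kill p ut < +oo)%E ->
  sb_dom m T p u.
Proof.
move=> maxi up uut jfin kfin; apply/sb_domP; split => //; apply: maxi; first exact: Lfun_fspow.
have vvt := sb_qc uut; have mv : measurable_fun setT (fspow ut (p / 2)) by have [] := vvt.
have /andP[+ _] := power_energy_bounds a02 (measure_energy_positive E_sep J kill mv).
rewrite measure_energy_sb -cE => bound.
have fin : (measure_energy J kill (fspow ut (p / 2)) (increments id id) < +oo)%E.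
  rewrite -(@lte_pmul2l _ c%:E) ?lte_fin// gt0_muley ?lte_fin//.
  apply: le_lt_trans bound _; rewrite lte_add_pinfty// lte_mul_pinfty ?lee_fin ?invr_ge0//.
exists (fspow ut (p / 2)); move: fin; rewrite /measure_energy.
have -> : (fun x => (increments id id (0, fspow ut (p / 2) x))%:E) =
    (fun x => (fspow ut (p / 2) x ^+ 2)%:E).
  by apply/funext => x; rewrite /increments /= !subr0 expr2.
have -> : (fun z : E * E => (increments id id (fspow ut (p / 2) z.1, fspow ut (p / 2) z.2))%:E) =
    (fun z => ((fspow ut (p / 2) z.2 - fspow ut (p / 2) z.1) ^+ 2)%:E).
  by apply/funext => z; rewrite /increments /= expr2.
set j := (\int[J]_(z in _) _)%E; set k := (\int[kill]_x _)%E.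
have j0 : (0 <= j)%E by apply: integral_ge0 => z _; rewrite lee_fin sqr_ge0.
have k0 : (0 <= k)%E by apply: integral_ge0 => z _; rewrite lee_fin sqr_ge0.
move: j0 k0; case: j => [j| |]//; case: k => [k| |]// _ _; rewrite ?gt0_muley//.
by split => //; exact: ltry.
Qed.

End sobolev_bregman.

Theorem theorem1p1 (d : measure_display) (R : realType)
    (E : borelMetricType d R)
    (E_lc : locally_compact [set: E]) (E_sep : @separable_space E)
    (m : {measure set E -> \bar R})
    (m_radon : radon_on m measurable setT) (m_full : full_support m)
    (D : set (E -> R)) (A : (E -> R) -> (E -> R) -> R)
    (A_dir : dirichlet_form m D A) (A_reg : regular m D A)
    (T : R -> R.-spker E ~> E) (T_sg : semigroup_of m D A T)
    (Ac : (E -> R) -> (E -> R) -> R)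
    (J : {measure set (E * E)%type -> \bar R})
    (k : {measure set E -> \bar R})
    (A_bd : beurling_deny m D A Ac J k)
    (p : R) (p1 : 1 < p) :
  [/\ (forall u : E -> R,
        sb_dom m T p u <-> u \in Lfun m p%:E /\ D (fspow u (p / 2))),
      (forall u : E -> R, sb_dom m T p u ->
        4 * (p - 1) / p ^+ 2 * A (fspow u (p / 2)) (fspow u (p / 2))
          <= sb_form m T p u
          <= 2 * A (fspow u (p / 2)) (fspow u (p / 2))),
      (forall u ut : E -> R, sb_dom m T p u -> qc_modification m D A u ut ->
        (sb_form m T p u)%:E =
          ((4 * (p - 1) / p ^+ 2
             * Ac (fspow u (p / 2)) (fspow u (p / 2)))%:E
           + (2^-1)%:E * sb_jump J p ut + sb_kill k p ut)%E),
      (forall u : E -> R, sb_dom m T p u -> exists ut : E -> R,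
        [/\ qc_modification m D A u ut,
            (sb_jump J p ut < +oo)%E & (sb_kill k p ut < +oo)%E]) &
      (maximally_defined m D A J k -> forall u : E -> R,
        u \in Lfun m p%:E ->
        (exists ut : E -> R,
          [/\ qc_modification m D A u ut,
              (sb_jump J p ut < +oo)%E & (sb_kill k p ut < +oo)%E]) ->
        sb_dom m T p u)].
Proof.
split.
- exact: (sb_domP E_sep A_dir A_reg T_sg A_bd p1).
- exact: (sb_form_bounds E_sep A_dir A_reg T_sg A_bd p1).
- exact: (sb_formE E_sep A_dir A_reg T_sg A_bd p1).
- move=> u Du; have [ut uut] := sb_qc_exists E_sep A_dir A_reg T_sg A_bd p1 Du.
  exists ut; have [jfin kfin] := sb_energies_fin E_sep A_dir A_reg T_sg A_bd p1 Du uut.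
  by split.
move=> maxi u up [ut [uut jfin kfin]].
exact: (maximal_sb_dom E_sep A_dir A_reg T_sg A_bd p1 maxi up uut jfin kfin).
Qed.
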